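(* Suppose the following hold for the federated compositional problem and the FedCoMuon algorithm described in the context. (1) $F_*:=\inf_{W\in\mathbb R^{m\times n}}F(W)>-\infty$. (2) There are constants $\sigma_g,\sigma_{\nabla g},\sigma_f>0$ such that for all $k\in[K]$, $W\in\mathbb R^{m\times n}$, $y\in\mathbb R^d$: $\mathbb E_{\xi^k}[g^k(W;\xi^k)]=g^k(W)$, $\mathbb E_{\xi^k}[\nabla g^k(W;\xi^k)]=\nabla g^k(W)$, $\mathbb E_{\zeta^k}[\nabla_y f^k(y;\zeta^k)]=\nabla_y f^k(y)$, $\mathbb E_{\xi^k}\|g^k(W;\xi^k)-g^k(W)\|^2\le\sigma_g^2$, $\mathbb E_{\xi^k}\|\nabla g^k(W;\xi^k)-\nabla g^k(W)\|_F^2\le\sigma_{\nabla g}^2$, $\mathbb E_{\zeta^k}\|\nabla_y f^k(y;\zeta^k)-\nabla_y f^k(y)\|^2\le\sigma_f^2$; the samples are independent across clients and iterations, and $\xi^k$ is independent of $\zeta^k$. (3) There are constants $C_g,C_f>0$ such that for all $k,W,y$: $\mathbb E_{\xi^k}\|\nabla g^k(W;\xi^k)\|_F^2\le C_g^2$ and $\mathbb E_{\zeta^k}\|\nabla_y f^k(y;\zeta^k)\|^2\le C_f^2$. (4) There are constants $L_g,L_f$ such that for all $k$, $W_1,W_2$, $y_1,y_2$: $\|\nabla g^k(W_1)-\nabla g^k(W_2)\|_F\le L_g\|W_1-W_2\|_F$ and $\|\nabla_y f^k(y_1)-\nabla_y f^k(y_2)\|\le L_f\|y_1-y_2\|$.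 (5) There is $\delta\ge0$ such that for all $W$: $\frac1K\sum_{k=1}^K\|\nabla F^k(W)-\nabla F(W)\|_F^2\le\delta^2$. Let $L_F=C_fL_g+C_g^2L_f$, and let $\{W_t^k,u_t^k,M_t^k\}$ be generated by FedCoMuon with $\eta>0$, $0<\alpha,\beta<1$ and $\alpha\tau\le1$. Then for every integer $T\ge1$, $$\begin{aligned} \frac1T\sum_{t=0}^{T-1}\mathbb E\|\nabla F(\bar W_t)\|_F \le{}&\frac{F(\bar W_0)-F_*}{\eta T}+\frac{2\sqrt n\,C_gL_f\sigma_g}{\beta T}+2\sqrt n\Bigl(\frac1{\beta T}+2\beta\tau\Bigr)\bigl(C_g\sigma_f+C_f\sigma_{\nabla g}\bigr)\\ &+2\sqrt n\,C_gL_f(1+2\beta\tau)\Bigl(\frac{4\sigma_g^2}{\alpha T}+\frac{86C_g^2n}{\alpha^2}\eta^2+86\alpha\sigma_g^2\Bigr)^{1/2}\\ &+\eta nL_F\Bigl(\frac12+4\tau+\frac6\beta+8\beta\tau^2\Bigr)+2\sqrt n\,\beta\tau\delta+\frac{2\sqrt{n\beta}}{\sqrt K}\sqrt{C_g^2\sigma_f^2+C_f^2\sigma_{\nabla g}^2}. \end{aligned}$$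
   Context: Problem. Let $K,m,n,d\ge1$ be integers, $[K]=\{1,\dots,K\}$. For each $k\in[K]$ let $\mathcal D_g^k,\mathcal D_f^k$ be probability distributions, and let $g^k(W;\xi)\in\mathbb R^d$ ($W\in\mathbb R^{m\times n}$, $\xi\sim\mathcal D_g^k$) and $f^k(y;\zeta)\in\mathbb R$ ($y\in\mathbb R^d$, $\zeta\sim\mathcal D_f^k$) be differentiable in $W$, resp. $y$. Put $g^k(W)=\mathbb E_\xi[g^k(W;\xi)]$, $f^k(y)=\mathbb E_\zeta[f^k(y;\zeta)]$ (also differentiable), $F^k(W)=f^k(g^k(W))$, $F(W)=\frac1K\sum_{k=1}^KF^k(W)$. $\|\cdot\|$ is the Euclidean norm of vectors, $\|\cdot\|_F$ the Frobenius norm, $\otimes$ the Kronecker product. The Jacobian $\nabla g^k(W)$ is the $m\times nd$ matrix $[\nabla g^k_1(W),\dots,\nabla g^k_d(W)]$ of the $m\times n$ gradients of the components (similarly for $\nabla g^k(W;\xi)$), so that $\nabla g^k(W)(v\otimes I_n)=\sum_{i=1}^d v_i\nabla g_i^k(W)$ for $v\in\mathbb R^d$ and $\nabla F^k(W)=\nabla g^k(W)(\nabla_yf^k(g^k(W))\otimes I_n)$. FedCoMuon algorithm. Inputs: $\eta>0$, $\alpha,\beta\in[0,1)$, integer $\tau\ge1$, deterministic $W_0\in\mathbb R^{m\times n}$. Initialization: draw $\xi_0^k\sim\mathcal D_g^k$, $\zeta_0^k\sim\mathcal D_f^k$; set $W_0^k=W_0$, $u_0^k=g^k(W_0;\xi_0^k)$,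 and, for all $k$, $M_0^k=\frac1K\sum_{j=1}^K\nabla g^j(W_0;\xi_0^j)(\nabla_yf^j(u_0^j;\zeta_0^j)\otimes I_n)$. For $t=0,1,2,\dots$, each client $k$ takes a compact singular value decomposition $M_t^k=U_t^k\Sigma_t^k(V_t^k)^\top$ (only nonzero singular values), sets $\tilde W_{t+1}^k=W_t^k-\eta U_t^k(V_t^k)^\top$, draws fresh independent $\xi_{t+1}^k\sim\mathcal D_g^k$, $\zeta_{t+1}^k\sim\mathcal D_f^k$, and sets $u_{t+1}^k=\alpha g^k(\tilde W_{t+1}^k;\xi_{t+1}^k)+(1-\alpha)u_t^k$, $G_{t+1}^k=\nabla g^k(\tilde W_{t+1}^k;\xi_{t+1}^k)(\nabla_yf^k(u_{t+1}^k;\zeta_{t+1}^k)\otimes I_n)$, $\tilde M_{t+1}^k=\beta G_{t+1}^k+(1-\beta)M_t^k$. If $\tau$ divides $t+1$, then $W_{t+1}^k=\frac1K\sum_j\tilde W_{t+1}^j$ and $M_{t+1}^k=\frac1K\sum_j\tilde M_{t+1}^j$ for all $k$ (the $u$'s are not averaged); otherwise $W_{t+1}^k=\tilde W_{t+1}^k$, $M_{t+1}^k=\tilde M_{t+1}^k$. Write $\bar W_t=\frac1K\sum_kW_t^k$, $\bar M_t=\frac1K\sum_kM_t^k$. $\mathbb E$ is over all samples. *)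

(* Defs.v *)
From mathcomp Require Export all_boot all_order all_algebra.
From mathcomp Require Export mxtens.
From mathcomp Require Export all_classical all_reals all_analysis.
Export Order.TTheory GRing.Theory Num.Theory.
Export numFieldNormedType.Exports.

Set Implicit Arguments.
Unset Strict Implicit.
Unset Printing Implicit Defensive.

Local Open Scope classical_set_scope.
Local Open Scope ring_scope.

(* On column vectors this is the Euclidean norm.  The library norm [`|A|] on
   matrices is the max norm; it is used only through the notion of
   differentiability, which does not depend on the choice of a norm. *)
Definition frob (R : realType) (m n : nat) (A : 'M[R]_(m, n)) : R :=
  Num.sqrt (\sum_i \sum_j A i j ^+ 2).

Definition grad (R : realType) (m n : nat) (h : 'M[R]_(m, n) -> R)
    (W : 'M[R]_(m, n)) : 'M[R]_(m, n) :=
  \matrix_(i, j) 'D_(delta_mx i j) h W.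

(* The m x dn block row [grad h_1, ..., grad h_d]; [mxtens_unindex] splits a
   column index into its block number and its column inside the block. *)
Definition jac (R : realType) (m n d : nat) (h : 'M[R]_(m, n) -> 'cV[R]_d)
    (W : 'M[R]_(m, n)) : 'M[R]_(m, d * n) :=
  \matrix_(i, j) grad (fun V => h V (mxtens_unindex j).1 0) W
                      i (mxtens_unindex j).2.

(* The Kronecker product of v with I_n; the cast replaces the width 1 * n
   by n. *)
Definition kron_id (R : realType) (d : nat) (n : nat) (v : 'cV[R]_d) :
    'M[R]_(d * n, n) :=
  castmx (erefl, mul1n n) (tensmx v (1%:M : 'M[R]_n)).

Lemma jac_kron_id (R : realType) (m n d : nat)
    (h : 'M[R]_(m, n) -> 'cV[R]_d) (W : 'M[R]_(m, n)) (v : 'cV[R]_d) :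
  jac h W *m kron_id n v = \sum_i v i 0 *: grad (fun V => h V i 0) W.
Proof.
apply/matrixP => a b; rewrite !mxE summxE.
have -> : \sum_j jac h W a j * kron_id n v j b =
    \sum_(p : 'I_d * 'I_n) grad (fun V => h V p.1 0) W a p.2 *
                           (v p.1 0 * (p.2 == b)%:R).
  rewrite (reindex (@mxtens_unindex d n)) /=; last first.
    by exists (@mxtens_index d n) => i _; rewrite (mxtens_indexK, mxtens_unindexK).
  apply: eq_bigr => j _; rewrite [jac _ _ _ _]mxE /kron_id castmxE !mxE /=.
  rewrite ord1; congr (_ * (v _ _ * _%:R)); first exact: val_inj.
  by rewrite -!val_eqE /= [(b %% n)%N]modn_small.
rewrite -(pair_bigA _ (fun i j => grad (fun V => h V i 0) W a j *
                                  (v i 0 * (j == b)%:R))) /=.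
apply: eq_bigr => i _; rewrite (bigD1 b) //= eqxx mulr1 big1 ?addr0.
  by rewrite !mxE mulrC.
by move=> j /negbTE ->; rewrite !mulr0.
Qed.

Definition avg (R : realType) (K m n : nat) (A : 'I_K -> 'M[R]_(m, n)) :
    'M[R]_(m, n) :=
  K%:R^-1 *: \sum_k A k.

Section objective.
Context (R : realType) (K m n d : nat).
Variables (g : 'I_K -> 'M[R]_(m, n) -> 'cV[R]_d) (f : 'I_K -> 'cV[R]_d -> R).

Definition client_obj (k : 'I_K) (W : 'M[R]_(m, n)) : R := f k (g k W).

Definition obj (W : 'M[R]_(m, n)) : R :=
  K%:R^-1 * \sum_k client_obj k W.

End objective.

(* Entrywise expectation of a random matrix; integrability is part of the
   claim that the expectation exists. *)
Definition has_mean (R : realType) (dX : measure_display)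
    (X : measurableType dX) (D : probability X R) (m n : nat)
    (h : X -> 'M[R]_(m, n)) (A : 'M[R]_(m, n)) : Prop :=
  forall i j, D.-integrable setT (EFin \o (fun x => h x i j)) /\
              ('E_D[fun x => h x i j] = (A i j)%:E)%E.

(* Mutual independence of a family of sets of events: the product rule over
   every finite subfamily. *)
Definition mutually_independent (R : realType) (dO : measure_display)
    (O : measurableType dO) (P : probability O R) (I : choiceType)
    (E : I -> set (set O)) : Prop :=
  forall (s : seq I) (A : I -> set O), uniq s ->
    (forall i, i \in s -> E i (A i)) ->
    P (\bigcap_(i in [set` s]) A i) = (\prod_(i <- s) P (A i))%E.

(* Events generated by the individual samples: [inl (t, k)] stands for
   [xi t k] and [inr (t, k)] for [zeta t k]. *)
Definition sample_events (R : realType) (dO dX dZ : measure_display)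
    (O : measurableType dO) (P : probability O R) (K : nat)
    (X : 'I_K -> measurableType dX) (Z : 'I_K -> measurableType dZ)
    (xi : forall (t : nat) (k : 'I_K), {RV P >-> X k})
    (zeta : forall (t : nat) (k : 'I_K), {RV P >-> Z k})
    (i : (nat * 'I_K) + (nat * 'I_K)) : set (set O) :=
  match i with
  | inl (t, k) => preimage_set_system setT (xi t k) measurable
  | inr (t, k) => preimage_set_system setT (zeta t k) measurable
  end.

Definition compact_svd (R : realType) (m n r : nat) (M : 'M[R]_(m, n))
    (U : 'M[R]_(m, r)) (s : 'rV[R]_r) (V : 'M[R]_(n, r)) : Prop :=
  [/\ U^T *m U = 1%:M, V^T *m V = 1%:M, (forall i, 0 < s 0 i) &
      M = U *m diag_mx s *m V^T].

Section algorithm.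
Context (R : realType) (K m n d : nat) (X Z : 'I_K -> Type).
Variables (g : forall k, 'M[R]_(m, n) -> X k -> 'cV[R]_d).
Variables (f : forall k, 'cV[R]_d -> Z k -> R).

Definition sgrad (k : 'I_K) (W : 'M[R]_(m, n)) (u : 'cV[R]_d)
    (x : X k) (z : Z k) : 'M[R]_(m, n) :=
  jac (fun V => g V x) W *m kron_id n (grad (fun y => f y z) u).

(* One trajectory, i.e. for one realization [x], [z] of all the samples.
   [Wt] and [Mt] are the local iterates before the synchronization step; their
   values at time 0 are irrelevant.  The decomposition, including its rank r,
   may be chosen differently at each step. *)
Record FedCoMuon (eta alpha beta : R) (tau : nat) (W0 : 'M[R]_(m, n))
    (x : nat -> forall k, X k) (z : nat -> forall k, Z k)
    (W Wt : nat -> 'I_K -> 'M[R]_(m, n)) (u : nat -> 'I_K -> 'cV[R]_d)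
    (M Mt : nat -> 'I_K -> 'M[R]_(m, n)) : Prop := {
  init_W : forall k, W 0%N k = W0;
  init_u : forall k, u 0%N k = g W0 (x 0%N k);
  init_M : forall k,
    M 0%N k = avg (fun j => sgrad W0 (u 0%N j) (x 0%N j) (z 0%N j));
  step_W : forall t k, exists r (U : 'M[R]_(m, r)) (s : 'rV[R]_r)
                              (V : 'M[R]_(n, r)),
    compact_svd (M t k) U s V /\ Wt t.+1 k = W t k - eta *: (U *m V^T);
  step_u : forall t k,
    u t.+1 k = alpha *: g (Wt t.+1 k) (x t.+1 k) + (1 - alpha) *: u t k;
  step_M : forall t k,
    Mt t.+1 k =
      beta *: sgrad (Wt t.+1 k) (u t.+1 k) (x t.+1 k) (z t.+1 k)
      + (1 - beta) *: M t k;
  sync_W : forall t k,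
    W t.+1 k = if (tau %| t.+1)%N then avg (Wt t.+1) else Wt t.+1 k;
  sync_M : forall t k,
    M t.+1 k = if (tau %| t.+1)%N then avg (Mt t.+1) else Mt t.+1 k
}.

End algorithm.

(* Main.v *)
From HB Require Import structures.
Require Import Defs.
From mathcomp Require Import measurable_realfun.
From mathcomp Require Import ring lra.

(* Along each trajectory the polar factor U V^T of M satisfies
   <M, U V^T> >= |M|_F and |U V^T|_F <= sqrt n, so the descent lemma for the
   L_F-smooth F gives
     eta |dF(Wbar_t)| <= F(Wbar_t) - F(Wbar_{t+1})
       + 2 sqrt n eta (|Mbar_t - dF(Wbar_t)| + avg_k |M_t^k - Mbar_t|)
       + eta^2 n L_F / 2.
   A stochastic gradient splits into dF^k, a conditionally centered noise and a
   bias controlled by the inner error u - g.  The exponential averages of the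
   noises are sums of orthogonal increments, which yields their second moments;
   everything else is bounded pathwise, using that all clients stay within
   2 eta tau sqrt n of each other.  Comparing u_t with g(Wbar_t) instead of
   g(W~_t) makes the synchronization jumps harmless, since alpha tau <= 1.
   Conditional expectations are replaced by Fubini on sigma(S) x (law of one
   sample outside S); this needs the iterates to be measurable, hence U V^T to be
   a measurable function of M, which holds because it is the limit of the
   Newton-Schulz iteration. *)

Set Implicit Arguments.
Unset Strict Implicit.
Unset Printing Implicit Defensive.

Local Open Scope classical_set_scope.
Local Open Scope ring_scope.

(** * Frobenius geometry *)

(** The obstacle is that client k uses one sample [xi t k] both in [u t k] and in the Jacobian that
    multiplies the outer gradient at [u t k], so these two factors are correlated. The Jacobian
    noise is therefore paired with the outer gradient at the exact inner value, which depends on the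
    past only, while the outer noise is centered given everything except [zeta t k]. What remains,
    the stochastic Jacobian times the change of outer gradient from the exact inner value to
    [u t k], is the bias; Cauchy-Schwarz in L2 separates its two factors, so their correlation does
    no harm. The terms in 1 / (beta T) are the first moments of the noise and bias at time 0, which
    the momentum forgets at rate beta. The argument yields 2, 50, 2 under the square root, where the
    statement has 4, 86, 86, and 2 / beta where it has 6 / beta; the other constants come out
    exactly. *)

Section frobenius.
Context {R : realType}.
Implicit Types m n p r : nat.

Definition dot m n (A B : 'M[R]_(m, n)) : R := \sum_i \sum_j A i j * B i j.

Lemma dotC m n (A B : 'M[R]_(m, n)) : dot A B = dot B A.
Proof. by apply: eq_bigr => i _; apply: eq_bigr => j _; rewrite mulrC. Qed.

Lemma dotDl m n (A B C : 'M[R]_(m, n)) : dot (A + B) C = dot A C + dot B C.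
Proof.
rewrite -big_split; apply: eq_bigr => i _; rewrite -big_split.
by apply: eq_bigr => j _; rewrite mxE mulrDl.
Qed.

Lemma dotZl m n c (A B : 'M[R]_(m, n)) : dot (c *: A) B = c * dot A B.
Proof.
rewrite mulr_sumr; apply: eq_bigr => i _; rewrite mulr_sumr.
by apply: eq_bigr => j _; rewrite mxE mulrA.
Qed.

Lemma dotNl m n (A B : 'M[R]_(m, n)) : dot (- A) B = - dot A B.
Proof. by rewrite -scaleN1r dotZl mulN1r. Qed.

Lemma dotBl m n (A B C : 'M[R]_(m, n)) : dot (A - B) C = dot A C - dot B C.
Proof. by rewrite dotDl dotNl. Qed.

Lemma dotDr m n (A B C : 'M[R]_(m, n)) : dot C (A + B) = dot C A + dot C B.
Proof. by rewrite dotC dotDl !(dotC C). Qed.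

Lemma dotZr m n c (A B : 'M[R]_(m, n)) : dot A (c *: B) = c * dot A B.
Proof. by rewrite dotC dotZl dotC. Qed.

Lemma dotNr m n (A B : 'M[R]_(m, n)) : dot A (- B) = - dot A B.
Proof. by rewrite dotC dotNl dotC. Qed.

Lemma dotBr m n (A B C : 'M[R]_(m, n)) : dot C (A - B) = dot C A - dot C B.
Proof. by rewrite dotDr dotNr. Qed.

Lemma dot0l m n (A : 'M[R]_(m, n)) : dot 0 A = 0.
Proof. by rewrite -(scale0r A) dotZl mul0r. Qed.

Lemma dot_suml m n (I : finType) (A : I -> 'M[R]_(m, n)) B :
  dot (\sum_k A k) B = \sum_k dot (A k) B.
Proof.
elim/big_rec2: _ => [|k x y _ <-]; first exact: dot0l.
by rewrite dotDl.
Qed.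

Lemma dot_sumr m n (I : finType) (A : I -> 'M[R]_(m, n)) B :
  dot B (\sum_k A k) = \sum_k dot B (A k).
Proof. by rewrite dotC dot_suml; apply: eq_bigr => k _; rewrite dotC. Qed.

Lemma dot_ge0 m n (A : 'M[R]_(m, n)) : 0 <= dot A A.
Proof. by do 2! (apply: sumr_ge0 => ? _); rewrite -expr2 sqr_ge0. Qed.

Lemma dot_trace m n (A B : 'M[R]_(m, n)) : dot A B = \tr (A^T *m B).
Proof.
rewrite /dot exchange_big; apply: eq_bigr => j _; rewrite mxE.
by apply: eq_bigr => i _; rewrite mxE.
Qed.

Lemma frob_ge0 m n (A : 'M[R]_(m, n)) : 0 <= frob A.
Proof. exact: sqrtr_ge0. Qed.

Lemma frob_sqr m n (A : 'M[R]_(m, n)) : frob A ^+ 2 = dot A A.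
Proof.
by rewrite sqr_sqrtr; do 2!(first [apply: eq_bigr => ? _|apply: sumr_ge0 => ? _]);
  rewrite ?sqr_ge0 // expr2.
Qed.

Lemma frob_sqrE m n (A : 'M[R]_(m, n)) :
  frob A ^+ 2 = \sum_i \sum_j A i j ^+ 2.
Proof.
rewrite frob_sqr; apply: eq_bigr => i _.
by apply: eq_bigr => j _; rewrite expr2.
Qed.

Lemma frobE m n (A : 'M[R]_(m, n)) : frob A = Num.sqrt (dot A A).
Proof. by rewrite -frob_sqr sqrtr_sqr ger0_norm ?frob_ge0. Qed.

Lemma frob_le m n (A : 'M[R]_(m, n)) c :
  0 <= c -> dot A A <= c ^+ 2 -> frob A <= c.
Proof. by move=> c0 h; rewrite -(ler_pXn2r (ltn0Sn 1)) ?nnegrE ?frob_ge0 ?frob_sqr. Qed.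

Lemma frob0 m n : frob (0 : 'M[R]_(m, n)) = 0.
Proof. by rewrite frobE dot0l sqrtr0. Qed.

Lemma frobZ m n c (A : 'M[R]_(m, n)) : frob (c *: A) = `|c| * frob A.
Proof.
by rewrite frobE dotZl dotZr mulrA -expr2 sqrtrM ?sqr_ge0// sqrtr_sqr -frobE.
Qed.

Lemma frobN m n (A : 'M[R]_(m, n)) : frob (- A) = frob A.
Proof. by rewrite -scaleN1r frobZ normrN1 mul1r. Qed.

Lemma frobBC m n (A B : 'M[R]_(m, n)) : frob (A - B) = frob (B - A).
Proof. by rewrite -frobN opprB. Qed.

Lemma frob_eq0 m n (A : 'M[R]_(m, n)) : frob A = 0 -> A = 0.
Proof.
move=> A0; have : frob A ^+ 2 = 0 by rewrite A0 expr0n.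
rewrite frob_sqrE => h; apply/matrixP => i j; rewrite mxE.
have h1 i' : 0 <= \sum_j A i' j ^+ 2 by apply: sumr_ge0 => *; exact: sqr_ge0.
have /eqP := h; rewrite psumr_eq0 // => /allP /(_ i (mem_index_enum _)) /=.
rewrite psumr_eq0; last by move=> *; exact: sqr_ge0.
by move=> /allP /(_ j (mem_index_enum _)); rewrite /= sqrf_eq0 => /eqP.
Qed.

(** Expand the nonnegative square of |B| A - |A| B; the null cases are split off because the result
    is divided by |A| |B|. *)
Lemma cauchy_schwarz m n (A B : 'M[R]_(m, n)) : dot A B <= frob A * frob B.
Proof.
have [B0|B0] := eqVneq (frob B) 0.
  by rewrite B0 mulr0 (frob_eq0 B0) dotC dot0l.
have bp : 0 < frob B by rewrite lt_def B0 frob_ge0.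
have := dot_ge0 (frob B *: A - (frob A) *: B).
rewrite dotBl !dotBr !dotZl !dotZr (dotC B A) -!frob_sqr.
have [A0|A0] := eqVneq (frob A) 0.
  by move=> _; rewrite A0 mul0r (frob_eq0 A0) dot0l.
have ap : 0 < frob A by rewrite lt_def A0 frob_ge0.
have abp := mulr_gt0 ap bp.
by move=> h; rewrite -(ler_pM2l abp); nra.
Qed.

Lemma frobD m n (A B : 'M[R]_(m, n)) : frob (A + B) <= frob A + frob B.
Proof.
apply: frob_le; first by rewrite addr_ge0 ?frob_ge0.
rewrite dotDl !dotDr (dotC B A) -!frob_sqr.
by have := cauchy_schwarz A B; nra.
Qed.

Lemma frobB m n (A B : 'M[R]_(m, n)) : frob (A - B) <= frob A + frob B.
Proof. by rewrite (le_trans (frobD _ _)) ?frobN. Qed.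

Lemma frob_sum m n (I : finType) (A : I -> 'M[R]_(m, n)) :
  frob (\sum_k A k) <= \sum_k frob (A k).
Proof.
elim/big_rec2: _ => [|k x y _ h]; first by rewrite frob0.
by rewrite (le_trans (frobD _ _)) ?lerD2l.
Qed.

Lemma dot_norm_le m n (A B : 'M[R]_(m, n)) : `|dot A B| <= frob A * frob B.
Proof.
rewrite ler_norml cauchy_schwarz andbT lerNl -dotNl.
by rewrite (le_trans (cauchy_schwarz _ _)) ?frobN.
Qed.

End frobenius.

(** * Averages over the clients *)

Section averages.
Context {R : realType} {K m n : nat}.
Implicit Types A B : 'I_K -> 'M[R]_(m, n).
Hypothesis K_gt0 : (0 < K)%N.

Definition mean (x : 'I_K -> R) : R := K%:R^-1 * \sum_k x k.

Let Kp : 0 < K%:R :> R. Proof. by rewrite ltr0n. Qed.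

Lemma mean_cst c : mean (fun=> c) = c.
Proof. by rewrite /mean sumr_const card_ord -[c *+ _]mulr_natl mulKf ?gt_eqF. Qed.

Lemma ler_mean (x y : 'I_K -> R) : (forall k, x k <= y k) -> mean x <= mean y.
Proof.
by move=> h; rewrite ler_pM2l ?invr_gt0//; apply: ler_sum => k _.
Qed.

Lemma mean_ge0 (x : 'I_K -> R) : (forall k, 0 <= x k) -> 0 <= mean x.
Proof. by move=> h; rewrite -[leLHS](mean_cst 0) ler_mean. Qed.

Lemma meanD (x y : 'I_K -> R) : mean (fun k => x k + y k) = mean x + mean y.
Proof. by rewrite /mean big_split mulrDr. Qed.

Lemma meanZ c (x : 'I_K -> R) : mean (fun k => c * x k) = c * mean x.
Proof. by rewrite /mean -mulr_sumr mulrCA. Qed.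

(** Average the tangent inequality x^2 >= 2 c x - c^2 at c = [mean x]. *)
Lemma sqr_mean_le (x : 'I_K -> R) : mean x ^+ 2 <= mean (fun k => x k ^+ 2).
Proof.
set c := mean x; have : mean (fun k => 2 * c * x k + - c ^+ 2) <= mean (fun k => x k ^+ 2).
  by apply: ler_mean => k; have := sqr_ge0 (x k - c); nra.
by rewrite meanD mean_cst meanZ -/c; nra.
Qed.

Lemma avg_cst (B : 'M[R]_(m, n)) : avg (fun _ : 'I_K => B) = B.
Proof.
rewrite /avg sumr_const card_ord -[B *+ _]scaler_nat scalerA mulVf ?scale1r//.
by rewrite gt_eqF.
Qed.

Lemma avgD A B : avg (fun k => A k + B k) = avg A + avg B.
Proof. by rewrite /avg big_split scalerDr. Qed.

Lemma avgZ c A : avg (fun k => c *: A k) = c *: avg A.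
Proof. by rewrite /avg -scaler_sumr !scalerA mulrC. Qed.

Lemma avgN A : avg (fun k => - A k) = - avg A.
Proof. by rewrite /avg sumrN scalerN. Qed.

Lemma avgB A B : avg (fun k => A k - B k) = avg A - avg B.
Proof. by rewrite avgD avgN. Qed.

Lemma frob_avg A : frob (avg A) <= mean (fun k => frob (A k)).
Proof.
rewrite /avg frobZ ger0_norm ?invr_ge0 ?ler0n// ler_wpM2l ?invr_ge0 ?ler0n//.
exact: frob_sum.
Qed.

Lemma dot_avgr A (B : 'M[R]_(m, n)) : dot B (avg A) = mean (fun k => dot B (A k)).
Proof. by rewrite /avg dotZr dot_sumr. Qed.

End averages.

(** * The polar factor *)

Section polar_factor.
Context {R : realType}.
Implicit Types m n p r : nat.

(** The squared norm is the trace of the identity of size r, and r <= n because V has a left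
    inverse. *)
Lemma compact_svd_frob_polar m n r (M : 'M[R]_(m, n)) U (s : 'rV_r) V :
  compact_svd M U s V -> frob (U *m V^T) <= Num.sqrt n%:R.
Proof.
case=> UU VV _ _; rewrite frobE ler_sqrt ?ler0n// dot_trace trmx_mul trmxK.
rewrite -mulmxA (mulmxA U^T) UU mul1mx mxtrace_mulC VV mxtrace1 ler_nat.
exact: mulmx1_min VV.
Qed.

(** The inner product is the nuclear norm, the sum of the singular values, which dominates their
    Euclidean norm. *)
Lemma compact_svd_dot_polar m n r (M : 'M[R]_(m, n)) U (s : 'rV_r) V :
  compact_svd M U s V -> frob M <= dot M (U *m V^T).
Proof.
case=> UU VV s0 ->.
have -> : dot (U *m diag_mx s *m V^T) (U *m V^T) = \sum_i s 0 i.
  rewrite dot_trace !trmx_mul trmxK tr_diag_mx -!mulmxA (mulmxA U^T) UU mul1mx.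
  by rewrite mulmxA mxtrace_mulC mulmxA VV mul1mx mxtrace_diag.
apply: frob_le; first by apply: sumr_ge0 => i _; exact: ltW.
rewrite dot_trace !trmx_mul trmxK tr_diag_mx -!mulmxA (mulmxA U^T) UU mul1mx.
rewrite mxtrace_mulC -!mulmxA VV mulmx1 mulmx_diag mxtrace_diag.
rewrite expr2 mulr_suml ler_sum // => i _; rewrite mxE.
rewrite ler_pM2l// (bigD1 i)//= lerDl; apply: sumr_ge0 => j _; exact: ltW.
Qed.

(* The Newton-Schulz iteration; on singular values it is
   s |-> (3 s - s^3) / 2, which increases to 1 on ]0, 1]. *)
Fixpoint newton_schulz m n (j : nat) (M : 'M[R]_(m, n)) : 'M[R]_(m, n) :=
  if j is j'.+1 then
    let A := newton_schulz j' M in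
    (3 / 2) *: A - (1 / 2) *: (A *m A^T *m A)
  else (1 + frob M ^+ 2)^-1 *: M.

Fixpoint newton_schulz_sv (j : nat) (s : R) : R :=
  if j is j'.+1 then
    let a := newton_schulz_sv j' s in (3 / 2) * a - (1 / 2) * a ^+ 3
  else s.

(** Since U and V have orthonormal columns, an odd polynomial such as A |-> (3 A - A A^T A) / 2 acts
    on the diagonal factor alone. Null singular values, absent from the compact form, stay null. *)
Lemma newton_schulz_svd m n r (M : 'M[R]_(m, n)) U (s : 'rV_r) V j :
  compact_svd M U s V ->
  newton_schulz j M = U *m diag_mx (\row_i newton_schulz_sv j
     ((1 + frob M ^+ 2)^-1 * s 0 i)) *m V^T.
Proof.
move=> [UU VV s0 ME]; elim: j => [|j IH] /=.
  set c := _^-1; rewrite {1}ME scalemxAl scalemxAr; congr (_ *m _ *m _).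
  by apply/matrixP => a b; rewrite !mxE mulrnAr.
rewrite IH; set D := \row_i _.
have -> : U *m diag_mx D *m V^T *m (U *m diag_mx D *m V^T)^T *m
   (U *m diag_mx D *m V^T) = U *m (diag_mx D *m diag_mx D *m diag_mx D) *m V^T.
  rewrite !trmx_mul trmxK tr_diag_mx -!mulmxA (mulmxA V^T V) VV mul1mx.
  by rewrite (mulmxA U^T U) UU mul1mx.
have scE c (A : 'M[R]_r) : c *: (U *m A *m V^T) = U *m (c *: A) *m V^T.
  by rewrite scalemxAl scalemxAr.
rewrite !scE -mulmxBl -mulmxBr; congr (_ *m _ *m _).
rewrite !mulmx_diag; apply/matrixP => a b; rewrite !mxE.
by case: eqP => _; rewrite ?mulr1n ?mulr0n ?mulr0 ?subr0//; ring.
Qed.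

Lemma newton_schulz_sv_bounds s j : 0 < s <= 1 -> s <= newton_schulz_sv j s <= 1.
Proof.
move=> /andP[s0 s1]; elim: j => [|j /andP[IH1 IH2]] /=; first by rewrite lexx s1.
set a := newton_schulz_sv j s in IH1 IH2 *.
have a0 : 0 < a by exact: lt_le_trans IH1.
apply/andP; split.
  apply: (le_trans IH1); rewrite -subr_ge0.
  have -> : 3 / 2 * a - 1 / 2 * a ^+ 3 - a = 1 / 2 * (a * ((1 - a) * (1 + a))).
    by field.
  by apply: mulr_ge0; [lra|apply: mulr_ge0; [lra|apply: mulr_ge0; lra]].
rewrite -subr_ge0.
have -> : 1 - (3 / 2 * a - 1 / 2 * a ^+ 3) = 1 / 2 * ((1 - a) ^+ 2 * (2 + a)).
  by field.
by apply: mulr_ge0; [lra|apply: mulr_ge0; [exact: sqr_ge0|lra]].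
Qed.

(** One step multiplies the gap 1 - a by 1 - a (1 + a) / 2, which is at most 1 - s / 2 because the
    iterates stay above s. *)
Lemma newton_schulz_sv_rate s j : 0 < s <= 1 ->
  1 - newton_schulz_sv j s <= (1 - s / 2) ^+ j.
Proof.
move=> s01; have /andP[s0 s1] := s01.
elim: j => [|j IH] /=; first by rewrite expr0; lra.
have /andP[h1 h2] := newton_schulz_sv_bounds j s01.
set a := newton_schulz_sv j s in IH h1 h2 *.
have -> : 1 - (3 / 2 * a - 1 / 2 * a ^+ 3) = (1 - a) * (1 - a * (1 + a) / 2).
  by field.
rewrite exprSr ler_pM// ?subr_ge0//; nra.
Qed.

Lemma newton_schulz_sv_cvg s : 0 < s <= 1 ->
  newton_schulz_sv j s @[j --> \oo] --> (1 : R).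
Proof.
move=> s01; have /andP[s0 s1] := s01.
have h : (1 - (1 - s / 2) ^+ j) @[j --> \oo] --> (1 : R).
  rewrite -[X in _ --> X]subr0; apply: cvgB; first exact: cvg_cst.
  by apply: cvg_expr; rewrite ger0_norm; lra.
apply: squeeze_cvgr h (cvg_cst (1 : R)).
near=> j; have := newton_schulz_sv_rate j s01.
by have /andP[_ ->] := newton_schulz_sv_bounds j s01; rewrite andbT; lra.
Unshelve. all: by end_near. Qed.

(** The iterates depend on M only, so every compact decomposition of M has the same U V^T, whatever
    choice the algorithm makes. *)
Lemma newton_schulz_cvg m n r (M : 'M[R]_(m, n)) U (s : 'rV_r) V a b :
  compact_svd M U s V ->
  newton_schulz j M a b @[j --> \oo] --> (U *m V^T) a b.
Proof.
move=> svd; have [UU VV s0 ME] := svd.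
have sM i : s 0 i <= frob M.
  rewrite -(@ler_pXn2r _ 2)// ?nnegrE ?frob_ge0 ?(ltW (s0 _))// frob_sqr ME.
  rewrite dot_trace !trmx_mul trmxK tr_diag_mx -!mulmxA (mulmxA U^T) UU mul1mx.
  rewrite mxtrace_mulC -!mulmxA VV mulmx1 mulmx_diag mxtrace_diag.
  rewrite (bigD1 i)//= mxE expr2 lerDl; apply: sumr_ge0 => j _; rewrite mxE.
  by rewrite mulr_ge0// ltW.
(* The initial scaling is positive for every M, 0 included, and s <= |M| <= 1 + |M|^2 is all that is
   asked of it. *)
have c01 i : 0 < (1 + frob M ^+ 2)^-1 * s 0 i <= 1.
  have h : 0 < 1 + frob M ^+ 2 by rewrite ltr_pwDl// sqr_ge0.
  rewrite mulr_gt0 ?invr_gt0//= ler_pdivrMl// mulr1 (le_trans (sM i))//.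
  by have := sqr_ge0 (frob M - 1/2); nra.
rewrite mxE; under eq_cvg do rewrite (newton_schulz_svd _ svd) mxE.
have hc : continuous (fun x : R * R => x.1 + x.2) by exact: add_continuous.
apply: (cvg_big hc) => i _.
under eq_cvg do rewrite mul_mx_diag !mxE.
have -> : U a i * V^T i b = U a i * 1 * V^T i b by rewrite mulr1.
rewrite mxE; apply: cvgMr_tmp; apply: cvgMl_tmp; exact: newton_schulz_sv_cvg.
Qed.

End polar_factor.

(** * Gradients *)

Section kronecker.
Context {R : realType} {m n d : nat}.
Implicit Types (J : 'M[R]_(m, d * n)) (v : 'cV[R]_d).

Lemma mulmx_kron_idE J v a b :
  (J *m kron_id n v) a b = \sum_c J a (mxtens_index (c, b)) * v c 0.
Proof.
rewrite mxE (reindex (@mxtens_index d n)) /=; last first.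
  by exists (@mxtens_unindex d n) => i _; rewrite (mxtens_indexK, mxtens_unindexK).
rewrite (eq_bigr (fun p : 'I_d * 'I_n =>
    J a (mxtens_index (p.1, p.2)) * (v p.1 0 * (p.2 == b)%:R))); last first.
  move=> -[c e] _; rewrite /kron_id castmxE !mxE cast_ord_id mxtens_indexK /=.
  rewrite ord1; congr (_ * (v _ _ * _%:R)).
  by rewrite -!val_eqE /= [(b %% n)%N]modn_small.
rewrite -(pair_bigA _ (fun c e => J a (mxtens_index (c, e)) *
    (v c 0 * (e == b)%:R))) /=.
apply: eq_bigr => c _; rewrite (bigD1 b)//= eqxx mulr1 big1 ?addr0//.
by move=> e /negbTE ->; rewrite !mulr0.
Qed.

Lemma mulmx_kron_idBl J1 J2 v :
  (J1 - J2) *m kron_id n v = J1 *m kron_id n v - J2 *m kron_id n v.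
Proof. exact: mulmxBl. Qed.

Lemma mulmx_kron_idBr J v1 v2 :
  J *m kron_id n (v1 - v2) = J *m kron_id n v1 - J *m kron_id n v2.
Proof.
apply/matrixP => a b; rewrite [RHS]mxE [X in _ = _ + X]mxE !mulmx_kron_idE -sumrB.
by apply: eq_bigr => c _; rewrite !mxE mulrBr.
Qed.

Lemma mulmx_kron_id0 J : J *m kron_id n 0 = 0.
Proof. by rewrite -(subrr (0 : 'cV[R]_d)) mulmx_kron_idBr subrr. Qed.

(** Entry (a, b) of the product is the inner product of v with the d entries of J in row a and in
    column b of the successive blocks. Cauchy-Schwarz applies to each entry, and these families
    partition J. *)
Lemma frob_mulmx_kron_id J v : frob (J *m kron_id n v) <= frob J * frob v.
Proof.
apply: frob_le; first by rewrite mulr_ge0 ?frob_ge0.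
rewrite -frob_sqr frob_sqrE.
pose row a b : 'cV[R]_d := \col_c J a (mxtens_index (c, b)).
have -> : (frob J * frob v) ^+ 2 =
    \sum_a \sum_b frob (row a b) ^+ 2 * frob v ^+ 2.
  rewrite exprMn (frob_sqrE J) mulr_suml; apply: eq_bigr => a _.
  rewrite -mulr_suml; congr (_ * _).
  rewrite (reindex (@mxtens_index d n)) /=; last first.
    by exists (@mxtens_unindex d n) => i _; rewrite (mxtens_indexK, mxtens_unindexK).
  under [RHS]eq_bigr => b _ do rewrite frob_sqrE.
  rewrite [RHS]exchange_big /= (eq_bigr (fun p : 'I_d * 'I_n =>
    J a (mxtens_index (p.1, p.2)) ^+ 2)); last by case.
  rewrite -(pair_bigA _ (fun c e => J a (mxtens_index (c, e)) ^+ 2)) /=.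
  apply: eq_bigr => c _; rewrite exchange_big big_ord1.
  by apply: eq_bigr => b _; rewrite mxE.
apply: ler_sum => a _; apply: ler_sum => b _.
have -> : (J *m kron_id n v) a b = dot (row a b) v.
  rewrite mulmx_kron_idE; apply: eq_bigr => c _.
  by rewrite big_ord1 mxE.
rewrite -exprMn -real_normK ?num_real// ler_pXn2r ?nnegrE ?mulr_ge0 ?frob_ge0//.
exact: dot_norm_le.
Qed.

End kronecker.

Section gradients.
Context {R : realType}.
Implicit Types m n d : nat.

Lemma derive_grad m n (h : 'M[R]_(m, n) -> R) (W V : 'M[R]_(m, n)) :
  differentiable h W -> 'D_V h W = dot (grad h W) V.
Proof.
move=> dh; rewrite deriveE// [V in LHS]matrix_sum_delta linear_sum.
apply: eq_bigr => i _; rewrite linear_sum; apply: eq_bigr => j _.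
by rewrite linearZ /= mxE deriveE// mulrC.
Qed.

Lemma differentiable_coef m n d (g : 'M[R]_(m, n) -> 'cV[R]_d) W c :
  differentiable g W -> differentiable (fun V => g V c 0) W.
Proof.
move=> dg; apply: (differentiable_comp (g := fun v : 'cV[R]_d => v c 0)) => //.
exact: differentiable_coord.
Qed.

Lemma derive_coef m n d (g : 'M[R]_(m, n) -> 'cV[R]_d) W V c :
  differentiable g W -> ('D_V g W) c 0 = 'D_V (fun V => g V c 0) W.
Proof.
move=> dg; have cv := diff_derivable (v := V) dg; rewrite /derivable in cv.
apply/esym/cvg_lim => //.
have := continuous_cvg _ (@coord_continuous R _ _ c 0 ('D_V g W)) cv.
by under eq_cvg do rewrite /= !mxE; apply.
Qed.

Lemma grad_comp m n d (g : 'M[R]_(m, n) -> 'cV[R]_d) (f : 'cV[R]_d -> R) W :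
  differentiable g W -> differentiable f (g W) ->
  grad (fun V => f (g V)) W = jac g W *m kron_id n (grad f (g W)).
Proof.
move=> dg df; rewrite jac_kron_id; apply/matrixP => i j.
rewrite mxE summxE deriveE; last exact: (differentiable_comp (g := f)).
rewrite (diff_comp (g := f))//= -[LHS]deriveE// derive_grad//.
apply: eq_bigr => c _; rewrite big_ord1 [RHS]mxE [X in _ = _ * X]mxE.
by congr (_ * _); rewrite -deriveE// derive_coef.
Qed.

Lemma is_derive_line m n (h : 'M[R]_(m, n) -> R) (W V : 'M[R]_(m, n)) (s : R) :
  (forall W, differentiable h W) ->
  is_derive s 1 (fun s => h (W + s *: V)) (dot (grad h (W + s *: V)) V).
Proof.
move=> dh; have D := diff_derivable (v := V) (dh (W + s *: V)).
have E : (fun t : R => t^-1 *: (((fun s => h (W + s *: V)) \o shift s) (t *: 1)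
     - h (W + s *: V))) =
   (fun t => t^-1 *: ((h \o shift (W + s *: V)) (t *: V) - h (W + s *: V))).
  apply/funext => t /=; congr (_ *: (h _ - _)).
  by rewrite [t *: 1]mulr1 scalerDl addrCA.
rewrite -(derive_grad V (dh _)); apply: DeriveDef.
- by move: D; rewrite /derivable -E.
- by rewrite /derive -E.
Qed.

(** The comparison function q lets one mean value theorem serve twice: a quadratic q gives the
    descent lemma, q = 0 the Lipschitz bound. *)
Lemma mean_value_line m n (h : 'M[R]_(m, n) -> R) (W V : 'M[R]_(m, n)) (q dq : R -> R) :
  (forall W, differentiable h W) ->
  (forall s : R, is_derive s 1 q (dq s)) ->
  exists2 c, 0 < c < 1 & h (W + V) - h W - (q 1 - q 0) =
    dot (grad h (W + c *: V)) V - dq c.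
Proof.
move=> dh dq'.
have H (s : R) : is_derive s 1 (fun s => h (W + s *: V) - q s)
    (dot (grad h (W + s *: V)) V - dq s).
  by have := is_derive_line W V s dh => ?; apply: is_deriveB.
have [] := @MVT R _ _ 0 1 ltr01 (fun s _ => H s).
  apply: derivable_within_continuous => s _.
  exact: (@ex_derive _ _ _ _ _ _ _ (H s)).
move=> c; rewrite in_itv /= => c01 E; exists c => //.
move: E; rewrite subr0 mulr1 scale1r scale0r addr0 => <-; ring.
Qed.

(** With q quadratic, its derivative majorizes that of h along the segment, so the mean value
    theorem replaces the integral remainder. *)
Lemma descent_lemma m n (h : 'M[R]_(m, n) -> R) L (W V : 'M[R]_(m, n)) :
  (forall W, differentiable h W) ->
  (forall W1 W2, frob (grad h W1 - grad h W2) <= L * frob (W1 - W2)) ->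
  h (W + V) <= h W + dot (grad h W) V + L / 2 * frob V ^+ 2.
Proof.
move=> dh hL.
pose q (s : R) := s * dot (grad h W) V + s ^+ 2 * (L / 2 * frob V ^+ 2).
have dq (s : R) : is_derive s 1 q (dot (grad h W) V + s * (L * frob V ^+ 2)).
  rewrite /q; apply: is_derive_eq.
  by rewrite /GRing.scale /=; field.
have [c /andP[c0 c1]] := mean_value_line W V dh dq.
rewrite /q mul0r expr0n mul0r addr0 subr0 mul1r expr1n mul1r => E.
have : dot (grad h (W + c *: V) - grad h W) V <= c * (L * frob V ^+ 2).
  apply: (le_trans (cauchy_schwarz _ _)).
  have := hL (W + c *: V) W; rewrite [W + _ - W]addrC addKr frobZ ger0_norm ?(ltW c0)//.
  by have := frob_ge0 V; nra.
rewrite dotBl; move: E; lra.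
Qed.

(** The mean value theorem fails for vector-valued maps; it is applied to the scalar function <v, g>
    with v = g W1 - g W2, whose gradient is the Jacobian times v (x) I_n. Dividing by |v|
    concludes. *)
Lemma lipschitz_of_jac m n d (g : 'M[R]_(m, n) -> 'cV[R]_d) C W1 W2 :
  (forall W, differentiable g W) -> (forall W, frob (jac g W) <= C) ->
  frob (g W1 - g W2) <= C * frob (W1 - W2).
Proof.
move=> dg gC; set v := g W1 - g W2; set V := W1 - W2.
pose h (W : 'M[R]_(m, n)) : R := \sum_c v c 0 * g W c 0.
have hE : h = \sum_(c < d) (fun W => v c 0 * g W c 0).
  by apply/funext => W; rewrite fct_sumE.
have dh W : differentiable h W.
  rewrite hE; apply: (@differentiable_sum R _ _ d (fun c W => v c 0 * g W c 0)) => c.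
  by apply: differentiableM => //; exact: differentiable_coef.
have [c /andP[c0 c1]] := mean_value_line W2 V dh
  (fun s : R => @is_derive_cst R R R 0 s 1).
rewrite subrr !subr0 => E.
have E' : dot v v = dot (grad h (W2 + c *: V)) V.
  rewrite -E (_ : W2 + V = W1); last by rewrite addrC subrK.
  rewrite /h -sumrB; apply: eq_bigr => k _.
  by rewrite big_ord1 /v !mxE mulrBr.
have gh W : frob (grad h W) <= frob v * C.
  have -> : grad h W = jac g W *m kron_id n v.
    rewrite jac_kron_id; apply/matrixP => i j; rewrite mxE summxE hE.
    rewrite (@derive_sum R _ _ d (fun c W => v c 0 * g W c 0)); last first.
      move=> k; apply: derivableM; first exact: derivable_cst.
      exact/diff_derivable/differentiable_coef.
    apply: eq_bigr => k _; rewrite deriveM //; last first.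
      exact/diff_derivable/differentiable_coef.
    by rewrite derive_cst scaler0 addr0 !mxE.
  rewrite mulrC (le_trans (frob_mulmx_kron_id _ _))// ler_wpM2r ?frob_ge0//.
have [v0|v0] := eqVneq (frob v) 0.
  by rewrite v0 mulr_ge0 ?frob_ge0// (le_trans (frob_ge0 _) (gC 0)).
have vp : 0 < frob v by rewrite lt_def v0 frob_ge0.
rewrite -(ler_pM2l vp) -expr2 frob_sqr E' (le_trans (cauchy_schwarz _ _))//.
by rewrite mulrA ler_wpM2r ?frob_ge0.
Qed.

End gradients.

(** * Measurability of random matrices *)

Section matrix_measurability.
Context {R : realType} {dY : measure_display} {Y : measurableType dY}.
Implicit Types m n d p : nat.

Definition measurable_mx m n (A : Y -> 'M[R]_(m, n)) : Prop :=
  forall i j, measurable_fun setT (fun y => A y i j).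

Lemma measurable_mx_cst m n (A : 'M[R]_(m, n)) : measurable_mx (fun=> A).
Proof. by move=> i j; exact: measurable_cst. Qed.

Lemma measurable_mxD m n (A B : Y -> 'M[R]_(m, n)) :
  measurable_mx A -> measurable_mx B -> measurable_mx (fun y => A y + B y).
Proof.
move=> mA mB i j; under eq_fun do rewrite mxE.
exact: measurable_funD.
Qed.

Lemma measurable_mxZ m n (c : Y -> R) (A : Y -> 'M[R]_(m, n)) :
  measurable_fun setT c -> measurable_mx A -> measurable_mx (fun y => c y *: A y).
Proof.
move=> mc mA i j; under eq_fun do rewrite mxE.
exact: measurable_funM.
Qed.

Lemma measurable_mxN m n (A : Y -> 'M[R]_(m, n)) :
  measurable_mx A -> measurable_mx (fun y => - A y).
Proof.
move=> mA i j; under eq_fun do rewrite mxE.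
exact: measurable_funN.
Qed.

Lemma measurable_mxB m n (A B : Y -> 'M[R]_(m, n)) :
  measurable_mx A -> measurable_mx B -> measurable_mx (fun y => A y - B y).
Proof. by move=> mA mB; apply: measurable_mxD => //; exact: measurable_mxN. Qed.

Lemma measurable_fun_sumR (I : finType) (h : I -> Y -> R) :
  (forall i, measurable_fun setT (h i)) ->
  measurable_fun setT (fun y => \sum_i h i y).
Proof.
move=> mh; elim: (index_enum I) => [|i s IH].
  by under eq_fun do rewrite big_nil; exact: measurable_cst.
under eq_fun do rewrite big_cons; exact: measurable_funD.
Qed.

Lemma measurable_mx_sum m n (I : finType) (A : I -> Y -> 'M[R]_(m, n)) :
  (forall i, measurable_mx (A i)) -> measurable_mx (fun y => \sum_i A i y).
Proof.
move=> mA a b; under eq_fun do rewrite summxE.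
by apply: measurable_fun_sumR => i; exact: mA.
Qed.

Lemma measurable_mx_avg K m n (A : 'I_K -> Y -> 'M[R]_(m, n)) :
  (forall i, measurable_mx (A i)) -> measurable_mx (fun y => avg (fun k => A k y)).
Proof.
move=> mA; apply: measurable_mxZ; first exact: measurable_cst.
exact: measurable_mx_sum.
Qed.

Lemma measurable_mxM m n p (A : Y -> 'M[R]_(m, n)) (B : Y -> 'M[R]_(n, p)) :
  measurable_mx A -> measurable_mx B -> measurable_mx (fun y => A y *m B y).
Proof.
move=> mA mB i j; under eq_fun do rewrite mxE.
by apply: measurable_fun_sumR => k; exact: measurable_funM.
Qed.

Lemma measurable_mx_tr m n (A : Y -> 'M[R]_(m, n)) :
  measurable_mx A -> measurable_mx (fun y => (A y)^T).
Proof. by move=> mA i j; under eq_fun do rewrite mxE; exact: mA. Qed.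

Lemma measurable_dot m n (A B : Y -> 'M[R]_(m, n)) :
  measurable_mx A -> measurable_mx B ->
  measurable_fun setT (fun y => dot (A y) (B y)).
Proof.
move=> mA mB; apply: measurable_fun_sumR => i; apply: measurable_fun_sumR => j.
exact: measurable_funM.
Qed.

Lemma measurable_sqr_frob m n (A : Y -> 'M[R]_(m, n)) :
  measurable_mx A -> measurable_fun setT (fun y => frob (A y) ^+ 2).
Proof. by move=> mA; under eq_fun do rewrite frob_sqr; exact: measurable_dot. Qed.

Lemma measurable_sqrt (h : Y -> R) :
  measurable_fun setT h -> measurable_fun setT (fun y => Num.sqrt (h y)).
Proof.
move=> mh; apply: (@measurableT_comp _ _ _ _ _ _ (@Num.sqrt R)) => //.
apply: continuous_measurable_fun; exact: sqrt_continuous.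
Qed.

Lemma measurable_frob m n (A : Y -> 'M[R]_(m, n)) :
  measurable_mx A -> measurable_fun setT (fun y => frob (A y)).
Proof.
move=> mA; under eq_fun do rewrite frobE.
by apply: measurable_sqrt; exact: measurable_dot.
Qed.

Lemma measurable_mulmx_kron_id m n d (J : Y -> 'M[R]_(m, d * n)) (v : Y -> 'cV[R]_d) :
  measurable_mx J -> measurable_mx v ->
  measurable_mx (fun y => J y *m kron_id n (v y)).
Proof.
move=> mJ mv i j; under eq_fun do rewrite mulmx_kron_idE.
by apply: measurable_fun_sumR => k; exact: measurable_funM.
Qed.

Lemma measurable_inv_gt0 (h : Y -> R) : (forall y, 0 < h y) ->
  measurable_fun setT h -> measurable_fun setT (fun y => (h y)^-1).
Proof.
move=> h0 mh; under eq_fun do rewrite -[h _]lnK ?posrE// -expRN.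
apply: measurableT_comp; first exact: measurable_expR.
by apply: measurable_funN; apply: measurableT_comp => //; exact: measurable_ln.
Qed.

Lemma measurable_newton_schulz m n (A : Y -> 'M[R]_(m, n)) j :
  measurable_mx A -> measurable_mx (fun y => newton_schulz j (A y)).
Proof.
move=> mA; elim: j => [|j IH] /=.
  apply: measurable_mxZ => //; apply: measurable_inv_gt0 => [y|].
    by rewrite ltr_pwDl// sqr_ge0.
  apply: measurable_funD; first exact: measurable_cst.
  exact: measurable_sqr_frob.
apply: measurable_mxB; (apply: measurable_mxZ; first exact: measurable_cst) => //.
by do 2! apply: measurable_mxM => //; exact: measurable_mx_tr.
Qed.

(** Used with I the integer matrices, which index the cells of a grid. *)
Lemma measurable_bigcup_countType (I : countType) (A : I -> set Y) :
  (forall i, measurable (A i)) -> measurable (\bigcup_i A i).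
Proof.
move=> mA; rewrite [X in measurable X](_ : _ =
  \bigcup_n (if unpickle n is Some i then A i else set0)).
  by apply: bigcupT_measurable => n; case: unpickle.
apply/seteqP; split=> y [i _ Ay]; first by exists (pickle i) => //=; rewrite pickleK.
by move: Ay; case: unpickle => // j Ay; exists j.
Qed.

(* A Caratheodory function is evaluated along the random matrix [A y] by
   rounding [A y] to a countable grid. *)
Lemma measurable_caratheodory m n (A : Y -> 'M[R]_(m, n))
    (h : 'M[R]_(m, n) -> Y -> R) :
  measurable_mx A -> (forall B, measurable_fun setT (h B)) ->
  (forall y, continuous (h^~ y)) ->
  measurable_fun setT (fun y => h (A y) y).
Proof.
move=> mA mh ch.
pose grid p (Q : 'M[int]_(m, n)) : 'M[R]_(m, n) :=
  \matrix_(i, j) ((Q i j)%:~R / p.+1%:R).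
pose rd p (B : 'M[R]_(m, n)) : 'M[int]_(m, n) :=
  \matrix_(i, j) Num.floor (B i j * p.+1%:R).
apply: (@measurable_fun_cvg _ _ _ setT (fun p y => h (grid p (rd p (A y))) y)).
  move=> p _ B mB; rewrite setTI.
  rewrite [X in measurable X](_ : _ = \bigcup_(Q in [set: 'M[int]_(m, n)])
    ([set y | rd p (A y) = Q] `&` (h (grid p Q) @^-1` B))); last first.
    apply/seteqP; split => [y By|y [Q _ [/= <-]]] //.
    by exists (rd p (A y)).
  apply: measurable_bigcup_countType => Q; apply: measurableI; last first.
    by rewrite -[X in measurable X]setTI; exact: mh.
  (* The fibre of the rounding over Q is a half-open box, one interval condition per entry. *)
  rewrite [X in measurable X](_ : _ = \bigcap_(i in [set: 'I_m])
    \bigcap_(j in [set: 'I_n]) ((fun y => A y i j) @^-1`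
      `[(Q i j)%:~R / p.+1%:R, (Q i j + 1)%:~R / p.+1%:R[%classic)); last first.
    apply/seteqP; split=> [y /= <- i _ j _|y Ay] /=.
      have := floor_itv (A y i j * p.+1%:R).
      by rewrite in_itv /= mxE ler_pdivrMr ?ltr0n// ltr_pdivlMr ?ltr0n.
    apply/matrixP => i j; rewrite mxE; apply: floor_def.
    have := Ay i Logic.I j Logic.I.
    by rewrite /= in_itv /= ler_pdivrMr ?ltr0n// ltr_pdivlMr ?ltr0n.
  apply: fin_bigcap_measurable => // i _; apply: fin_bigcap_measurable => // j _.
  by rewrite -[X in measurable X]setTI; exact: mA.
move=> y _ /=.
have : grid p (rd p (A y)) @[p --> \oo] --> A y; last first.
  by move=> cA; exact: (cvg_comp _ _ cA (ch y (A y))).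
apply/cvg_ballP => e e0; near=> p; split => // i j.
rewrite /ball /= !mxE.
have /andP[h1 h2] := floor_itv (A y i j * p.+1%:R).
have p0 : 0 < p.+1%:R :> R by rewrite ltr0n.
set x := A y i j in h1 h2 *; set f := Num.floor _ in h1 h2 *.
have -> : x - f%:~R / p.+1%:R = (x * p.+1%:R - f%:~R) / p.+1%:R by field; rewrite gt_eqF.
have f0 : 0 <= x * p.+1%:R - f%:~R by rewrite subr_ge0.
rewrite ger0_norm ?divr_ge0 ?ler0n// (@le_lt_trans _ _ p.+1%:R^-1)//.
  rewrite -[leRHS]mul1r ler_wpM2r ?invr_ge0 ?ler0n// lerBlDl.
  by move: h2; rewrite intrD => /ltW.
by near: p; exact: near_infty_natSinv_lt (PosNum e0).
Unshelve. all: by end_near. Qed.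

(** The gradient itself need not be continuous in the matrix, but it is a limit of difference
    quotients with steps 1 / (p + 1), and these are continuous. *)
Lemma measurable_grad_along m n (A : Y -> 'M[R]_(m, n))
    (h : 'M[R]_(m, n) -> Y -> R) :
  measurable_mx A -> (forall B, measurable_fun setT (h B)) ->
  (forall y B, differentiable (h^~ y) B) ->
  measurable_mx (fun y => grad (h^~ y) (A y)).
Proof.
move=> mA mh dh i j; under eq_fun do rewrite mxE.
set e := delta_mx i j.
apply: (@measurable_fun_cvg _ _ _ setT
  (fun p y => (p.+1%:R^-1)^-1 *: (h (p.+1%:R^-1 *: e + A y) y - h (A y) y))).
  move=> p; apply: (measurable_caratheodory
    (h := fun B y => (p.+1%:R^-1)^-1 *: (h (p.+1%:R^-1 *: e + B) y - h B y))) => //.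
    move=> B; apply: measurable_funM; first exact: measurable_cst.
    by apply: measurable_funB.
  move=> y B; apply: differentiable_continuous; apply: differentiableZ.
  apply: differentiableB; last exact: dh.
  apply: (differentiable_comp (f := fun C : 'M[R]_(m, n) => p.+1%:R^-1 *: e + C)
    (g := h^~ y)); last exact: dh.
  by apply: differentiableD; [exact: differentiable_cst|exact: ex_diff].
move=> y _; have := @diff_derivable _ _ _ _ _ e (dh y (A y)).
rewrite /derivable => cv.
have /cvgr_dnbhsP := cv; apply; split; last exact: cvg_harmonic.
by move=> p; rewrite invr_neq0// pnatr_eq0.
Qed.

End matrix_measurability.

(** * Bounds on means *)

Section mean_bounds.
Context {R : realType} {d : measure_display} {T : measurableType d}.
Variable P : probability T R.
Implicit Types (f h : T -> R) (a b c : R).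

(** Bundling measurability with a real L1 bound gives integrability for free, so that estimates
    compose without side conditions. *)
Definition mean_le f c : Prop :=
  measurable_fun setT f /\ (\int[P]_w (`|f w|)%:E <= c%:E)%E.

Let mabs f : measurable_fun setT f -> measurable_fun setT (fun w => (`|f w|)%:E).
Proof. by move=> mf; apply/measurable_EFinP; exact: measurableT_comp. Qed.

Lemma mean_le_expectation f c : mean_le f c -> (forall w, 0 <= f w) ->
  ('E_P[f] <= c%:E)%E.
Proof.
move=> [mf le] f0; rewrite unlock; move: le; congr (_ <= _)%E.
by apply: eq_integral => w _; rewrite ger0_norm.
Qed.

Lemma mean_le_of_expectation f c : measurable_fun setT f -> (forall w, 0 <= f w) ->
  ('E_P[f] <= c%:E)%E -> mean_le f c.
Proof.
move=> mf f0; rewrite unlock => le; split=> //; move: le; congr (_ <= _)%E.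
by apply: eq_integral => w _; rewrite ger0_norm.
Qed.

Lemma mean_le_integrable f c : mean_le f c -> P.-integrable setT (EFin \o f).
Proof.
move=> [mf le]; apply/integrableP; split; first exact/measurable_EFinP.
by rewrite (le_lt_trans _ (ltry c)).
Qed.

Lemma mean_le_dominated f h c : measurable_fun setT f ->
  (forall w, `|f w| <= h w) -> mean_le h c -> mean_le f c.
Proof.
move=> mf fh [mh le]; split=> //; apply: le_trans le.
apply: ge0_le_integral => //; try exact: mabs.
by move=> w _; rewrite lee_fin (le_trans (fh w))// ler_norm.
Qed.

Lemma mean_le_weaken f a b : a <= b -> mean_le f a -> mean_le f b.
Proof. by move=> ab [mf le]; split=> //; rewrite (le_trans le). Qed.

Lemma mean_le_cst c : mean_le (fun=> c) `|c|.
Proof.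
split; first exact: measurable_cst.
by rewrite integral_cst//= probability_setT mule1.
Qed.

Lemma mean_le_cst_ge0 c : 0 <= c -> mean_le (fun=> c) c.
Proof. by move=> c0; have := mean_le_cst c; rewrite ger0_norm. Qed.

Lemma mean_leD f h a b : mean_le f a -> mean_le h b ->
  mean_le (fun w => f w + h w) (a + b).
Proof.
move=> [mf fa] [mh hb]; split; first exact: measurable_funD.
apply: (@le_trans _ _ (\int[P]_w ((`|f w|)%:E + (`|h w|)%:E))%E).
  apply: ge0_le_integral => //; first exact/mabs/measurable_funD.
    by apply: emeasurable_funD; exact: mabs.
  by move=> w _; rewrite -EFinD lee_fin ler_normD.
rewrite ge0_integralD//; try exact: mabs.
by rewrite EFinD leeD.
Qed.

Lemma mean_leZ f a c : mean_le f a -> mean_le (fun w => c * f w) (`|c| * a).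
Proof.
move=> [mf fa]; split.
  by apply: measurable_funM => //; exact: measurable_cst.
under eq_integral do rewrite normrM EFinM.
rewrite ge0_integralZl_EFin//; last exact: mabs.
by rewrite EFinM lee_wpmul2l.
Qed.

Lemma mean_le_sum (I : Type) (s : seq I) (f : I -> T -> R) (a : I -> R) :
  (forall i, mean_le (f i) (a i)) ->
  mean_le (fun w => \sum_(i <- s) f i w) (\sum_(i <- s) a i).
Proof.
move=> fa; elim: s => [|i s IH].
  under eq_fun do rewrite big_nil.
  by rewrite big_nil; have := mean_le_cst 0; rewrite normr0.
by under eq_fun do rewrite big_cons; rewrite big_cons; exact: mean_leD.
Qed.

Lemma mean_le_mean K (f : 'I_K -> T -> R) (a : 'I_K -> R) :
  (forall k, mean_le (f k) (a k)) ->
  mean_le (fun w => mean (fun k => f k w)) (mean a).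
Proof.
move=> fa; rewrite /mean -[K%:R^-1 in X in mean_le _ X]ger0_norm ?invr_ge0 ?ler0n//.
by apply: mean_leZ; exact: mean_le_sum.
Qed.

(* AM-GM: [2 |f h| <= s f^2 + h^2 / s] with [s = b / a]. *)
Lemma mean_le_mul f h a b : 0 < a -> 0 < b ->
  mean_le (fun w => f w ^+ 2) (a ^+ 2) -> mean_le (fun w => h w ^+ 2) (b ^+ 2) ->
  measurable_fun setT f -> measurable_fun setT h ->
  mean_le (fun w => f w * h w) (a * b).
Proof.
move=> a0 b0 fa hb mf mh.
have H := mean_leD (mean_leZ (b / a / 2) fa) (mean_leZ (a / b / 2) hb).
have E : `|b / a / 2| * a ^+ 2 + `|a / b / 2| * b ^+ 2 = a * b.
  rewrite !ger0_norm ?divr_ge0 ?ltW//; field; rewrite !gt_eqF//.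
rewrite E in H; apply: mean_le_dominated H; first exact: measurable_funM.
move=> w; rewrite normrM -[f w ^+ 2]real_normK ?num_real//.
rewrite -[h w ^+ 2]real_normK ?num_real// -subr_ge0.
set x := `|f w|; set y := `|h w|.
have -> : b / a / 2 * x ^+ 2 + a / b / 2 * y ^+ 2 - x * y =
  (b * x - a * y) ^+ 2 / (a * b * 2) by field; rewrite !gt_eqF.
by rewrite divr_ge0 ?sqr_ge0// ?mulr_ge0// ltW.
Qed.

Lemma mean_le_sqrt f a : 0 < a -> measurable_fun setT f ->
  mean_le (fun w => f w ^+ 2) (a ^+ 2) -> mean_le f a.
Proof.
move=> a0 mf fa; have h1 : mean_le (fun=> 1 ^+ 2) ((1 : R) ^+ 2).
  by have := mean_le_cst (1 ^+ 2); rewrite expr1n normr1.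
have := mean_le_mul a0 ltr01 fa h1 mf (measurable_cst _).
by under eq_fun do rewrite mulr1; rewrite mulr1.
Qed.

(** Pythagoras in L2. The cross term is integrable because 2 |<A, B>| <= |A|^2 + |B|^2. *)
Lemma mean_le_frobD_orthogonal m n (A B : T -> 'M[R]_(m, n)) a b :
  measurable_mx A -> measurable_mx B ->
  mean_le (fun w => frob (A w) ^+ 2) a -> mean_le (fun w => frob (B w) ^+ 2) b ->
  (\int[P]_w (dot (A w) (B w))%:E = 0)%E ->
  mean_le (fun w => frob (A w + B w) ^+ 2) (a + b).
Proof.
move=> mA mB Aa Bb AB0.
have mAB := measurable_dot mA mB.
have H := mean_leD Aa Bb.
have iAB : P.-integrable setT (EFin \o (fun w => 2 * dot (A w) (B w))).
  apply: (@mean_le_integrable _ (a + b)).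
  apply: mean_le_dominated H; first by apply: measurable_funM => //; exact: measurable_cst.
  move=> w; rewrite normrM ger0_norm//.
  have := dot_norm_le (A w) (B w); have := sqr_ge0 (frob (A w) - frob (B w)); nra.
split; first by apply: measurable_sqr_frob; exact: measurable_mxD.
rewrite [leLHS](_ : _ = (\int[P]_w ((frob (A w) ^+ 2 + frob (B w) ^+ 2)%:E +
    (2 * dot (A w) (B w))%:E))%E); last first.
  apply: eq_integral => w _; rewrite ger0_norm ?sqr_ge0// -EFinD; congr _%:E.
  by rewrite !frob_sqr dotDl !dotDr (dotC (B w) (A w)); ring.
rewrite integralD//; last exact: mean_le_integrable H.
rewrite [X in (_ + X)%E](_ : _ = 0)%E; last first.
  under eq_integral do rewrite EFinM.
  rewrite integralZl//; first by rewrite [X in (_ * X)%E]AB0 mule0.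
  have := integrableZl measurableT 2^-1 iAB.
  by apply: eq_integrable => // w _ /=; rewrite -EFinM; congr _%:E; field.
rewrite adde0; have [_] := H.
congr (_ <= _)%E; apply: eq_integral => w _.
by rewrite ger0_norm// addr_ge0// sqr_ge0.
Qed.

Lemma mean_le_sqr_frobZ m n (A : T -> 'M[R]_(m, n)) c a :
  mean_le (fun w => frob (A w) ^+ 2) a ->
  mean_le (fun w => frob (c *: A w) ^+ 2) (c ^+ 2 * a).
Proof.
move=> Aa; have := mean_leZ (c ^+ 2) Aa; rewrite (ger0_norm (sqr_ge0 _)).
congr mean_le; apply/funext => w.
by rewrite frobZ exprMn real_normK ?num_real.
Qed.

Definition has_mean1 f c : Prop :=
  P.-integrable setT (EFin \o f) /\ (\int[P]_w (f w)%:E = c%:E)%E.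

Lemma has_mean1_cst c : has_mean1 (fun=> c) c.
Proof.
split; first exact: finite_measure_integrable_cst.
by rewrite integral_cst//= probability_setT mule1.
Qed.

Lemma has_mean1D f h a b : has_mean1 f a -> has_mean1 h b ->
  has_mean1 (fun w => f w + h w) (a + b).
Proof.
move=> [fi fa] [hi hb]; split.
  have := integrableD measurableT fi hi.
  by apply: eq_integrable => // w _ /=; rewrite EFinD.
under eq_integral do rewrite EFinD.
by rewrite integralD// fa hb.
Qed.

Lemma has_mean1Z f a c : has_mean1 f a -> has_mean1 (fun w => c * f w) (c * a).
Proof.
move=> [fi fa]; split.
  have := integrableZl measurableT c fi.
  by apply: eq_integrable => // w _ /=; rewrite EFinM.
under eq_integral do rewrite EFinM.
by rewrite integralZl// fa EFinM.
Qed.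

Lemma has_mean1_sum (I : finType) (f : I -> T -> R) (a : I -> R) :
  (forall i, has_mean1 (f i) (a i)) ->
  has_mean1 (fun w => \sum_i f i w) (\sum_i a i).
Proof.
move=> fa; elim: (index_enum I) => [|i s IH].
  by under eq_fun do rewrite big_nil; rewrite big_nil; exact: has_mean1_cst.
by under eq_fun do rewrite big_cons; rewrite big_cons; exact: has_mean1D.
Qed.

Lemma has_meanE m n (h : T -> 'M[R]_(m, n)) A i j :
  has_mean P h A -> has_mean1 (fun w => h w i j) (A i j).
Proof. by move=> /(_ i j)[hi E]; split=> //; rewrite -E unlock. Qed.

Lemma has_meanP m n (h : T -> 'M[R]_(m, n)) (A : 'M[R]_(m, n)) :
  (forall i j, has_mean1 (fun w => h w i j) (A i j)) -> has_mean P h A.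
Proof. by move=> H i j; have [? E] := H i j; split=> //; rewrite -E unlock. Qed.

Lemma has_mean_measurable m n (h : T -> 'M[R]_(m, n)) A :
  has_mean P h A -> measurable_mx h.
Proof. by move=> hA i j; have [/measurable_int/measurable_EFinP] := hA i j. Qed.

Lemma has_mean_center m n (h : T -> 'M[R]_(m, n)) A :
  has_mean P h A -> has_mean P (fun w => h w - A) 0.
Proof.
move=> hA; apply: has_meanP => i j; under eq_fun do rewrite !mxE.
rewrite [X in has_mean1 _ X](_ : _ = A i j + - A i j); last by rewrite mxE subrr.
by apply: has_mean1D (has_mean1_cst _); exact: has_meanE.
Qed.

Lemma has_meanZ m n c (h : T -> 'M[R]_(m, n)) A :
  has_mean P h A -> has_mean P (fun w => c *: h w) (c *: A).
Proof.
move=> hA; apply: has_meanP => i j; under eq_fun do rewrite mxE.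
by rewrite mxE; apply: has_mean1Z; exact: has_meanE.
Qed.

Lemma has_mean_dot m n (h : T -> 'M[R]_(m, n)) A B :
  has_mean P h A -> has_mean1 (fun w => dot B (h w)) (dot B A).
Proof.
by move=> hA; do 2! apply: has_mean1_sum => ?; apply: has_mean1Z; exact: has_meanE.
Qed.

Lemma has_mean_kronr m n k (h : T -> 'cV[R]_k) A (J : 'M[R]_(m, k * n)) :
  has_mean P h A ->
  has_mean P (fun w => J *m kron_id n (h w)) (J *m kron_id n A).
Proof.
move=> hA; apply: has_meanP => i j; under eq_fun do rewrite mulmx_kron_idE.
by rewrite mulmx_kron_idE; apply: has_mean1_sum => c; apply: has_mean1Z; exact: has_meanE.
Qed.

Lemma has_mean_kronl m n k (h : T -> 'M[R]_(m, k * n)) A (v : 'cV[R]_k) :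
  has_mean P h A ->
  has_mean P (fun w => h w *m kron_id n v) (A *m kron_id n v).
Proof.
move=> hA; apply: has_meanP => i j; under eq_fun do rewrite mulmx_kron_idE.
rewrite mulmx_kron_idE; apply: has_mean1_sum => c; under eq_fun do rewrite mulrC.
by rewrite mulrC; apply: has_mean1Z; exact: has_meanE.
Qed.

(** Jensen's inequality, from |A|^2 = E <A, h> <= (E |h|^2 + |A|^2) / 2. It turns the second-moment
    bounds on the stochastic derivatives into pointwise bounds on the expected ones. *)
Lemma frob_mean_le m n (h : T -> 'M[R]_(m, n)) A c : 0 <= c ->
  has_mean P h A -> ('E_P[fun w => (frob (h w) ^+ 2)%R] <= (c ^+ 2)%:E)%E ->
  frob A <= c.
Proof.
move=> c0 hA; rewrite unlock => hc.
have mh := has_mean_measurable hA.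
apply: frob_le => //; rewrite -frob_sqr.
have H : mean_le (fun w => frob (h w) ^+ 2) (c ^+ 2).
  apply: mean_le_of_expectation => //; first exact: measurable_sqr_frob.
  by move=> w; exact: sqr_ge0.
  by rewrite unlock.
have [iA EA] := has_mean_dot A hA.
have H2 := mean_leZ (1 / 2) (mean_leD H (mean_le_cst (frob A ^+ 2))).
have : (\int[P]_w (dot A (h w))%:E <= (1 / 2 * (c ^+ 2 + frob A ^+ 2))%:E)%E.
  apply: (@le_trans _ _ (\int[P]_w (`|1 / 2 * (frob (h w) ^+ 2 + frob A ^+ 2)|)%:E)%E).
    apply: le_integral => //.
      have := mean_le_integrable H2 => /integrable_norm.
      by apply: eq_integrable.
    move=> w _; rewrite lee_fin ger0_norm; last by rewrite mulr_ge0// addr_ge0// sqr_ge0.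
    by have := cauchy_schwarz A (h w); have := sqr_ge0 (frob (h w) - frob A); nra.
  by have [_] := H2; rewrite (ger0_norm (sqr_ge0 _)) ger0_norm.
rewrite EA lee_fin -frob_sqr; lra.
Qed.

End mean_bounds.

(** * Independent samples *)

Section subalgebra.
Context {R : realType} {dO : measure_display} {O : measurableType dO}.
Variables (G : set (set O)).
Hypothesis Gm : <<s G >> `<=` measurable.

Lemma measurable_fun_subalgebra dY (Y : measurableType dY) (f : O -> Y) :
  measurable_fun (setT : set (g_sigma_algebraType G)) f -> measurable_fun setT f.
Proof. by move=> mf mD B mB; exact: (Gm (mf measurableT B mB)). Qed.

Lemma measurable_mx_subalgebra m n (A : O -> 'M[R]_(m, n)) :
  @measurable_mx R _ (g_sigma_algebraType G) m n A -> measurable_mx A.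
Proof. by move=> mA i j; apply: measurable_fun_subalgebra; exact: mA. Qed.

End subalgebra.

Section decoupling.
Context {R : realType} {dO : measure_display} {O : measurableType dO}.
Variables (P : probability O R) (G : set (set O)).
Hypotheses (Gm : G `<=` measurable) (GI : setI_closed G) (GT : G setT).
Context {dY : measure_display} {Y : measurableType dY}.
Variables (D : probability Y R) (X : O -> Y).
Hypothesis mX : measurable_fun setT X.
Hypothesis indep : forall A B, G A -> measurable B ->
  P (A `&` X @^-1` B) = (P A * D B)%E.

Local Notation OG := (g_sigma_algebraType G).

Let sGm : <<s G >> `<=` measurable.
Proof. exact: smallest_sub (@sigma_algebra_measurable _ O) Gm. Qed.

(** For fixed B both sides are finite measures in A; they agree on G, which is stable under
    intersection and contains the whole space, hence on the sigma-algebra it generates. *)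
Let indep_sigma A B : <<s G >> A -> measurable B ->
  P (A `&` X @^-1` B) = (P A * D B)%E.
Proof.
move=> sA mB.
have mXB : measurable (X @^-1` B).
  by rewrite -[X in measurable X]setTI; exact: mX.
have DBfin : D B \is a fin_num by exact: fin_num_measure.
pose r : {nonneg R} := NngNum (fine_ge0 (measure_ge0 D B)).
have rE C : (P C * D B = mscale r P C)%E by rewrite /mscale /= fineK// muleC.
rewrite rE -/(mrestr P mXB A).
apply: (@g_sigma_algebra_measure_unique _ _ _ G Gm (fun=> setT)) => //.
- by apply/seteqP; split => // x _; exists 0%N.
- by move=> C GC; rewrite -[RHS]rE -indep.
- by move=> k; rewrite /= /mrestr setTI (le_lt_trans (probability_le1 _ _))// ltry.
Qed.

Let mid : measurable_fun (setT : set O) (id : O -> OG).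
Proof. by move=> _ B sB; rewrite setTI preimage_id; exact: sGm. Qed.

Let mpair : measurable_fun (setT : set O) (fun w => (w, X w) : OG * Y).
Proof. exact: measurable_fun_pair. Qed.

(** The identity into the coarser measurable space carries exactly the information of G; [pairG]
    adjoins the independent sample, and their joint law is a product. *)
Let idG : {mfun O >-> OG} := HB.pack (id : O -> OG) (isMeasurableFun.Build _ _ _ _ _ mid).
Let pairG : {mfun O >-> (OG * Y)%type} :=
  HB.pack (fun w => (w, X w) : OG * Y) (isMeasurableFun.Build _ _ _ _ _ mpair).

Let joint_law A : measurable A ->
  (distribution P idG \x D)%E A = distribution P pairG A.
Proof.
by move=> mA; apply: product_measure_unique => //.
Qed.

(** Freezing: what is determined by G stays fixed at w while the independent sample is averaged over
    its own law. *)
Lemma integral_decoupled (f : OG * Y -> \bar R) :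
  measurable_fun setT f -> (forall p, 0 <= f p)%E ->
  (\int[P]_w f (w, X w) = \int[P]_w \int[D]_y f (w, y))%E.
Proof.
move=> mf f0.
transitivity (\int[distribution P pairG]_p f p)%E.
  by rewrite ge0_integral_distribution.
transitivity (\int[distribution P idG \x D]_p f p)%E.
  by apply: eq_measure_integral => A mA _; exact/esym/joint_law.
rewrite fubini_tonelli1//; rewrite ge0_integral_distribution//.
  exact: measurable_fun_fubini_tonelli_F.
by move=> w; exact: integral_ge0.
Qed.

Lemma mean_le_decoupled (f : OG * Y -> R) (b : O -> R) c :
  measurable_fun setT f -> (forall p, 0 <= f p) ->
  (forall w, \int[D]_y (f (w, y))%:E <= (b w)%:E)%E ->
  mean_le P b c -> mean_le P (fun w => f (w, X w)) c.
Proof.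
move=> mf f0 fb [mb bc]; split; first exact: measurableT_comp mpair.
apply: le_trans bc.
under eq_integral do rewrite ger0_norm//.
rewrite (integral_decoupled (f := EFin \o f)); last 2 first.
- exact/measurable_EFinP.
- by move=> p; rewrite lee_fin.
have b0 w : 0 <= b w.
  by rewrite -lee_fin (le_trans _ (fb w))// integral_ge0// => y _; rewrite lee_fin.
apply: ge0_le_integral => //.
- by move=> w _; apply: integral_ge0 => y _; rewrite lee_fin.
- apply: (measurable_fun_subalgebra sGm).
  apply: (@measurable_fun_fubini_tonelli_F _ _ _ _ _ D (EFin \o f)) => //.
    exact/measurable_EFinP.
- by apply/measurable_EFinP; exact: measurableT_comp.
- by move=> w _; rewrite ger0_norm//; exact: fb.
Qed.

(** For a signed integrand Fubini requires integrability, which the bound [c] supplies; the inner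
    integral then vanishes for every w. *)
Lemma integral_decoupled_eq0 (f : OG * Y -> R) c :
  measurable_fun setT f -> (forall w, has_mean1 D (fun y => f (w, y)) 0) ->
  mean_le P (fun w => f (w, X w)) c ->
  (\int[P]_w (f (w, X w))%:E = 0)%E.
Proof.
move=> mf f0 fc.
have If : (distribution P pairG).-integrable setT (EFin \o f).
  apply: integrable_pushforward => //; first exact/measurable_EFinP.
  exact: mean_le_integrable fc.
transitivity (\int[distribution P pairG]_p (f p)%:E)%E.
  by rewrite integral_distribution//; [exact/measurable_EFinP|exact: mean_le_integrable fc].
transitivity (\int[distribution P idG \x D]_p (f p)%:E)%E.
  by apply: eq_measure_integral => A mA _; exact/esym/joint_law.
have If' : (distribution P idG \x D)%E.-integrable setT (EFin \o f).
  apply/integrableP; split; first exact/measurable_EFinP.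
  have /integrableP[_] := If; congr (_ < _)%E.
  by apply: eq_measure_integral => A mA _; exact/esym/joint_law.
rewrite -(integral12_prod_meas1 If').
rewrite -[RHS](integral0 (distribution P idG) setT).
by apply: eq_integral => w _; exact: (f0 w).2.
Qed.

End decoupling.

(** * Information carried by a set of samples *)

Section cylinders.
Context {R : realType} {dO : measure_display} {O : measurableType dO}.
Variables (P : probability O R) (I : choiceType) (E : I -> set (set O)).
Hypotheses (Em : forall i, E i `<=` measurable) (EI : forall i, setI_closed (E i)).
Hypothesis ET : forall i, E i setT.
Hypothesis Eindep : mutually_independent P E.

(** Finite intersections form an intersection-stable generator of the information in S and are
    exactly the sets to which the product rule of independence applies. *)
Definition cylinders (S : set I) : set (set O) :=
  [set A | exists (s : seq I) (B : I -> set O),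
    [/\ uniq s, (forall i, i \in s -> S i /\ E i (B i)) &
        A = \bigcap_(i in [set` s]) B i]].

Lemma cylinders_setT S : cylinders S setT.
Proof. by exists [::], (fun=> setT); split => //; rewrite set_nil bigcap_set0. Qed.

Lemma cylinders_event (S : set I) i A : S i -> E i A -> cylinders S A.
Proof.
move=> Si EA; exists [:: i], (fun=> A); split => // [j|].
  by rewrite inE => /eqP ->.
by rewrite set_cons1 bigcap_set1.
Qed.

Lemma cylinders_sub (S S' : set I) : S `<=` S' -> cylinders S `<=` cylinders S'.
Proof.
move=> SS' A [s [B [us sB ->]]]; exists s, B; split => // i /sB[/SS' ? ?].
by split.
Qed.

Lemma cylinders_measurable S : cylinders S `<=` measurable.
Proof.
move=> A [s [B [us sB ->]]]; apply: fin_bigcap_measurable => // i /= /sB[_].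
exact: Em.
Qed.

Lemma cylinders_setI S : setI_closed (cylinders S).
Proof.
move=> _ _ [s [B [us sB ->]]] [s' [B' [us' sB' ->]]].
(* An index listed on one side only gets the whole space from the other, so that both intersections
   run over one duplicate-free list. *)
pose C i := (if i \in s then B i else setT) `&` (if i \in s' then B' i else setT).
exists (undup (s ++ s')), C; split; first exact: undup_uniq.
  move=> i; rewrite mem_undup mem_cat => /orP H; split.
    by case: H => [/sB[]|/sB'[]].
  by apply: EI; case: ifPn => // H'; [have [] := sB _ H'|have [] := sB' _ H'].
apply/seteqP; split=> w.
  by move=> [sw s'w] i _; split; case: ifPn => // ii; [exact: sw|exact: s'w].
move=> H; split=> i /= ii; have := H i; rewrite /= mem_undup mem_cat ii ?orbT.
  by move=> /(_ isT)[]; rewrite ii.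
by move=> /(_ isT)[]; rewrite ii.
Qed.

(** The index i is new to the list of A; compare the product rule over i :: s with the one over
    s. *)
Lemma cylinders_indep S i A B : ~ S i -> cylinders S A -> E i B ->
  P (A `&` B) = (P A * P B)%E.
Proof.
move=> Si [s [C [us sC ->]]] EB.
have is_ : i \notin s by apply/negP => /sC[].
pose C' j := if j == i then B else C j.
have C'E j : j \in s -> C' j = C j.
  by rewrite /C'; case: eqP => // ->; rewrite (negbTE is_).
have C'i : C' i = B by rewrite /C' eqxx.
have PA := Eindep us (fun j js => (sC j js).2).
have := Eindep (s := i :: s) (A := C') _ _.
rewrite big_cons C'i (eq_big_seq (fun j => P (C j))); last first.
  by move=> j /C'E ->.
rewrite -PA muleC => <-.
- rewrite !bigcap_seq big_cons C'i setIC; congr (P (_ `&` _)).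
  by apply: eq_big_seq => j /C'E ->.
- by rewrite /= is_.
- move=> j; rewrite inE => /orP[/eqP ->|js]; first by rewrite C'i.
  by rewrite C'E//; exact: (sC j js).2.
Qed.

End cylinders.

Section expectation_scale.
Context {R : realType} {d : measure_display} {T : measurableType d}.
Variable P : probability T R.

Lemma expectation_le_scale (f h : T -> R) (a c : R) :
  measurable_fun setT f -> measurable_fun setT h ->
  (forall w, 0 <= h w) -> 0 <= c ->
  (forall w, 0 <= f w <= c * h w) -> ('E_P[h] <= a%:E)%E ->
  ('E_P[f] <= (c * a)%:E)%E.
Proof.
move=> mf mh h0 c0 fh ha; apply: mean_le_expectation; last first.
  by move=> w; have /andP[] := fh w.
have := mean_leZ c (mean_le_of_expectation mh h0 ha); rewrite (ger0_norm c0).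
apply: mean_le_dominated => // w; have /andP[f0 fch] := fh w.
by rewrite ger0_norm.
Qed.

Lemma expectation_sqr_frob_le m n p q (h : T -> 'M[R]_(m, n)) (h' : T -> 'M[R]_(p, q))
    A A' c a :
  has_mean P h A -> has_mean P h' A' -> 0 <= c ->
  (forall w, frob (h' w) <= c * frob (h w)) ->
  ('E_P[fun w => (frob (h w) ^+ 2)%R] <= a%:E)%E ->
  ('E_P[fun w => (frob (h' w) ^+ 2)%R] <= (c ^+ 2 * a)%:E)%E.
Proof.
move=> hA hA' c0 hh'; apply: expectation_le_scale.
- by apply: measurable_sqr_frob; exact: has_mean_measurable hA'.
- by apply: measurable_sqr_frob; exact: has_mean_measurable hA.
- by move=> w; exact: sqr_ge0.
- exact: sqr_ge0.
- move=> w; rewrite sqr_ge0 -exprMn/= ler_pXn2r ?nnegrE ?mulr_ge0 ?frob_ge0//.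
Qed.

End expectation_scale.

Section conditional_step.
Context {R : realType} {dO : measure_display} {O : measurableType dO}.
Variables (P : probability O R) (I : choiceType) (E : I -> set (set O)).
Hypotheses (Em : forall i, E i `<=` measurable) (EI : forall i, setI_closed (E i)).
Hypothesis ET : forall i, E i setT.
Hypothesis Eindep : mutually_independent P E.

Local Notation Sig S := (g_sigma_algebraType (cylinders E S)).
Local Notation adapted S A := (@measurable_mx R _ (Sig S) _ _ A).

Lemma sigma_cylinders_measurable S : <<s cylinders E S >> `<=` measurable.
Proof.
apply: smallest_sub; first exact: sigma_algebra_measurable.
exact: cylinders_measurable.
Qed.

Lemma adapted_sub S S' m n (A : O -> 'M[R]_(m, n)) : S `<=` S' ->
  adapted S A -> adapted S' A.
Proof.
move=> SS' mA i j _ B mB; have := mA i j measurableT B mB.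
by apply: sub_sigma_algebra2; exact: cylinders_sub.
Qed.

Lemma adapted_measurable S m n (A : O -> 'M[R]_(m, n)) :
  adapted S A -> measurable_mx A.
Proof. by apply: measurable_mx_subalgebra; exact: sigma_cylinders_measurable. Qed.

Context {dY : measure_display} {Y : measurableType dY}.
Variables (D : probability Y R) (X : {RV P >-> Y}) (i : I).
Hypothesis EiX : E i = preimage_set_system setT X measurable.
Hypothesis XD : forall B, measurable B -> distribution P X B = D B.

Lemma measurable_sample (S : set I) : S i ->
  measurable_fun (setT : set (Sig S)) (X : O -> Y).
Proof.
move=> Si _ B mB; apply: sub_sigma_algebra; apply: cylinders_event Si _.
by rewrite EiX; exists B.
Qed.

Variable S : set I.
Hypothesis Si : ~ S i.

Let indepX A B : cylinders E S A -> measurable B ->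
  P (A `&` X @^-1` B) = (P A * D B)%E.
Proof.
move=> SA mB; rewrite (cylinders_indep Eindep Si SA).
  by rewrite -XD.
by rewrite EiX; exists B => //; rewrite setTI.
Qed.

Let mX : measurable_fun setT (X : O -> Y).
Proof. exact: measurable_funP. Qed.

Variables (m n : nat) (h : Sig S * Y -> 'M[R]_(m, n)) (b : O -> R) (c : R).
Hypothesis mh : measurable_mx h.
Hypothesis hb : forall w : O,
  ('E_D[fun y => (frob (h (w, y)) ^+ 2)%R] <= (b w)%:E)%E.
Hypothesis bc : mean_le P b c.

Lemma conditional_bound : mean_le P (fun w => frob (h (w, X w)) ^+ 2) c.
Proof.
have H := mean_le_decoupled (cylinders_measurable Em (S := S))
  (cylinders_setI EI ET (S := S)) (cylinders_setT E S) mX indepX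
  (f := fun p => frob (h p) ^+ 2) (b := b) (c := c).
apply: H => //.
- exact: measurable_sqr_frob.
- by move=> p; exact: sqr_ge0.
- by move=> w; have := hb w; rewrite unlock.
Qed.

(** A martingale increment without conditional expectations: with w frozen, <A w, h (w, y)> is
    linear in the centered h, so the cross term vanishes. *)
Lemma conditional_step (A : O -> 'M[R]_(m, n)) a :
  adapted S A -> (forall w : O, has_mean D (fun y => h (w, y)) 0) ->
  mean_le P (fun w => frob (A w) ^+ 2) a ->
  mean_le P (fun w => frob (A w + h (w, X w)) ^+ 2) (a + c).
Proof.
move=> mA h0 Aa.
have mhX : measurable_mx (fun w : O => h (w, X w)).
  move=> i' j'; apply: (measurableT_comp (mh i' j')).
  apply: measurable_fun_pair => //.
  by move=> _ B sB; rewrite setTI; exact: (sigma_cylinders_measurable sB).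
apply: (mean_le_frobD_orthogonal (adapted_measurable mA) mhX Aa conditional_bound).
have mf : measurable_fun setT (fun p : Sig S * Y => dot (A p.1) (h p)).
  apply: measurable_dot => // i' j'.
  by apply: (measurableT_comp (mA i' j')); exact: measurable_fst.
have Ah : mean_le P (fun w => dot (A w) (h (w, X w))) (a + c).
  apply: mean_le_dominated (mean_leD Aa conditional_bound).
    by apply: measurable_dot => //; exact: adapted_measurable mA.
  move=> w; have := dot_norm_le (A w) (h (w, X w)).
  have := sqr_ge0 (frob (A w) - frob (h (w, X w))).
  have := sqr_ge0 (frob (A w) + frob (h (w, X w))); nra.
apply: (integral_decoupled_eq0 (cylinders_measurable Em (S := S)) (cylinders_setI EI ET (S := S))
  (cylinders_setT _ _) mX indepX mf _ Ah) => w.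
by have := has_mean_dot (A w) (h0 w); rewrite dotC dot0l.
Qed.

End conditional_step.

(** * The expected problem *)

Section expected_problem.
Context (R : realType) (K m n d : nat).
Hypotheses (K_gt0 : (0 < K)%N) (m_gt0 : (0 < m)%N) (n_gt0 : (0 < n)%N)
  (d_gt0 : (0 < d)%N).
Variables (g : 'I_K -> 'M[R]_(m, n) -> 'cV[R]_d) (f : 'I_K -> 'cV[R]_d -> R).
Hypothesis g_diff : forall k (W : 'M[R]_(m, n)), differentiable (g k) W.
Hypothesis f_diff : forall k (y : 'cV[R]_d), differentiable (f k) y.
Variables (C_g C_f L_g L_f : R).
Hypotheses (C_g_gt0 : 0 < C_g) (C_f_gt0 : 0 < C_f).
Hypothesis jac_le : forall k W, frob (jac (g k) W) <= C_g.
Hypothesis grad_le : forall k y, frob (grad (f k) y) <= C_f.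
Hypothesis dg_lip : forall k W1 W2,
  frob (jac (g k) W1 - jac (g k) W2) <= L_g * frob (W1 - W2).
Hypothesis df_lip : forall k y1 y2,
  frob (grad (f k) y1 - grad (f k) y2) <= L_f * frob (y1 - y2).

(** The Lipschitz constants of the problem come without a sign; testing on the all-ones matrix,
    which is nonzero in positive dimensions, provides it. *)
Lemma lipschitz_const_ge0 p q (L : R) (F : 'M[R]_(p, q) -> R) :
  (0 < p)%N -> (0 < q)%N -> (forall A, 0 <= F A) ->
  (forall A, F A <= L * frob A) -> 0 <= L.
Proof.
move=> p0 q0 F0 FL; pose A : 'M[R]_(p, q) := const_mx 1.
have : 0 < frob A.
  rewrite lt_def frob_ge0 andbT; apply/eqP => /frob_eq0/matrixP.
  move/(_ (Ordinal p0) (Ordinal q0)); rewrite !mxE => /eqP.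
  by rewrite oner_eq0.
move=> A0; have := le_trans (F0 A) (FL A).
by rewrite pmulr_lge0.
Qed.

Lemma L_f_ge0 : 0 <= L_f.
Proof.
apply: (@lipschitz_const_ge0 d 1 _
  (fun y => frob (grad (f (Ordinal K_gt0)) y - grad (f (Ordinal K_gt0)) 0))) => //.
  by move=> y; exact: frob_ge0.
by move=> y; rewrite (le_trans (df_lip _ _ _))// subr0.
Qed.

Lemma L_g_ge0 : 0 <= L_g.
Proof.
apply: (@lipschitz_const_ge0 m n _
  (fun W => frob (jac (g (Ordinal K_gt0)) W - jac (g (Ordinal K_gt0)) 0))) => //.
  by move=> y; exact: frob_ge0.
by move=> y; rewrite (le_trans (dg_lip _ _ _))// subr0.
Qed.

Lemma inner_lip k W1 W2 : frob (g k W1 - g k W2) <= C_g * frob (W1 - W2).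
Proof. exact: lipschitz_of_jac. Qed.

Lemma grad_client_obj k W :
  grad (client_obj g f k) W = jac (g k) W *m kron_id n (grad (f k) (g k W)).
Proof. exact: (grad_comp (g_diff k W) (f_diff k _)). Qed.

Let L_F := C_f * L_g + C_g ^+ 2 * L_f.

Lemma L_F_ge0 : 0 <= L_F.
Proof.
have := L_g_ge0; have := L_f_ge0 => hf hg.
by rewrite addr_ge0// mulr_ge0 ?sqr_ge0// ltW.
Qed.

(** Moving the Jacobian against a bounded outer gradient costs C_f L_g; moving the outer gradient
    costs C_g times L_f times the Lipschitz constant C_g of g. *)
Lemma grad_client_obj_lip k W1 W2 :
  frob (grad (client_obj g f k) W1 - grad (client_obj g f k) W2)
    <= L_F * frob (W1 - W2).
Proof.
rewrite !grad_client_obj.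
have -> : jac (g k) W1 *m kron_id n (grad (f k) (g k W1)) -
    jac (g k) W2 *m kron_id n (grad (f k) (g k W2)) =
    (jac (g k) W1 - jac (g k) W2) *m kron_id n (grad (f k) (g k W1)) +
    jac (g k) W2 *m kron_id n (grad (f k) (g k W1) - grad (f k) (g k W2)).
  by rewrite mulmx_kron_idBl mulmx_kron_idBr addrA subrK.
apply: (le_trans (frobD _ _)); rewrite mulrDl; apply: lerD.
  apply: (le_trans (frob_mulmx_kron_id _ _)).
  rewrite (mulrC C_f) mulrAC ler_pM ?frob_ge0//.
apply: (le_trans (frob_mulmx_kron_id _ _)).
rewrite expr2 -!mulrA ler_pM ?frob_ge0//.
apply: (le_trans (df_lip _ _ _)); rewrite mulrCA ler_wpM2l ?L_f_ge0//.
exact: inner_lip.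
Qed.

Lemma client_obj_diff k W : differentiable (client_obj g f k) W.
Proof. exact: (differentiable_comp (f := g k) (g := f k)). Qed.

Let objE : obj g f = K%:R^-1 *: (\sum_(k < K) client_obj g f k).
Proof. by apply/funext => W; rewrite /obj /= fct_sumE. Qed.

Lemma obj_diff W : differentiable (obj g f) W.
Proof.
rewrite objE; apply: differentiableZ; apply: differentiable_sum => k.
exact: client_obj_diff.
Qed.

Lemma grad_obj W : grad (obj g f) W = avg (fun k => grad (client_obj g f k) W).
Proof.
apply/matrixP => i j; rewrite !mxE summxE objE deriveZ; last first.
  by apply: derivable_sum => k; exact/diff_derivable/client_obj_diff.
rewrite derive_sum; last by move=> k; exact/diff_derivable/client_obj_diff.
by congr (_ * _); apply: eq_bigr => k _; rewrite mxE.
Qed.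

Lemma grad_obj_lip W1 W2 :
  frob (grad (obj g f) W1 - grad (obj g f) W2) <= L_F * frob (W1 - W2).
Proof.
rewrite !grad_obj -avgB (le_trans (frob_avg _))//.
rewrite -[leRHS](mean_cst K_gt0) ler_mean// => k; exact: grad_client_obj_lip.
Qed.

End expected_problem.

(** * Measurability of the oracles along random arguments *)

Section measurable_oracles.
Context {R : realType} {m n d : nat}.
Context {dY : measure_display} {Y : measurableType dY}.

(** The oracle is continuous in the matrix, being differentiable, and measurable in the sample,
    which is part of the integrability in [has_mean]. *)
Lemma measurable_mx_eval {dX : measure_display} {X : measurableType dX}
    (D : probability X R) (gs : 'M[R]_(m, n) -> X -> 'cV[R]_d)
    (g : 'M[R]_(m, n) -> 'cV[R]_d) (A : Y -> 'M[R]_(m, n)) (x : Y -> X) :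
  (forall x W, differentiable (fun V : 'M[R]_(m, n) => gs V x) W) ->
  (forall W, has_mean D (gs W) (g W)) ->
  measurable_mx A -> measurable_fun setT x ->
  measurable_mx (fun y => gs (A y) (x y)).
Proof.
move=> dgs mgs mA mx i j; apply: (measurable_caratheodory
  (h := fun B y => gs B (x y) i j)) => //.
  move=> B; have [/measurable_int/measurable_EFinP mg _] := mgs B i j.
  exact: measurableT_comp mg mx.
move=> y B; apply: differentiable_continuous; rewrite ord1.
exact: differentiable_coef.
Qed.

Lemma measurable_mx_jac {dX : measure_display} {X : measurableType dX}
    (D : probability X R) (gs : 'M[R]_(m, n) -> X -> 'cV[R]_d)
    (g : 'M[R]_(m, n) -> 'cV[R]_d) (A : Y -> 'M[R]_(m, n)) (x : Y -> X) :
  (forall x W, differentiable (fun V : 'M[R]_(m, n) => gs V x) W) ->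
  (forall W, has_mean D (gs W) (g W)) ->
  measurable_mx A -> measurable_fun setT x ->
  measurable_mx (fun y => jac (fun V => gs V (x y)) (A y)).
Proof.
move=> dgs mgs mA mx i j; under eq_fun do rewrite mxE.
apply: (measurable_grad_along (h := fun B y => gs B (x y) (mxtens_unindex j).1 0)) => //.
  move=> B; have [/measurable_int/measurable_EFinP mg _] := mgs B (mxtens_unindex j).1 0.
  exact: measurableT_comp mg mx.
by move=> y B; exact: differentiable_coef.
Qed.

Lemma measurable_mx_grad {dZ : measure_display} {Z : measurableType dZ}
    (D : probability Z R) (fs : 'cV[R]_d -> Z -> R) (u : Y -> 'cV[R]_d) (z : Y -> Z) :
  (forall z y, differentiable (fun y' : 'cV[R]_d => fs y' z) y) ->
  (forall y, D.-integrable setT (EFin \o fs y)) ->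
  measurable_mx u -> measurable_fun setT z ->
  measurable_mx (fun y => grad (fun v => fs v (z y)) (u y)).
Proof.
move=> dfs ifs mu mz.
apply: (measurable_grad_along (h := fun B y => fs B (z y))) => // B.
have /measurable_int/measurable_EFinP mf := ifs B.
exact: measurableT_comp mf mz.
Qed.

Lemma measurable_mx_comp_diff (g : 'M[R]_(m, n) -> 'cV[R]_d) (A : Y -> 'M[R]_(m, n)) :
  (forall W, differentiable g W) -> measurable_mx A ->
  measurable_mx (fun y => g (A y)).
Proof.
move=> dg mA i j; apply: (measurable_caratheodory (h := fun B y => g B i j)) => //.
move=> y B; apply: differentiable_continuous; rewrite ord1.
exact: differentiable_coef.
Qed.

Lemma measurable_mx_comp_jac (g : 'M[R]_(m, n) -> 'cV[R]_d) (A : Y -> 'M[R]_(m, n)) :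
  (forall W, differentiable g W) -> measurable_mx A ->
  measurable_mx (fun y => jac g (A y)).
Proof.
move=> dg mA i j; under eq_fun do rewrite mxE.
apply: (measurable_grad_along (h := fun B y => g B (mxtens_unindex j).1 0)) => //.
by move=> y B; exact: differentiable_coef.
Qed.

Lemma measurable_mx_comp_grad p q (f : 'M[R]_(p, q) -> R) (u : Y -> 'M[R]_(p, q)) :
  (forall y, differentiable f y) -> measurable_mx u ->
  measurable_mx (fun y => grad f (u y)).
Proof. by move=> df mu; apply: (measurable_grad_along (h := fun B y => f B)). Qed.

End measurable_oracles.

(** * A single trajectory *)

Section trajectory.
Context (R : realType) (K m n d : nat).
Hypotheses (K_gt0 : (0 < K)%N) (m_gt0 : (0 < m)%N) (n_gt0 : (0 < n)%N)
  (d_gt0 : (0 < d)%N).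
Variables (g : 'I_K -> 'M[R]_(m, n) -> 'cV[R]_d) (f : 'I_K -> 'cV[R]_d -> R).
Hypothesis g_diff : forall k (W : 'M[R]_(m, n)), differentiable (g k) W.
Hypothesis f_diff : forall k (y : 'cV[R]_d), differentiable (f k) y.
Variables (C_g C_f L_g L_f : R).
Hypotheses (C_g_gt0 : 0 < C_g) (C_f_gt0 : 0 < C_f).
Hypothesis jac_le : forall k W, frob (jac (g k) W) <= C_g.
Hypothesis grad_le : forall k y, frob (grad (f k) y) <= C_f.
Hypothesis dg_lip : forall k W1 W2,
  frob (jac (g k) W1 - jac (g k) W2) <= L_g * frob (W1 - W2).
Hypothesis df_lip : forall k y1 y2,
  frob (grad (f k) y1 - grad (f k) y2) <= L_f * frob (y1 - y2).
Variable delta : R.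
Hypothesis delta_ge0 : 0 <= delta.
Hypothesis heterogeneity : forall W,
  K%:R^-1 * \sum_k frob (grad (client_obj g f k) W - grad (obj g f) W) ^+ 2
    <= delta ^+ 2.

Variables (X Z : 'I_K -> Type).
Variables (gs : forall k, 'M[R]_(m, n) -> X k -> 'cV[R]_d).
Variables (fs : forall k, 'cV[R]_d -> Z k -> R).
Variables (eta alpha beta : R) (tau : nat) (W0 : 'M[R]_(m, n)).
Hypotheses (eta_gt0 : 0 < eta) (alpha_gt0 : 0 < alpha) (alpha_lt1 : alpha < 1)
  (beta_gt0 : 0 < beta) (beta_lt1 : beta < 1) (tau_gt0 : (0 < tau)%N)
  (alpha_tau : alpha * tau%:R <= 1).
Variables (x : nat -> forall k, X k) (z : nat -> forall k, Z k).
Variables (W Wt : nat -> 'I_K -> 'M[R]_(m, n)) (u : nat -> 'I_K -> 'cV[R]_d)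
  (M Mt : nat -> 'I_K -> 'M[R]_(m, n)).
Hypothesis run : FedCoMuon gs fs eta alpha beta tau W0 x z W Wt u M Mt.

(* The point at which client k samples at time t; it extends the local iterates
   before synchronization to time 0. *)
Definition sampled_at t k : 'M[R]_(m, n) := if t is 0%N then W0 else Wt t k.

Definition sample_grad t k : 'M[R]_(m, n) :=
  sgrad gs fs (sampled_at t k) (u t k) (x t k) (z t k).

Definition sample_jac t k : 'M[R]_(m, d * n) :=
  jac (fun V => gs V (x t k)) (sampled_at t k).

Definition inner_noise t k : 'cV[R]_d :=
  gs (sampled_at t k) (x t k) - g k (sampled_at t k).

Definition outer_grad_noise t k : 'M[R]_(m, n) :=
  sample_jac t k *m kron_id n
    (grad (fun y => fs y (z t k)) (u t k) - grad (f k) (u t k)).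

(** The second factor is known before [xi t k] is drawn, as it would not be with [u t k] in place of
    the exact inner value. *)
Definition jac_noise t k : 'M[R]_(m, n) :=
  (sample_jac t k - jac (g k) (sampled_at t k)) *m
    kron_id n (grad (f k) (g k (sampled_at t k))).

Definition grad_noise t k : 'M[R]_(m, n) := jac_noise t k + outer_grad_noise t k.

Definition grad_bias t k : 'M[R]_(m, n) :=
  sample_jac t k *m kron_id n
    (grad (f k) (u t k) - grad (f k) (g k (sampled_at t k))).

Lemma sample_gradE t k : sample_grad t k =
  grad_noise t k + grad_bias t k + grad (client_obj g f k) (sampled_at t k).
Proof.
rewrite grad_client_obj// /grad_noise /jac_noise /outer_grad_noise /grad_bias.
rewrite /sample_grad /sgrad -/(sample_jac t k).
rewrite mulmx_kron_idBl 2!mulmx_kron_idBr.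
have regroup (A B C E : 'M[R]_(m, n)) : A = B - E + (A - C) + (C - B) + E.
  by apply/matrixP => i j; rewrite !mxE; ring.
exact: regroup.
Qed.

Lemma frob_grad_bias t k :
  frob (grad_bias t k) <=
    L_f * (frob (sample_jac t k) * frob (u t k - g k (sampled_at t k))).
Proof.
apply: (le_trans (frob_mulmx_kron_id _ _)); rewrite mulrCA ler_wpM2l ?frob_ge0//.
Qed.

Fixpoint inner_noise_avg t k : 'cV[R]_d :=
  if t is t'.+1 then (1 - alpha) *: inner_noise_avg t' k + alpha *: inner_noise t k
  else inner_noise 0 k.

(** It starts at 0 although [Mbar 0] carries noise: the initial noise is charged to [drift], so that
    the variance here is of order beta / K from the start. *)
Fixpoint grad_noise_avg t : 'M[R]_(m, n) :=
  if t is t'.+1 then (1 - beta) *: grad_noise_avg t' + beta *: avg (grad_noise t)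
  else 0.

(** This is the polar factor U V^T, recovered from the iterates so that no decomposition has to be
    chosen. *)
Definition step_dir t k : 'M[R]_(m, n) := eta^-1 *: (W t k - Wt t.+1 k).

Lemma step_dirE t k : Wt t.+1 k = W t k - eta *: step_dir t k.
Proof.
rewrite /step_dir scalerA divff ?gt_eqF// scale1r; apply/matrixP => i j.
by rewrite !mxE; ring.
Qed.

Lemma step_dirP t k : exists r (U : 'M[R]_(m, r)) (s : 'rV_r) (V : 'M[R]_(n, r)),
  compact_svd (M t k) U s V /\ step_dir t k = U *m V^T.
Proof.
have [r [U [s [V [svd E]]]]] := step_W run t k; exists r, U, s, V; split => //.
rewrite /step_dir E opprB addrC subrK scalerA mulVf ?scale1r// gt_eqF//.
Qed.

Local Notation rn := (Num.sqrt n%:R : R).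

Lemma sqrtn_ge1 : 1 <= rn.
Proof. by rewrite -{1}[1]sqrtr1 ler_sqrt ?ler0n// ler1n. Qed.

Lemma frob_step_dir t k : frob (step_dir t k) <= rn.
Proof.
have [r [U [s [V [svd ->]]]]] := step_dirP t k.
exact: compact_svd_frob_polar svd.
Qed.

Lemma dot_step_dir t k : frob (M t k) <= dot (M t k) (step_dir t k).
Proof.
have [r [U [s [V [svd ->]]]]] := step_dirP t k.
exact: compact_svd_dot_polar svd.
Qed.

Definition Wbar t := avg (W t).
Definition Mbar t := avg (M t).

Lemma Wbar0 : Wbar 0 = W0.
Proof.
rewrite /Wbar (_ : W 0%N = fun=> W0) ?(avg_cst K_gt0)//.
by apply/funext => k; rewrite (init_W run).
Qed.

(** Replacing the iterates by their average does not change the average, so [Wbar] does not notice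
    synchronization. *)
Lemma avg_sampled_at t : avg (sampled_at t) = Wbar t.
Proof.
case: t => [|t]; first by rewrite Wbar0 (avg_cst K_gt0).
rewrite /Wbar; have -> : W t.+1 = if (tau %| t.+1)%N then fun=> avg (Wt t.+1) else Wt t.+1.
  by apply/funext => k; rewrite (sync_W run); case: ifP.
by case: ifP => // _; rewrite (avg_cst K_gt0).
Qed.

Lemma WbarS t : Wbar t.+1 = Wbar t - eta *: avg (step_dir t).
Proof.
rewrite -avg_sampled_at /= -avgZ -avgB; congr avg.
by apply/funext => k; exact: step_dirE.
Qed.

Lemma frob_avg_step_dir t : frob (avg (step_dir t)) <= rn.
Proof.
rewrite (le_trans (frob_avg _))// -[leRHS](mean_cst K_gt0) ler_mean// => k.
exact: frob_step_dir.
Qed.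

Lemma frob_WbarS t : frob (Wbar t.+1 - Wbar t) <= eta * rn.
Proof.
rewrite WbarS addrC addKr frobN frobZ gtr0_norm// ler_wpM2l ?(ltW eta_gt0)//.
exact: frob_avg_step_dir.
Qed.

(** Two clients agree right after a synchronization, then separate by at most 2 eta sqrt n per step;
    t mod tau counts the steps since. *)
Lemma frob_iterate_pair t k j :
  frob (W t k - W t j) <= 2 * eta * rn * (t %% tau)%:R.
Proof.
elim: t => [|t IH].
  by rewrite !(init_W run) subrr frob0 mod0n mulr0.
rewrite !(sync_W run); case: ifPn => dv.
  by rewrite subrr frob0 mulr_ge0// mulr_ge0 ?sqrtr_ge0// mulr_ge0// ltW.
have -> : (t.+1 %% tau = (t %% tau).+1)%N.
  by rewrite modnS (negbTE dv).
rewrite !step_dirE.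
have -> : W t k - eta *: step_dir t k - (W t j - eta *: step_dir t j) =
   W t k - W t j + eta *: (step_dir t j - step_dir t k).
  by apply/matrixP => a b; rewrite !mxE; ring.
rewrite (le_trans (frobD _ _))// frobZ gtr0_norm//.
have h : eta * frob (step_dir t j - step_dir t k) <= eta * (2 * rn).
  rewrite ler_wpM2l ?(ltW eta_gt0)// (le_trans (frobB _ _))//.
  by have := frob_step_dir t j; have := frob_step_dir t k; lra.
rewrite -natr1; nra.
Qed.

Local Notation rho := (2 * eta * rn * tau%:R).

Let rho_ge0 : 0 <= rho.
Proof. by rewrite mulr_ge0// mulr_ge0 ?sqrtr_ge0// mulr_ge0// ltW. Qed.

Lemma frob_sampled_pair t k j :
  frob (sampled_at t k - sampled_at t j) <= rho.
Proof.
case: t => [|t] /=; first by rewrite subrr frob0.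
rewrite !step_dirE.
have -> : W t k - eta *: step_dir t k - (W t j - eta *: step_dir t j) =
   W t k - W t j + eta *: (step_dir t j - step_dir t k).
  by apply/matrixP => a b; rewrite !mxE; ring.
rewrite (le_trans (frobD _ _))// frobZ gtr0_norm//.
have h : eta * frob (step_dir t j - step_dir t k) <= eta * (2 * rn).
  rewrite ler_wpM2l ?(ltW eta_gt0)// (le_trans (frobB _ _))//.
  by have := frob_step_dir t j; have := frob_step_dir t k; lra.
have := frob_iterate_pair t k j.
(* Sampling takes place before the synchronization of time t + 1, so the count of steps may reach
   tau here. *)
have : (t %% tau)%:R + 1 <= tau%:R :> R by rewrite natr1 ler_nat ltn_pmod.
have : 0 <= eta * rn by rewrite mulr_ge0 ?sqrtr_ge0// ltW.
nra.
Qed.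

Lemma frob_sampled_Wbar t k : frob (sampled_at t k - Wbar t) <= rho.
Proof.
rewrite -avg_sampled_at -[X in frob (X - _)](avg_cst K_gt0) -avgB.
rewrite (le_trans (frob_avg _))// -[leRHS](mean_cst K_gt0) ler_mean// => j.
exact: frob_sampled_pair.
Qed.

Lemma inner_error t k :
  frob (u t k - g k (sampled_at t k)) <=
    frob (inner_noise_avg t k) + 5 * (C_g * eta * rn / alpha).
Proof.
have ern : 0 <= eta * rn by rewrite mulr_ge0 ?sqrtr_ge0// ltW.
have ar : alpha * rho <= 2 * (eta * rn).
  have := mulr_ge0 ern ern; have := alpha_tau; nra.
set b := C_g * eta * rn / alpha.
have ab : alpha * b = C_g * eta * rn by rewrite /b mulrC divfK ?gt_eqF.
(* The value 3 b solves e = (1 - alpha) e + 3 C_g eta sqrt n: the gap between client and average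
   costs alpha C_g rho <= 2 C_g eta sqrt n, as alpha tau <= 1, and the motion of [Wbar] costs C_g
   eta sqrt n. *)
have H : frob (u t k - inner_noise_avg t k - g k (Wbar t)) <= 3 * b.
  elim: t => [|t IH].
    rewrite (init_u run) Wbar0 /= /inner_noise /=.
    rewrite [X in frob X](_ : _ = 0); last by apply/matrixP => i j; rewrite !mxE; ring.
    by rewrite frob0 mulr_ge0// divr_ge0 ?(ltW alpha_gt0)// -mulrA mulr_ge0// ltW.
  rewrite (step_u run) /= /inner_noise /=.
  set E := u t k - inner_noise_avg t k - g k (Wbar t) in IH.
  set G1 := g k (Wt t.+1 k).
  have -> : alpha *: gs (Wt t.+1 k) (x t.+1 k) + (1 - alpha) *: u t k -
     ((1 - alpha) *: inner_noise_avg t k + alpha *: (gs (Wt t.+1 k) (x t.+1 k) - G1)) -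
     g k (Wbar t.+1) = alpha *: (G1 - g k (Wbar t.+1)) + (1 - alpha) *: E +
       (1 - alpha) *: (g k (Wbar t) - g k (Wbar t.+1)).
    by apply/matrixP => i j; rewrite !mxE; ring.
  rewrite (le_trans (frobD _ _))//.
  have := frobD (alpha *: (G1 - g k (Wbar t.+1))) ((1 - alpha) *: E).
  rewrite !frobZ gtr0_norm// gtr0_norm ?subr_gt0//.
  have h1 := inner_lip g_diff jac_le k (sampled_at t.+1 k) (Wbar t.+1).
  have h2 := inner_lip g_diff jac_le k (Wbar t) (Wbar t.+1).
  have h3 := frob_sampled_Wbar t.+1 k.
  have h4 := frob_WbarS t; rewrite frobBC in h4.
  have h5 : frob (G1 - g k (Wbar t.+1)) <= C_g * rho.
    by rewrite (le_trans h1)// ler_wpM2l// ltW.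
  have h6 : frob (g k (Wbar t) - g k (Wbar t.+1)) <= C_g * (eta * rn).
    by rewrite (le_trans h2)// ler_wpM2l// ltW.
  have h7 : alpha * frob (G1 - g k (Wbar t.+1)) <= C_g * (2 * (eta * rn)).
    rewrite (le_trans (ler_wpM2l (ltW alpha_gt0) h5))// mulrCA ler_wpM2l//.
    exact: ltW.
  have h8 : (1 - alpha) * frob (g k (Wbar t) - g k (Wbar t.+1)) <= C_g * (eta * rn).
    rewrite -[leRHS]mul1r ler_pM ?frob_ge0 ?subr_ge0 ?(ltW alpha_lt1)//.
    by rewrite lerBlDr lerDl ltW.
  have h9 : (1 - alpha) * frob E <= (1 - alpha) * (3 * b).
    by rewrite ler_wpM2l// subr_ge0 ltW.
  nra.
have h1 := inner_lip g_diff jac_le k (Wbar t) (sampled_at t k).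
have h2 := frob_sampled_Wbar t k; rewrite frobBC in h2.
have -> : u t k - g k (sampled_at t k) = inner_noise_avg t k +
  ((u t k - inner_noise_avg t k - g k (Wbar t)) + (g k (Wbar t) - g k (sampled_at t k))).
  by apply/matrixP => i j; rewrite !mxE; ring.
rewrite (le_trans (frobD _ _))// lerD2l (le_trans (frobD _ _))//.
(* Going back from [Wbar t] to the sampling point adds C_g rho <= 2 b, whence the 5 of the
   conclusion. *)
have h3 : frob (g k (Wbar t) - g k (sampled_at t k)) <= 2 * b.
  rewrite (le_trans h1)// (le_trans (ler_wpM2l (ltW C_g_gt0) h2))//.
  rewrite -(ler_pM2l alpha_gt0) mulrCA (mulrCA alpha 2) ab.
  rewrite (le_trans (ler_wpM2l (ltW C_g_gt0) ar))//; lra.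
lra.
Qed.

Local Notation L_F := (C_f * L_g + C_g ^+ 2 * L_f).
Local Notation dF := (grad (obj g f)).
Local Notation dFk := (fun k => grad (client_obj g f k)).

Let LF_ge0 : 0 <= L_F.
Proof. exact: (L_F_ge0 K_gt0 m_gt0 n_gt0 d_gt0 C_g C_f_gt0 dg_lip df_lip). Qed.

Let dFk_lip k W1 W2 : frob (dFk k W1 - dFk k W2) <= L_F * frob (W1 - W2).
Proof.
exact: (grad_client_obj_lip K_gt0 d_gt0 g_diff f_diff jac_le grad_le dg_lip df_lip).
Qed.

Lemma Mbar0 : Mbar 0 = avg (sample_grad 0).
Proof.
rewrite /Mbar (_ : M 0%N = fun=> avg (sample_grad 0)) ?(avg_cst K_gt0)//.
by apply/funext => k; rewrite (init_M run).
Qed.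

Lemma MbarS t : Mbar t.+1 = (1 - beta) *: Mbar t + beta *: avg (sample_grad t.+1).
Proof.
have -> : Mbar t.+1 = avg (Mt t.+1).
  rewrite /Mbar; have -> : M t.+1 = if (tau %| t.+1)%N then fun=> avg (Mt t.+1) else Mt t.+1.
    by apply/funext => k; rewrite (sync_M run); case: ifP.
  by case: ifP => // _; rewrite (avg_cst K_gt0).
rewrite /Mbar -!avgZ -avgD; congr avg; apply/funext => k.
by rewrite (step_M run) addrC.
Qed.

Lemma frob_avg_grad_client t :
  frob (avg (fun k => dFk k (sampled_at t k)) - dF (Wbar t)) <= L_F * rho.
Proof.
rewrite (grad_obj g_diff f_diff) -avgB (le_trans (frob_avg _))//.
rewrite -[leRHS](mean_cst K_gt0) ler_mean// => k.
by rewrite (le_trans (dFk_lip _ _ _))// ler_wpM2l// frob_sampled_Wbar.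
Qed.

Lemma avg_sample_grad t : avg (sample_grad t) =
  avg (grad_noise t) + avg (grad_bias t) + avg (fun k => dFk k (sampled_at t k)).
Proof. by rewrite -!avgD; congr avg; apply/funext => k; exact: sample_gradE. Qed.

Definition tracking_error t := Mbar t - dF (Wbar t).

(** Pathwise bound for the part of the tracking error outside [grad_noise_avg]. No smoothness term
    appears at time 0, where all clients sample at [Wbar 0]. *)
Fixpoint drift t : R :=
  if t is t'.+1 then
    (1 - beta) * drift t' +
    (beta * (mean (fun k => frob (grad_bias t k)) + L_F * rho) + L_F * (eta * rn))
  else mean (fun k => frob (grad_noise 0 k)) + mean (fun k => frob (grad_bias 0 k)).

Lemma frob_tracking_error t :
  frob (tracking_error t) <= frob (grad_noise_avg t) + drift t.
Proof.
suff H : frob (tracking_error t - grad_noise_avg t) <= drift t.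
  rewrite -[X in frob X](subrK (grad_noise_avg t)) addrC.
  by rewrite (le_trans (frobD _ _))// lerD2l.
elim: t => [|t IH] /=.
  rewrite subr0 /tracking_error Mbar0 avg_sample_grad /= (grad_obj g_diff f_diff) Wbar0.
  by rewrite addrK (le_trans (frobD _ _))// lerD// ?frob_avg.
rewrite /tracking_error MbarS avg_sample_grad.
set N := avg (grad_noise _); set B := avg (grad_bias _).
set D := avg (fun k => _).
have -> : (1 - beta) *: Mbar t + beta *: (N + B + D) - dF (Wbar t.+1) -
    ((1 - beta) *: grad_noise_avg t + beta *: N) =
  (1 - beta) *: (tracking_error t - grad_noise_avg t) +
  (beta *: (B + (D - dF (Wbar t.+1))) + (1 - beta) *: (dF (Wbar t) - dF (Wbar t.+1))).
  by rewrite /tracking_error; apply/matrixP => i j; rewrite !mxE; ring.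
rewrite (le_trans (frobD _ _))//; apply: lerD.
  by rewrite frobZ gtr0_norm ?subr_gt0// ler_wpM2l// subr_ge0 ltW.
rewrite (le_trans (frobD _ _))//; apply: lerD.
  rewrite frobZ gtr0_norm// ler_wpM2l ?(ltW beta_gt0)// (le_trans (frobD _ _))//.
  by apply: lerD; [exact: frob_avg|exact: frob_avg_grad_client].
rewrite frobZ gtr0_norm ?subr_gt0// -[leRHS]mul1r.
rewrite ler_pM ?frob_ge0 ?subr_ge0 ?(ltW beta_lt1)//.
  by rewrite lerBlDr lerDl ltW.
have := grad_obj_lip K_gt0 d_gt0 g_diff f_diff jac_le grad_le dg_lip df_lip (Wbar t) (Wbar t.+1).
move=> h; rewrite (le_trans h)// ler_wpM2l// frobBC; exact: frob_WbarS.
Qed.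

Definition consensus_error t := mean (fun k => frob (M t k - Mbar t)).

Lemma consensus_error0 : consensus_error 0 = 0.
Proof.
rewrite /consensus_error -[RHS](mean_cst K_gt0); congr mean; apply/funext => k.
rewrite (init_M run) Mbar0 /sample_grad /= [X in frob X](_ : _ = 0) ?frob0//.
by rewrite subrr.
Qed.

Lemma consensus_errorS t : consensus_error t.+1 <=
  if (tau %| t.+1)%N then 0 else (1 - beta) * consensus_error t +
    beta * mean (fun k => frob (sample_grad t.+1 k - avg (sample_grad t.+1))).
Proof.
case: ifPn => dv.
  rewrite /consensus_error -[leRHS](mean_cst K_gt0) ler_mean// => k.
  have E j : M t.+1 j = avg (Mt t.+1) by rewrite (sync_M run) dv.
  rewrite E /Mbar (_ : M t.+1 = fun=> avg (Mt t.+1)); last exact/funext.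
  by rewrite (avg_cst K_gt0) subrr frob0.
rewrite /consensus_error -!meanZ -meanD ler_mean// => k.
rewrite MbarS (sync_M run) (negbTE dv) (step_M run).
rewrite -/(sample_grad t.+1 k).
have -> : beta *: sample_grad t.+1 k + (1 - beta) *: M t k -
   ((1 - beta) *: Mbar t + beta *: avg (sample_grad t.+1)) =
   (1 - beta) *: (M t k - Mbar t) + beta *: (sample_grad t.+1 k - avg (sample_grad t.+1)).
  by apply/matrixP => i j; rewrite !mxE; ring.
by rewrite (le_trans (frobD _ _))// !frobZ gtr0_norm ?subr_gt0// gtr0_norm.
Qed.

(** Noise and bias count twice, once for the client and once for the average. The client gradients
    are moved to the common point [Wbar t], where heterogeneity applies. *)
Lemma sample_grad_dispersion t :
  mean (fun k => frob (sample_grad t k - avg (sample_grad t))) <=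
  2 * mean (fun k => frob (grad_noise t k)) + 2 * mean (fun k => frob (grad_bias t k))
  + (2 * (L_F * rho) + delta).
Proof.
set N := fun k => frob (grad_noise t k); set B := fun k => frob (grad_bias t k).
have het : mean (fun k => frob (dFk k (Wbar t) - dF (Wbar t))) <= delta.
  rewrite -(@ler_pXn2r _ 2)// ?nnegrE//; last first.
    by apply: mean_ge0 => // k; exact: frob_ge0.
  by rewrite (le_trans (sqr_mean_le K_gt0 _))//; exact: heterogeneity.
have h k : frob (sample_grad t k - avg (sample_grad t)) <=
   N k + B k + frob (dFk k (Wbar t) - dF (Wbar t)) + (mean N + mean B + 2 * (L_F * rho)).
  have -> : sample_grad t k - avg (sample_grad t) =
    grad_noise t k + grad_bias t k + (dFk k (Wbar t) - dF (Wbar t)) +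
    ((dFk k (sampled_at t k) - dFk k (Wbar t)) -
     (avg (grad_noise t) + avg (grad_bias t) +
      (avg (fun k => dFk k (sampled_at t k)) - dF (Wbar t)))).
    have regroup (A1 B1 C E D F A2 B2 : 'M[R]_(m, n)) :
      A1 + B1 + C - (A2 + B2 + D) =
      A1 + B1 + (E - F) + ((C - E) - (A2 + B2 + (D - F))).
      by apply/matrixP => i j; rewrite !mxE; ring.
    rewrite avg_sample_grad sample_gradE; exact: regroup.
  rewrite (le_trans (frobD _ _))//; apply: lerD.
    by rewrite (le_trans (frobD _ _))// lerD2r frobD.
  rewrite (le_trans (frobB _ _))//.
  have h1 := le_trans (dFk_lip k (sampled_at t k) (Wbar t))
    (ler_wpM2l LF_ge0 (frob_sampled_Wbar t k)).
  have h2 : frob (avg (grad_noise t) + avg (grad_bias t) +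
      (avg (fun k => dFk k (sampled_at t k)) - dF (Wbar t))) <=
      mean N + mean B + L_F * rho.
    apply: (le_trans (frobD _ _)); apply: lerD (frob_avg_grad_client t).
    apply: (le_trans (frobD _ _)); apply: lerD; exact: frob_avg.
  apply: (le_trans (lerD h1 h2)); rewrite addrC -addrA -mulr2n -[_ *+ 2]mulr_natl.
  exact: lexx.
rewrite (le_trans (ler_mean K_gt0 h))// meanD (mean_cst K_gt0) !meanD; lra.
Qed.

(** With D_k the polar factor and e = M_k - dF(Wbar), replacing the gradient by M_k loses |e| in
    |dF| <= |M_k| + |e| and sqrt n |e| in <e, D_k>; together at most 2 sqrt n |e|, as sqrt n >=
    1. *)
Lemma descent_step t :
  eta * frob (dF (Wbar t)) <= obj g f (Wbar t) - obj g f (Wbar t.+1)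
   + 2 * rn * eta * (frob (tracking_error t) + consensus_error t)
   + L_F / 2 * (eta ^+ 2 * n%:R).
Proof.
have := descent_lemma (Wbar t) (- (eta *: avg (step_dir t))) (obj_diff g_diff f_diff)
  (grad_obj_lip K_gt0 d_gt0 g_diff f_diff jac_le grad_le dg_lip df_lip).
rewrite -WbarS dotNr dotZr frobN frobZ gtr0_norm// (dot_avgr _ (dF (Wbar t))).
have h1 : frob (avg (step_dir t)) ^+ 2 <= n%:R.
  rewrite -(sqr_sqrtr (ler0n R n)) ler_pXn2r ?nnegrE ?frob_ge0 ?sqrtr_ge0//.
  exact: frob_avg_step_dir.
have h2 : frob (dF (Wbar t)) - 2 * rn * (frob (tracking_error t) + consensus_error t)
    <= mean (fun k => dot (dF (Wbar t)) (step_dir t k)).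
  have hk k : frob (dF (Wbar t)) <= dot (dF (Wbar t)) (step_dir t k) +
     (2 * rn * frob (tracking_error t) + 2 * rn * frob (M t k - Mbar t)).
    set e := M t k - dF (Wbar t).
    have e_le : frob e <= frob (tracking_error t) + frob (M t k - Mbar t).
      rewrite (le_trans _ (frobD _ _))// /tracking_error.
      by rewrite addrC addrA subrK.
    have -> : dF (Wbar t) = M t k - e by rewrite /e opprB addrC subrK.
    rewrite dotBl.
    have a1 := dot_step_dir t k.
    have a2 := cauchy_schwarz e (step_dir t k).
    have a3 := ler_wpM2l (frob_ge0 e) (frob_step_dir t k).
    have a4 := frobB (M t k) e.
    have a5 := ler_wpM2r (frob_ge0 e) sqrtn_ge1.
    have a6 := ler_wpM2l (le_trans ler01 sqrtn_ge1) e_le.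
    lra.
  have := ler_mean K_gt0 hk.
  rewrite !meanD !(mean_cst K_gt0) meanZ -/(consensus_error t).
  lra.
have h3 := ler_wpM2l (ltW eta_gt0) h2.
have h4 : L_F / 2 * (eta * frob (avg (step_dir t))) ^+ 2 <= L_F / 2 * (eta ^+ 2 * n%:R).
  by rewrite ler_wpM2l ?divr_ge0// exprMn ler_wpM2l// sqr_ge0.
lra.
Qed.

Lemma descent_sum T Fstar : (forall V, Fstar <= obj g f V) ->
  eta * \sum_(t < T) frob (dF (Wbar t)) <= obj g f W0 - Fstar
   + 2 * rn * eta * \sum_(t < T) (frob (tracking_error t) + consensus_error t)
   + T%:R * (L_F / 2 * (eta ^+ 2 * n%:R)).
Proof.
move=> lb; rewrite (le_trans _ (lerD (lerD (lerB (lexx _) (lb (Wbar T))) (lexx _)) (lexx _)))//.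
elim: T => [|T IH].
  by rewrite !big_ord0 Wbar0 subrr !mulr0 mul0r !addr0.
rewrite !big_ord_recr /= -[T.+1%:R]natr1; have := descent_step T; lra.
Qed.

End trajectory.

(** * Expectations along the trajectory *)

Section fedcomuon.
Context (R : realType) (K m n d : nat).
Hypotheses (K_gt0 : (0 < K)%N) (m_gt0 : (0 < m)%N) (n_gt0 : (0 < n)%N)
  (d_gt0 : (0 < d)%N).
Context (dX dZ : measure_display).
Context (X : 'I_K -> measurableType dX) (Z : 'I_K -> measurableType dZ).
Variables (Dg : forall k, probability (X k) R) (Df : forall k, probability (Z k) R).
Variables (gs : forall k, 'M[R]_(m, n) -> X k -> 'cV[R]_d)
  (fs : forall k, 'cV[R]_d -> Z k -> R).
Arguments gs : clear implicits.
Arguments fs : clear implicits.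
Variables (g : 'I_K -> 'M[R]_(m, n) -> 'cV[R]_d) (f : 'I_K -> 'cV[R]_d -> R).
Hypothesis gs_diff : forall k x (W : 'M[R]_(m, n)),
  differentiable (fun V : 'M[R]_(m, n) => gs k V x) W.
Hypothesis fs_diff : forall k z (y : 'cV[R]_d),
  differentiable (fun y' : 'cV[R]_d => fs k y' z) y.
Arguments gs_diff : clear implicits.
Arguments fs_diff : clear implicits.
Hypothesis g_diff : forall k (W : 'M[R]_(m, n)), differentiable (g k) W.
Hypothesis f_diff : forall k (y : 'cV[R]_d), differentiable (f k) y.
Hypothesis g_mean : forall k W, has_mean (Dg k) (gs k W) (g k W).
Hypothesis f_integrable : forall k y, (Df k).-integrable setT (EFin \o fs k y).
Variables (sigma_g sigma_dg sigma_f : R).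
Hypotheses (sigma_g_gt0 : 0 < sigma_g) (sigma_dg_gt0 : 0 < sigma_dg)
  (sigma_f_gt0 : 0 < sigma_f).
Hypothesis dg_mean : forall k W,
  has_mean (Dg k) (fun x => jac (fun V => gs k V x) W) (jac (g k) W).
Hypothesis df_mean : forall k y,
  has_mean (Df k) (fun z => grad (fun y' => fs k y' z) y) (grad (f k) y).
Hypothesis g_var : forall k W,
  ('E_(Dg k)[fun x => (frob (gs k W x - g k W) ^+ 2)%R] <= (sigma_g ^+ 2)%:E)%E.
Hypothesis dg_var : forall k W,
  ('E_(Dg k)[fun x =>
      (frob (jac (fun V => gs k V x) W - jac (g k) W) ^+ 2)%R]
   <= (sigma_dg ^+ 2)%:E)%E.
Hypothesis df_var : forall k y,
  ('E_(Df k)[fun z =>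
      (frob (grad (fun y' => fs k y' z) y - grad (f k) y) ^+ 2)%R]
   <= (sigma_f ^+ 2)%:E)%E.
Variables (C_g C_f : R).
Hypotheses (C_g_gt0 : 0 < C_g) (C_f_gt0 : 0 < C_f).
Hypothesis dg_moment : forall k W,
  ('E_(Dg k)[fun x => (frob (jac (fun V => gs k V x) W) ^+ 2)%R]
   <= (C_g ^+ 2)%:E)%E.
Hypothesis df_moment : forall k y,
  ('E_(Df k)[fun z => (frob (grad (fun y' => fs k y' z) y) ^+ 2)%R]
   <= (C_f ^+ 2)%:E)%E.
Variables (L_g L_f : R).
Hypothesis dg_lip : forall k W1 W2,
  frob (jac (g k) W1 - jac (g k) W2) <= L_g * frob (W1 - W2).
Hypothesis df_lip : forall k y1 y2,
  frob (grad (f k) y1 - grad (f k) y2) <= L_f * frob (y1 - y2).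
Variable delta : R.
Hypothesis delta_ge0 : 0 <= delta.
Hypothesis heterogeneity : forall W,
  K%:R^-1 * \sum_k frob (grad (client_obj g f k) W - grad (obj g f) W) ^+ 2
    <= delta ^+ 2.
Context (dO : measure_display) (O : measurableType dO) (P : probability O R).
Variables (xi : forall (t : nat) (k : 'I_K), {RV P >-> X k})
  (zeta : forall (t : nat) (k : 'I_K), {RV P >-> Z k}).
Hypothesis xi_distr : forall t k A, measurable A ->
  distribution P (xi t k) A = Dg k A.
Hypothesis zeta_distr : forall t k A, measurable A ->
  distribution P (zeta t k) A = Df k A.
Hypothesis samples_indep : mutually_independent P (sample_events xi zeta).
Variables (eta alpha beta : R) (tau : nat) (W0 : 'M[R]_(m, n)).
Hypotheses (eta_gt0 : 0 < eta) (alpha_gt0 : 0 < alpha) (alpha_lt1 : alpha < 1)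
  (beta_gt0 : 0 < beta) (beta_lt1 : beta < 1) (tau_gt0 : (0 < tau)%N)
  (alpha_tau : alpha * tau%:R <= 1).
Variables (W Wt : nat -> 'I_K -> O -> 'M[R]_(m, n)) (u : nat -> 'I_K -> O -> 'cV[R]_d)
  (M Mt : nat -> 'I_K -> O -> 'M[R]_(m, n)).
Hypothesis run : forall w, FedCoMuon gs fs eta alpha beta tau W0
  (fun t k => xi t k w) (fun t k => zeta t k w)
  (fun t k => W t k w) (fun t k => Wt t k w) (fun t k => u t k w)
  (fun t k => M t k w) (fun t k => Mt t k w).

Lemma jac_le k V : frob (jac (g k) V) <= C_g.
Proof. exact: (frob_mean_le (ltW C_g_gt0) (dg_mean k V) (dg_moment k V)). Qed.

Lemma grad_le k y : frob (grad (f k) y) <= C_f.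
Proof. exact: (frob_mean_le (ltW C_f_gt0) (df_mean k y) (df_moment k y)). Qed.

Local Notation event := (sample_events xi zeta).
Local Notation index := ((nat * 'I_K) + (nat * 'I_K))%type.

Lemma sample_events_measurable i : event i `<=` measurable.
Proof.
by case: i => -[t k] A [B mB <-]; rewrite setTI -[X in measurable X]setTI;
  exact: measurable_funP.
Qed.

Lemma sample_events_setI i : setI_closed (event i).
Proof.
by case: i => -[t k] A A' [B mB <-] [B' mB' <-]; exists (B `&` B') => //;
  rewrite ?setTI//; exact: measurableI.
Qed.

Lemma sample_events_setT i : event i setT.
Proof. by case: i => -[t k]; exists setT => //; rewrite setTI. Qed.

Let Em := sample_events_measurable.
Let EI := sample_events_setI.
Let ET := sample_events_setT.

Definition sample_time (i : index) : nat :=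
  match i with inl p => p.1 | inr p => p.1 end.

Definition past t : set index := [set i | (sample_time i < t)%N].
(** The samples that the other clients draw at time t are kept, which makes the noises of different
    clients orthogonal to each other. *)
Definition before_outer t k : set index := past t.+1 `\ inr (t, k).
Definition before_inner t k : set index := before_outer t k `\ inl (t, k).

Lemma past_before_inner t k : past t `<=` before_inner t k.
Proof.
move=> i it; split; first split; first exact: ltnW it.
  by move=> E; move: it; rewrite E /past /= ltnn.
by move=> E; move: it; rewrite E /past /= ltnn.
Qed.

Lemma before_inner_outer t k : before_inner t k `<=` before_outer t k.
Proof. by move=> i []. Qed.

Lemma past_leq s t : (s <= t)%N -> past s `<=` past t.
Proof. by move=> st i /= is_; exact: leq_trans st. Qed.

Local Notation Sig S := (g_sigma_algebraType (cylinders event S)).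
Local Notation adapted S A := (@measurable_mx R _ (Sig S) _ _ A).

Definition sampled t k w : 'M[R]_(m, n) :=
  sampled_at W0 (fun t k => Wt t k w) t k.

Lemma measurable_xi (S : set index) t k : S (inl (t, k)) ->
  measurable_fun (setT : set (Sig S)) (xi t k : O -> X k).
Proof. by move=> Si; apply: (measurable_sample (i := inl (t, k))). Qed.

Lemma measurable_zeta (S : set index) t k : S (inr (t, k)) ->
  measurable_fun (setT : set (Sig S)) (zeta t k : O -> Z k).
Proof. by move=> Si; apply: (measurable_sample (i := inr (t, k))). Qed.

Definition sgrad_at t k w : 'M[R]_(m, n) :=
  sample_grad gs fs W0 (fun t k => xi t k w) (fun t k => zeta t k w)
    (fun t k => Wt t k w) (fun t k => u t k w) t k.

Definition sjac_at t k w : 'M[R]_(m, d * n) :=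
  sample_jac gs W0 (fun t k => xi t k w) (fun t k => Wt t k w) t k.

Section adapted_samples.
Variables (S : set index) (t : nat) (k : 'I_K).
Hypothesis aW : adapted S (sampled t k).
Hypothesis Sx : S (inl (t, k)).

Lemma adapted_gs : adapted S (fun w => gs k (sampled t k w) (xi t k w)).
Proof.
exact: (measurable_mx_eval (D := Dg k) (gs_diff k) (g_mean k) aW (measurable_xi Sx)).
Qed.

Lemma adapted_sjac : adapted S (sjac_at t k).
Proof.
exact: (measurable_mx_jac (D := Dg k) (gs_diff k) (g_mean k) aW (measurable_xi Sx)).
Qed.

Lemma adapted_sgrad : adapted S (u t k) -> S (inr (t, k)) -> adapted S (sgrad_at t k).
Proof.
move=> au Sz; apply: measurable_mulmx_kron_id; first exact: adapted_sjac.
exact: (measurable_mx_grad (D := Df k) (fs_diff k) (f_integrable k) au (measurable_zeta Sz)).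
Qed.

End adapted_samples.

(** The decompositions may be chosen in a non-measurable way from one outcome to the next; only the
    limit of [newton_schulz] enters. *)
Lemma adapted_WtS (S : set index) t k :
  adapted S (M t k) -> adapted S (W t k) -> adapted S (Wt t.+1 k).
Proof.
move=> aM aW.
have aD : adapted S (fun w => step_dir eta (fun t k => W t k w) (fun t k => Wt t k w) t k).
  move=> i j; apply: (@measurable_fun_cvg _ (Sig S) _ setT
    (fun p w => newton_schulz p (M t k w) i j)).
    by move=> p; exact: (measurable_newton_schulz p aM).
  move=> w _; have [r [U [s [V [svd ->]]]]] := step_dirP eta_gt0 (run w) t k.
  exact: newton_schulz_cvg svd.
have -> : Wt t.+1 k = fun w => W t k w -
    eta *: step_dir eta (fun t k => W t k w) (fun t k => Wt t k w) t k.
  apply/funext => w.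
  exact: (step_dirE eta_gt0 (fun t k => W t k w) (fun t k => Wt t k w) t k).
apply: measurable_mxB => //; apply: measurable_mxZ => //; exact: measurable_cst.
Qed.

Lemma adapted_sampled0 S k : adapted S (sampled 0 k).
Proof. exact: measurable_mx_cst. Qed.

Lemma adapted_state t : [/\ forall k, adapted (past t.+1) (u t k),
  forall k, adapted (past t.+1) (M t k) & forall k, adapted (past t.+1) (W t k)].
Proof.
elim: t => [|t [IHu IHM IHW]].
  have au k : adapted (past 1) (u 0 k).
    rewrite (_ : u 0%N k = fun w => gs k (sampled 0 k w) (xi 0%N k w)).
      by apply: adapted_gs => //; exact: adapted_sampled0.
    by apply/funext => w; rewrite (init_u (run w)).
  split=> // k.
    rewrite (_ : M 0%N k = fun w => avg (fun j => sgrad_at 0 j w)).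
      apply: measurable_mx_avg => j; apply: adapted_sgrad => //.
    by apply/funext => w; rewrite (init_M (run w)).
  rewrite (_ : W 0%N k = fun w => W0); first exact: measurable_mx_cst.
  by apply/funext => w; rewrite (init_W (run w)).
have sub : past t.+1 `<=` past t.+2 by exact: past_leq.
have aWt k : adapted (past t.+2) (Wt t.+1 k).
  by apply: (adapted_sub sub); exact: adapted_WtS.
have aS k : adapted (past t.+2) (sampled t.+1 k) by exact: aWt.
have Sx k : past t.+2 (inl (t.+1, k)) by exact: ltnSn.
have Sz k : past t.+2 (inr (t.+1, k)) by exact: ltnSn.
have au k : adapted (past t.+2) (u t.+1 k).
  rewrite (_ : u t.+1 k = fun w => alpha *: gs k (sampled t.+1 k w) (xi t.+1 k w) +
      (1 - alpha) *: u t k w).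
    apply: measurable_mxD; (apply: measurable_mxZ; first exact: measurable_cst).
      exact: (adapted_gs (aS k) (Sx k)).
    by apply: (adapted_sub sub); exact: IHu.
  by apply/funext => w; rewrite (step_u (run w)).
have aMt k : adapted (past t.+2) (Mt t.+1 k).
  rewrite (_ : Mt t.+1 k = fun w => beta *: sgrad_at t.+1 k w + (1 - beta) *: M t k w).
    apply: measurable_mxD; (apply: measurable_mxZ; first exact: measurable_cst).
      exact: (adapted_sgrad (aS k) (Sx k) (au k) (Sz k)).
    by apply: (adapted_sub sub); exact: IHM.
  by apply/funext => w; rewrite (step_M (run w)).
split=> // k.
  have -> : M t.+1 k = if (tau %| t.+1)%N then fun w => avg (fun j => Mt t.+1 j w)
      else Mt t.+1 k.
    by apply/funext => w; rewrite (sync_M (run w)); case: ifP.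
  by case: ifP => // _; exact: measurable_mx_avg.
have -> : W t.+1 k = if (tau %| t.+1)%N then fun w => avg (fun j => Wt t.+1 j w)
    else Wt t.+1 k.
  by apply/funext => w; rewrite (sync_W (run w)); case: ifP.
by case: ifP => // _; exact: measurable_mx_avg.
Qed.

Lemma adapted_sampled t k : adapted (past t) (sampled t k).
Proof.
case: t => [|t]; first exact: adapted_sampled0.
by have [_ aM aW] := adapted_state t; exact: adapted_WtS.
Qed.

(** Stated for a general S because [u t k] must be known in [before_outer t k], which contains
    [xi t k] but not [zeta t k]. *)
Lemma adapted_u S t k : past t `<=` S -> S (inl (t, k)) -> adapted S (u t k).
Proof.
move=> sub Sx.
have as_ : adapted S (sampled t k) by apply: (adapted_sub sub); exact: adapted_sampled.
case: t => [|t] in Sx sub as_ *.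
  rewrite (_ : u 0%N k = fun w => gs k (sampled 0 k w) (xi 0%N k w)).
    exact: adapted_gs.
  by apply/funext => w; rewrite (init_u (run w)).
rewrite (_ : u t.+1 k = fun w => alpha *: gs k (sampled t.+1 k w) (xi t.+1 k w) +
    (1 - alpha) *: u t k w).
  apply: measurable_mxD; (apply: measurable_mxZ; first exact: measurable_cst).
    by apply: adapted_gs.
  by apply: (adapted_sub sub); have [] := adapted_state t.
by apply/funext => w; rewrite (step_u (run w)).
Qed.

(** * Second moments of the noises *)

Definition inner_noise_at t k w : 'cV[R]_d :=
  inner_noise g gs W0 (fun t k => xi t k w) (fun t k => Wt t k w) t k.

Definition jac_noise_at t k w : 'M[R]_(m, n) :=
  jac_noise g f gs W0 (fun t k => xi t k w) (fun t k => Wt t k w) t k.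

Definition grad_noise_at t k w : 'M[R]_(m, n) :=
  grad_noise g f gs fs W0 (fun t k => xi t k w) (fun t k => zeta t k w)
    (fun t k => Wt t k w) (fun t k => u t k w) t k.

Lemma adapted_inner_noise S t k : past t `<=` S -> S (inl (t, k)) ->
  adapted S (inner_noise_at t k).
Proof.
move=> sub Sx.
have as_ : adapted S (sampled t k) by apply: (adapted_sub sub); exact: adapted_sampled.
apply: measurable_mxB; first exact: adapted_gs.
exact: (measurable_mx_comp_diff (g_diff k) as_).
Qed.

Lemma adapted_jac_noise S t k : past t `<=` S -> S (inl (t, k)) ->
  adapted S (jac_noise_at t k).
Proof.
move=> sub Sx.
have as_ : adapted S (sampled t k) by apply: (adapted_sub sub); exact: adapted_sampled.
apply: measurable_mulmx_kron_id.
  apply: measurable_mxB; first exact: adapted_sjac.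
  exact: (measurable_mx_comp_jac (g_diff k) as_).
apply: (measurable_mx_comp_grad (f_diff k)).
exact: (measurable_mx_comp_diff (g_diff k) as_).
Qed.

Lemma adapted_grad_noise S t k : past t `<=` S -> S (inl (t, k)) -> S (inr (t, k)) ->
  adapted S (grad_noise_at t k).
Proof.
move=> sub Sx Sz; apply: measurable_mxD; first exact: adapted_jac_noise.
have as_ : adapted S (sampled t k) by apply: (adapted_sub sub); exact: adapted_sampled.
have au := adapted_u sub Sx.
apply: measurable_mulmx_kron_id; first exact: adapted_sjac.
apply: measurable_mxB.
  exact: (measurable_mx_grad (D := Df k) (fs_diff k) (f_integrable k) au (measurable_zeta Sz)).
exact: (measurable_mx_comp_grad (f_diff k) au).
Qed.

Lemma adapted_fst dY (Y : measurableType dY) S p q (A : O -> 'M[R]_(p, q)) :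
  adapted S A -> measurable_mx (fun y : Sig S * Y => A y.1).
Proof.
move=> aA i j; apply: (measurableT_comp (aA i j)); exact: measurable_fst.
Qed.

Local Notation S2 := (C_g ^+ 2 * sigma_f ^+ 2 + C_f ^+ 2 * sigma_dg ^+ 2).

Section one_client.
Variables (t : nat) (k : 'I_K).

Let S := before_inner t k.
Let S' := before_outer t k.

Let aS : adapted S (sampled t k).
Proof. by apply: (adapted_sub (@past_before_inner t k)); exact: adapted_sampled. Qed.

Let Sx : ~ S (inl (t, k)).
Proof. by move=> [_ h]; exact: h. Qed.

Let Sz : ~ S' (inr (t, k)).
Proof. by move=> [_ h]; exact: h. Qed.

Let S'x : S' (inl (t, k)).
Proof. by split => //=; exact: ltnSn. Qed.

Let pS' : past t `<=` S'.
Proof. by apply: subset_trans (@before_inner_outer t k); exact: past_before_inner. Qed.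

Let aS' : adapted S' (sampled t k).
Proof. by apply: (adapted_sub pS'); exact: adapted_sampled. Qed.

Let sampled_fst : measurable_mx (fun p : Sig S * X k => sampled t k p.1).
Proof. exact: adapted_fst. Qed.

Lemma sjac_moment : mean_le P (fun w => frob (sjac_at t k w) ^+ 2) (C_g ^+ 2).
Proof.
have := conditional_bound Em EI ET samples_indep (i := inl (t, k)) (X := xi t k)
  (D := Dg k) erefl (xi_distr t (k := k)) Sx (h := fun p => jac (fun V => gs k V p.2) (sampled t k p.1))
  (b := fun=> C_g ^+ 2) (c := C_g ^+ 2).
apply.
- exact: (measurable_mx_jac (D := Dg k) (gs_diff k) (g_mean k) sampled_fst measurable_snd).
- move=> w; exact: (dg_moment k (sampled t k w)).
- by apply: mean_le_cst_ge0; exact: sqr_ge0.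
Qed.

Lemma inner_noise_step (A : O -> 'cV[R]_d) a c : adapted S A ->
  mean_le P (fun w => frob (A w) ^+ 2) a ->
  mean_le P (fun w => frob (A w + c *: inner_noise_at t k w) ^+ 2)
    (a + c ^+ 2 * sigma_g ^+ 2).
Proof.
move=> aA Aa.
have := conditional_step Em EI ET samples_indep (i := inl (t, k)) (X := xi t k)
  (D := Dg k) erefl (xi_distr t (k := k)) Sx
  (h := fun p => c *: (gs k (sampled t k p.1) p.2 - g k (sampled t k p.1)))
  (b := fun=> c ^+ 2 * sigma_g ^+ 2) (c := c ^+ 2 * sigma_g ^+ 2) _ _ _ aA _ Aa.
apply.
- apply: measurable_mxZ; first exact: measurable_cst.
  apply: measurable_mxB; last exact: (measurable_mx_comp_diff (g_diff k) sampled_fst).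
  exact: (measurable_mx_eval (D := Dg k) (gs_diff k) (g_mean k) sampled_fst measurable_snd).
- move=> w; have hm := has_mean_center (g_mean k (sampled t k w)).
  rewrite -[c ^+ 2]real_normK ?num_real//.
  apply: (expectation_sqr_frob_le hm (has_meanZ c hm)) => //.
  by move=> x; rewrite frobZ.
- by apply: mean_le_cst_ge0; rewrite -exprMn sqr_ge0.
- move=> w; rewrite -[0](scaler0 _ c).
  by apply: has_meanZ (has_mean_center (g_mean k (sampled t k w))).
Qed.

Let jac_noise_step (A : O -> 'M[R]_(m, n)) a c : adapted S A ->
  mean_le P (fun w => frob (A w) ^+ 2) a ->
  mean_le P (fun w => frob (A w + c *: jac_noise_at t k w) ^+ 2)
    (a + c ^+ 2 * (C_f ^+ 2 * sigma_dg ^+ 2)).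
Proof.
move=> aA Aa.
pose v w := grad (f k) (g k (sampled t k w)).
have := conditional_step Em EI ET samples_indep (i := inl (t, k)) (X := xi t k)
  (D := Dg k) erefl (xi_distr t (k := k)) Sx
  (h := fun p => c *: ((jac (fun V => gs k V p.2) (sampled t k p.1)
     - jac (g k) (sampled t k p.1)) *m kron_id n (v p.1)))
  (b := fun=> c ^+ 2 * (C_f ^+ 2 * sigma_dg ^+ 2))
  (c := c ^+ 2 * (C_f ^+ 2 * sigma_dg ^+ 2)) _ _ _ aA _ Aa.
have zero w : has_mean (Dg k) (fun x => (jac (fun V => gs k V x) (sampled t k w)
     - jac (g k) (sampled t k w)) *m kron_id n (v w)) 0.
  rewrite -(mul0mx _ (kron_id n (v w))); apply: has_mean_kronl.
  by apply: has_mean_center; exact: dg_mean.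
apply.
- apply: measurable_mxZ; first exact: measurable_cst.
  apply: measurable_mulmx_kron_id.
    apply: measurable_mxB; last exact: (measurable_mx_comp_jac (g_diff k) sampled_fst).
    exact: (measurable_mx_jac (D := Dg k) (gs_diff k) (g_mean k) sampled_fst measurable_snd).
  apply: (measurable_mx_comp_grad (f_diff k)).
  exact: (measurable_mx_comp_diff (g_diff k) sampled_fst).
- move=> w; have hm := has_mean_center (dg_mean k (sampled t k w)).
  rewrite mulrA -exprMn -[_ ^+ 2 in X in (_ <= X)%E]real_normK ?num_real// normrM.
  rewrite (gtr0_norm C_f_gt0).
  apply: (expectation_sqr_frob_le hm (has_meanZ c (zero w))); last exact: dg_var.
    by rewrite mulr_ge0// ltW.
  move=> x; rewrite frobZ -mulrA ler_wpM2l//.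
  by rewrite (le_trans (frob_mulmx_kron_id _ _))// mulrC ler_wpM2r ?frob_ge0// grad_le.
- by apply: mean_le_cst_ge0; rewrite -!exprMn sqr_ge0.
- move=> w; rewrite -[0](scaler0 _ c); exact: (has_meanZ c (zero w)).
Qed.

(** Two successive orthogonal increments: the Jacobian noise, then, with the Jacobian J known, the
    outer noise. The latter has second moment at most sigma_f^2 |J|^2 given J, and E |J|^2 <=
    C_g^2. *)
Lemma grad_noise_step (A : O -> 'M[R]_(m, n)) a c : adapted S A ->
  mean_le P (fun w => frob (A w) ^+ 2) a ->
  mean_le P (fun w => frob (A w + c *: grad_noise_at t k w) ^+ 2) (a + c ^+ 2 * S2).
Proof.
move=> aA Aa.
pose J w := sjac_at t k w.
have aJ : adapted S' J by exact: adapted_sjac.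
have au : adapted S' (u t k) by exact: adapted_u.
pose A1 w := A w + c *: jac_noise_at t k w.
have aA1 : adapted S' A1.
  apply: measurable_mxD; first exact: (adapted_sub (@before_inner_outer t k) aA).
  by apply: measurable_mxZ; [exact: measurable_cst|exact: adapted_jac_noise].
have := conditional_step Em EI ET samples_indep (i := inr (t, k)) (X := zeta t k)
  (D := Df k) erefl (zeta_distr t (k := k)) Sz
  (h := fun p => c *: (J p.1 *m kron_id n
    (grad (fun y => fs k y p.2) (u t k p.1) - grad (f k) (u t k p.1))))
  (b := fun w => (c ^+ 2 * sigma_f ^+ 2) * frob (J w) ^+ 2)
  (c := (c ^+ 2 * sigma_f ^+ 2) * C_g ^+ 2) _ _ _ aA1 _ (jac_noise_step c aA Aa).
have E : a + c ^+ 2 * (C_f ^+ 2 * sigma_dg ^+ 2) + c ^+ 2 * sigma_f ^+ 2 * C_g ^+ 2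
  = a + c ^+ 2 * S2 by ring.
have zero w : has_mean (Df k) (fun z => J w *m kron_id n
    (grad (fun y => fs k y z) (u t k w) - grad (f k) (u t k w))) 0.
  rewrite -(mulmx_kron_id0 (J w)); apply: has_mean_kronr.
  by apply: has_mean_center; exact: df_mean.
rewrite E; have -> : (fun w => frob (A w + c *: grad_noise_at t k w) ^+ 2) =
    (fun w => frob (A1 w + c *: (J w *m kron_id n
      (grad (fun y => fs k y (zeta t k w)) (u t k w) - grad (f k) (u t k w)))) ^+ 2).
  apply/funext => w; congr (frob _ ^+ 2).
  by rewrite /A1 -[RHS]addrA -scalerDr.
apply.
- apply: measurable_mxZ; first exact: measurable_cst.
  apply: measurable_mulmx_kron_id; first exact: adapted_fst.
  apply: measurable_mxB; last exact: (measurable_mx_comp_grad (f_diff k) (adapted_fst au)).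
  exact: (measurable_mx_grad (D := Df k) (fs_diff k) (f_integrable k) (adapted_fst au) measurable_snd).
- move=> w; have hm := has_mean_center (df_mean k (u t k w)).
  rewrite mulrAC -exprMn -[_ ^+ 2 in X in (_ <= X)%E]real_normK ?num_real// normrM.
  rewrite (ger0_norm (frob_ge0 _)).
  apply: (expectation_sqr_frob_le hm (has_meanZ c (zero w))); last exact: df_var.
    by rewrite mulr_ge0// frob_ge0.
  by move=> z; rewrite frobZ -mulrA ler_wpM2l// frob_mulmx_kron_id.
- have := mean_leZ (c ^+ 2 * sigma_f ^+ 2) sjac_moment.
  by rewrite ger0_norm// -exprMn sqr_ge0.
- move=> w; rewrite -[0](scaler0 _ c); exact: (has_meanZ c (zero w)).
Qed.

End one_client.

Lemma past_inner t k : past t.+1 (inl (t, k)).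
Proof. exact: ltnSn. Qed.

Lemma past_outer t k : past t.+1 (inr (t, k)).
Proof. exact: ltnSn. Qed.

Lemma past_sub t : past t `<=` past t.+1.
Proof. exact: past_leq. Qed.

Definition inner_noise_avg_at t k w : 'cV[R]_d :=
  inner_noise_avg g gs alpha W0 (fun t k => xi t k w) (fun t k => Wt t k w) t k.

Lemma adapted_inner_noise_avg t k : adapted (past t.+1) (inner_noise_avg_at t k).
Proof.
elim: t => [|t IH].
  exact: (adapted_inner_noise (@past_sub _) (past_inner _ _)).
apply: measurable_mxD; (apply: measurable_mxZ; first exact: measurable_cst).
  exact: (adapted_sub (@past_sub t.+1)).
exact: (adapted_inner_noise (@past_sub _) (past_inner _ _)).
Qed.

Lemma inner_noise_moment t k :
  mean_le P (fun w => frob (inner_noise_at t k w) ^+ 2) (sigma_g ^+ 2).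
Proof.
have h0 : mean_le P (fun=> frob (0 : 'cV[R]_d) ^+ 2) 0.
  rewrite frob0 expr2 mul0r; exact: (mean_le_cst_ge0 P (lexx 0)).
have := @inner_noise_step t k (fun=> 0) 0 1 (measurable_mx_cst _) h0.
rewrite add0r expr1n mul1r; congr mean_le; apply/funext => w.
by rewrite add0r scale1r.
Qed.

(** The recursion v |-> (1 - alpha)^2 v + alpha^2 sigma_g^2 keeps a stationary part below alpha
    sigma_g^2 and forgets the initial sample at least as fast as (1 - alpha)^t. *)
Lemma inner_noise_avg_moment t k :
  mean_le P (fun w => frob (inner_noise_avg_at t k w) ^+ 2)
    (((1 - alpha) ^+ t + alpha) * sigma_g ^+ 2).
Proof.
have s0 := sqr_ge0 sigma_g.
elim: t => [|t IH].
  apply: mean_le_weaken (inner_noise_moment 0 k); rewrite expr0 mulrDl mul1r lerDl.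
  by rewrite mulr_ge0// ltW.
have aA : adapted (before_inner t.+1 k) (fun w => (1 - alpha) *: inner_noise_avg_at t k w).
  apply: measurable_mxZ; first exact: measurable_cst.
  apply: (adapted_sub (@past_before_inner t.+1 k)).
  exact: adapted_inner_noise_avg.
have := inner_noise_step alpha aA (mean_le_sqr_frobZ (1 - alpha) IH).
apply: mean_le_weaken; rewrite mulrA -mulrDl ler_wpM2r// [(1 - alpha) ^+ t.+1]exprS.
have h0 : 0 <= (1 - alpha) ^+ t by rewrite exprn_ge0// subr_ge0 ltW.
have h1 : 0 <= alpha * (1 - alpha) by rewrite mulr_ge0 ?subr_ge0// ltW.
have := mulr_ge0 h0 h1; have := mulr_ge0 (ltW alpha_gt0) h1; nra.
Qed.

Lemma grad_noise_moment t k :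
  mean_le P (fun w => frob (grad_noise_at t k w) ^+ 2) S2.
Proof.
have h0 : mean_le P (fun=> frob (0 : 'M[R]_(m, n)) ^+ 2) 0.
  rewrite frob0 expr2 mul0r; exact: (mean_le_cst_ge0 P (lexx 0)).
have := @grad_noise_step t k (fun=> 0) 0 1 (measurable_mx_cst _) h0.
rewrite add0r expr1n mul1r; congr mean_le; apply/funext => w.
by rewrite add0r scale1r.
Qed.

(** Clients are added one at a time: when k is added, the partial sum involves neither of its
    samples of time t. *)
Lemma grad_noise_sum_moment t (s : seq 'I_K) (A : O -> 'M[R]_(m, n)) a c :
  uniq s -> adapted (past t) A -> mean_le P (fun w => frob (A w) ^+ 2) a ->
  mean_le P (fun w => frob (A w + \sum_(k <- s) c *: grad_noise_at t k w) ^+ 2)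
    (a + (size s)%:R * (c ^+ 2 * S2)).
Proof.
move=> us aA Aa; elim: s us => [_|k s IH /= /andP[ks us]].
  rewrite mul0r addr0; move: Aa; congr mean_le; apply/funext => w.
  by rewrite big_nil addr0.
have aB : adapted (before_inner t k)
    (fun w => A w + \sum_(j <- s) c *: grad_noise_at t j w).
  apply: measurable_mxD; first exact: (adapted_sub (@past_before_inner t k) aA).
  elim: s ks {IH us} => [_|j s IHs].
    by under eq_fun do rewrite big_nil; exact: measurable_mx_cst.
  rewrite inE negb_or => /andP[kj ks]; under eq_fun do rewrite big_cons.
  apply: measurable_mxD; last exact: IHs.
  apply: measurable_mxZ; first exact: measurable_cst.
  apply: adapted_grad_noise; first exact: past_before_inner.
    split; first by split => //; exact: past_inner.
    by case=> jk; rewrite jk eqxx in kj.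
  by split => //; split; [exact: past_outer|case=> jk; rewrite jk eqxx in kj].
have := grad_noise_step c aB (IH us).
have -> : a + (size s)%:R * (c ^+ 2 * S2) + c ^+ 2 * S2 =
  a + (size s).+1%:R * (c ^+ 2 * S2) by rewrite -[(size s).+1%:R]natr1; ring.
congr mean_le; apply/funext => w.
by rewrite big_cons -addrA [X in A w + X]addrC.
Qed.

Definition grad_noise_avg_at t w : 'M[R]_(m, n) :=
  grad_noise_avg g f gs fs beta W0 (fun t k => xi t k w) (fun t k => zeta t k w)
    (fun t k => Wt t k w) (fun t k => u t k w) t.

Lemma adapted_grad_noise_avg t : adapted (past t.+1) (grad_noise_avg_at t).
Proof.
elim: t => [|t IH]; first exact: measurable_mx_cst.
apply: measurable_mxD; (apply: measurable_mxZ; first exact: measurable_cst).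
  exact: (adapted_sub (@past_sub t.+1)).
apply: measurable_mx_avg => k; apply: adapted_grad_noise; first exact: past_sub.
  exact: past_inner.
exact: past_outer.
Qed.

(** K orthogonal noises of weight beta / K contribute beta^2 S2 / K, and (1 - beta)^2 beta + beta^2
    <= beta closes the induction. *)
Lemma grad_noise_avg_moment t :
  mean_le P (fun w => frob (grad_noise_avg_at t w) ^+ 2) (beta * (S2 / K%:R)).
Proof.
have S0 : 0 <= S2 / K%:R by rewrite divr_ge0 ?ler0n// -!exprMn addr_ge0 ?sqr_ge0.
elim: t => [|t IH].
  rewrite (_ : (fun w => _) = fun=> 0); last first.
    by apply/funext => w; rewrite /grad_noise_avg_at /= frob0 expr0n.
  apply: mean_le_weaken (mean_le_cst_ge0 P (lexx 0)).
  by rewrite mulr_ge0// ltW.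
have aA : adapted (past t.+1) (fun w => (1 - beta) *: grad_noise_avg_at t w).
  by apply: measurable_mxZ; [exact: measurable_cst|exact: adapted_grad_noise_avg].
have := grad_noise_sum_moment (beta / K%:R) (index_enum_uniq 'I_K) aA
  (mean_le_sqr_frobZ (1 - beta) IH).
rewrite (_ : (fun w => _) = (fun w => frob (grad_noise_avg_at t.+1 w) ^+ 2)); last first.
  apply/funext => w; congr (frob (_ + _) ^+ 2).
  by rewrite /avg scalerA -scaler_sumr.
apply: mean_le_weaken.
rewrite -[index_enum _]enumT size_enum_ord.
have K0 : K%:R != 0 :> R by rewrite pnatr_eq0 -lt0n.
have -> : (1 - beta) ^+ 2 * (beta * (S2 / K%:R)) +
   K%:R * ((beta / K%:R) ^+ 2 * S2) =
   ((1 - beta) ^+ 2 * beta + beta ^+ 2) * (S2 / K%:R) by field.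
rewrite ler_wpM2r//.
have h1 : 0 <= beta * (1 - beta) by rewrite mulr_ge0 ?subr_ge0// ltW.
have := mulr_ge0 (ltW beta_gt0) h1; nra.
Qed.

(** * First moments of bias, drift and consensus error *)

Local Notation rn := (Num.sqrt n%:R : R).
Local Notation L_F := (C_f * L_g + C_g ^+ 2 * L_f).
Local Notation rho := (2 * eta * rn * tau%:R).
Local Notation S1 := (C_g * sigma_f + C_f * sigma_dg).

Let Lf_ge0 : 0 <= L_f.
Proof. exact: (L_f_ge0 K_gt0 d_gt0 df_lip). Qed.

Let LF_ge0 : 0 <= L_F.
Proof. exact: (L_F_ge0 K_gt0 m_gt0 n_gt0 d_gt0 C_g C_f_gt0 dg_lip df_lip). Qed.

(** From (y + 5 b)^2 <= 2 y^2 + 50 b^2 applied to [inner_error]. *)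
Definition inner_bound t : R :=
  Num.sqrt (2 * (((1 - alpha) ^+ t + alpha) * sigma_g ^+ 2) +
            50 * (C_g * eta * rn / alpha) ^+ 2).

Let alpha_pow_ge0 t : 0 <= (1 - alpha) ^+ t.
Proof. by rewrite exprn_ge0// subr_ge0 ltW. Qed.

Let inner_bound_arg_gt0 t : 0 < 2 * (((1 - alpha) ^+ t + alpha) * sigma_g ^+ 2) +
  50 * (C_g * eta * rn / alpha) ^+ 2.
Proof.
apply: ltr_pwDl; last by rewrite mulr_ge0 ?sqr_ge0.
by apply: mulr_gt0 => //; apply: mulr_gt0; [exact: ltr_wpDl|exact: exprn_gt0].
Qed.

Lemma inner_bound_gt0 t : 0 < inner_bound t.
Proof. by rewrite sqrtr_gt0. Qed.

Lemma inner_bound_sqr t : inner_bound t ^+ 2 =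
  2 * (((1 - alpha) ^+ t + alpha) * sigma_g ^+ 2) + 50 * (C_g * eta * rn / alpha) ^+ 2.
Proof. by rewrite sqr_sqrtr// ltW. Qed.

(** It lets the step from t to t + 1 be charged to [inner_bound t], so that one sum over t < T
    serves both drift and consensus. *)
Lemma inner_bound_leS t : inner_bound t.+1 <= inner_bound t.
Proof.
rewrite ler_sqrt; last exact: ltW.
rewrite lerD2r ler_wpM2l// ler_wpM2r ?sqr_ge0// lerD2r exprS.
by rewrite -[leRHS]mul1r ler_wpM2r// lerBlDr lerDl ltW.
Qed.

Definition inner_error_at t k w : 'cV[R]_d := u t k w - g k (sampled t k w).

Let measurable_of_past p q (A : O -> 'M[R]_(p, q)) t :
  adapted (past t) A -> measurable_mx A.
Proof. exact: adapted_measurable. Qed.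

Lemma measurable_inner_error t k : measurable_mx (inner_error_at t k).
Proof.
apply: measurable_mxB.
  by apply: (measurable_of_past (t := t.+1)); have [] := adapted_state t.
apply: (measurable_mx_comp_diff (g_diff k)).
by apply: (measurable_of_past (t := t)); exact: adapted_sampled.
Qed.

Lemma inner_error_moment t k :
  mean_le P (fun w => frob (inner_error_at t k w) ^+ 2) (inner_bound t ^+ 2).
Proof.
set b := C_g * eta * rn / alpha.
have b0 : 0 <= b.
  apply: divr_ge0; last exact: ltW.
  by apply: mulr_ge0; [apply: mulr_ge0; exact: ltW|exact: sqrtr_ge0].
have := mean_leD (mean_leZ 2 (inner_noise_avg_moment t k))
  (mean_le_cst_ge0 P (mulr_ge0 (ler0n R 50) (sqr_ge0 b))).
rewrite ger0_norm// -inner_bound_sqr; apply: mean_le_dominated.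
  by apply: measurable_sqr_frob; exact: measurable_inner_error.
move=> w; rewrite ger0_norm ?sqr_ge0//.
have := inner_error K_gt0 g_diff C_g_gt0 jac_le eta_gt0 alpha_gt0 alpha_lt1
  tau_gt0 alpha_tau (run w) t k.
rewrite -/(inner_noise_avg_at t k w) -/(sampled t k w) -/(inner_error_at t k w) -/b.
set x := frob (inner_error_at t k w); set y := frob (inner_noise_avg_at t k w).
have x0 : 0 <= x by exact: frob_ge0.
have y0 : 0 <= y by exact: frob_ge0.
move=> h; have := sqr_ge0 (y - 5 * b); have : x ^+ 2 <= (y + 5 * b) ^+ 2.
  by rewrite ler_pXn2r ?nnegrE ?addr_ge0// mulr_ge0.
lra.
Qed.

Definition grad_bias_at t k w : 'M[R]_(m, n) :=
  grad_bias g f gs W0 (fun t k => xi t k w) (fun t k => Wt t k w)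
    (fun t k => u t k w) t k.

Lemma measurable_sjac t k : measurable_mx (sjac_at t k).
Proof.
apply: (measurable_of_past (t := t.+1)); apply: adapted_sjac; last exact: past_inner.
by apply: (adapted_sub (@past_sub t)); exact: adapted_sampled.
Qed.

Lemma measurable_grad_bias t k : measurable_mx (grad_bias_at t k).
Proof.
have mu : measurable_mx (u t k).
  by apply: (measurable_of_past (t := t.+1)); have [] := adapted_state t.
have ms : measurable_mx (sampled t k).
  by apply: (measurable_of_past (t := t)); exact: adapted_sampled.
apply: measurable_mulmx_kron_id; first exact: measurable_sjac.
apply: measurable_mxB; first exact: (measurable_mx_comp_grad (f_diff k)).
apply: (measurable_mx_comp_grad (f_diff k)).
exact: (measurable_mx_comp_diff (g_diff k)).
Qed.

(** Stochastic Jacobian and inner error share [xi t k]; [mean_le_mul] separates them through their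
    second moments. *)
Let grad_bias_mean_of t k q : 0 < q ->
  mean_le P (fun w => frob (inner_error_at t k w) ^+ 2) (q ^+ 2) ->
  mean_le P (fun w => frob (grad_bias_at t k w)) (C_g * L_f * q).
Proof.
move=> q0 hq; have me := measurable_frob (measurable_inner_error t k).
have mj := measurable_frob (measurable_sjac t k).
have := mean_leZ L_f (mean_le_mul C_g_gt0 q0 (sjac_moment t k) hq mj me).
rewrite (ger0_norm Lf_ge0) mulrA (mulrC L_f); apply: mean_le_dominated.
  by apply: measurable_frob; exact: measurable_grad_bias.
move=> w; rewrite ger0_norm ?frob_ge0//; exact: frob_grad_bias.
Qed.

Lemma grad_bias_mean t k :
  mean_le P (fun w => frob (grad_bias_at t k w)) (C_g * L_f * inner_bound t).
Proof. by apply: grad_bias_mean_of; [exact: inner_bound_gt0|exact: inner_error_moment]. Qed.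

(** At time 0 the inner error is the bare sampling noise, whence sigma_g instead of
    [inner_bound 0]. *)
Lemma grad_bias_mean0 k :
  mean_le P (fun w => frob (grad_bias_at 0 k w)) (C_g * L_f * sigma_g).
Proof.
apply: grad_bias_mean_of => //; have := inner_noise_moment 0 k.
congr mean_le; apply/funext => w; congr (frob _ ^+ 2).
by rewrite /inner_error_at (init_u (run w)).
Qed.

Lemma grad_noise_mean t k : mean_le P (fun w => frob (grad_noise_at t k w)) S1.
Proof.
have S1_gt0 : 0 < S1 by rewrite addr_gt0// mulr_gt0.
apply: mean_le_sqrt => //.
  apply: measurable_frob; apply: (measurable_of_past (t := t.+1)).
  apply: adapted_grad_noise; [exact: past_sub|exact: past_inner|exact: past_outer].
apply: mean_le_weaken (grad_noise_moment t k).
have : 0 <= (C_g * sigma_f) * (C_f * sigma_dg) by rewrite !mulr_ge0// ltW.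
rewrite sqrrD -!exprMn; nra.
Qed.

Lemma grad_noise_avg_mean t :
  mean_le P (fun w => frob (grad_noise_avg_at t w)) (Num.sqrt (beta * (S2 / K%:R))).
Proof.
have S0 : 0 < beta * (S2 / K%:R).
  by rewrite mulr_gt0// divr_gt0 ?ltr0n// -!exprMn addr_gt0// exprn_gt0// mulr_gt0.
apply: mean_le_sqrt; first by rewrite sqrtr_gt0.
  by apply: measurable_frob; apply: (measurable_of_past (t := t.+1));
    exact: adapted_grad_noise_avg.
by rewrite sqr_sqrtr ?ltW//; exact: grad_noise_avg_moment.
Qed.

Definition drift_at t w : R :=
  drift g f C_g C_f L_g L_f gs fs eta beta tau W0 (fun t k => xi t k w)
    (fun t k => zeta t k w) (fun t k => Wt t k w) (fun t k => u t k w) t.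

Fixpoint drift_bound t : R :=
  if t is t'.+1 then
    (1 - beta) * drift_bound t' +
    (beta * (C_g * L_f * inner_bound t' + L_F * rho) + L_F * (eta * rn))
  else S1 + C_g * L_f * sigma_g.

Lemma drift_mean t : mean_le P (drift_at t) (drift_bound t).
Proof.
have ern : 0 <= eta * rn by rewrite mulr_ge0 ?sqrtr_ge0// ltW.
have rho0 : 0 <= rho by rewrite mulr_ge0// mulr_ge0 ?sqrtr_ge0// mulr_ge0// ltW.
elim: t => [|t IH].
  have := mean_leD (mean_le_mean (grad_noise_mean 0)) (mean_le_mean grad_bias_mean0).
  by rewrite !(mean_cst K_gt0).
have hB k : mean_le P (fun w => frob (grad_bias_at t.+1 k w))
    (C_g * L_f * inner_bound t).
  apply: mean_le_weaken (grad_bias_mean t.+1 k).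
  by rewrite ler_wpM2l ?inner_bound_leS// mulr_ge0// ltW.
have := mean_leD (mean_leZ (1 - beta) IH) (mean_leD (mean_leZ beta (mean_leD
  (mean_le_mean hB) (mean_le_cst_ge0 P (mulr_ge0 LF_ge0 rho0))))
  (mean_le_cst_ge0 P (mulr_ge0 LF_ge0 ern))).
rewrite (mean_cst K_gt0) (gtr0_norm beta_gt0) ger0_norm//.
by rewrite subr_ge0 ltW.
Qed.

Definition dispersion_bound t : R :=
  2 * S1 + 2 * (C_g * L_f * inner_bound t) + (2 * (L_F * rho) + delta).

(** The contraction factor 1 - beta between synchronizations is bounded by 1, which gives the shape
    required by [sum_reset]. *)
Fixpoint consensus_bound t : R :=
  if t is t'.+1 then
    if (tau %| t)%N then 0 else consensus_bound t' + beta * dispersion_bound t'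
  else 0.

Let trajW w := (fun t k => W t k w).
Let trajM w := (fun t k => M t k w).

Lemma measurable_consensus_error t :
  measurable_fun setT (fun w => consensus_error (trajM w) t).
Proof.
have mM k : measurable_mx (M t k).
  by apply: (measurable_of_past (t := t.+1)); have [] := adapted_state t.
apply: measurable_funM; first exact: measurable_cst.
apply: measurable_fun_sumR => k; apply: measurable_frob.
by apply: measurable_mxB; [exact: (mM k)|exact: (measurable_mx_avg mM)].
Qed.

Lemma consensus_error_ge0 w t : 0 <= consensus_error (trajM w) t.
Proof. by apply: mean_ge0 => // k; exact: frob_ge0. Qed.

Lemma consensus_mean t :
  mean_le P (fun w => consensus_error (trajM w) t) (consensus_bound t).
Proof.
elim: t => [|t IH].
  have := mean_le_cst_ge0 P (lexx 0); apply: mean_le_dominated.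
    exact: measurable_consensus_error.
  by move=> w; rewrite (consensus_error0 K_gt0 (run w)) normr0.
rewrite /=; case: ifPn => dv.
  have := mean_le_cst_ge0 P (lexx 0); apply: mean_le_dominated.
    exact: measurable_consensus_error.
  move=> w; rewrite ger0_norm ?consensus_error_ge0//.
  by have := consensus_errorS K_gt0 beta_gt0 beta_lt1 (run w) t; rewrite dv.
have hB k : mean_le P (fun w => frob (grad_bias_at t.+1 k w))
    (C_g * L_f * inner_bound t).
  apply: mean_le_weaken (grad_bias_mean t.+1 k).
  by rewrite ler_wpM2l ?inner_bound_leS// mulr_ge0// ltW.
have c0 : 0 <= 2 * (L_F * rho) + delta.
  rewrite addr_ge0// mulr_ge0// mulr_ge0// mulr_ge0// mulr_ge0 ?sqrtr_ge0//.
  by rewrite mulr_ge0// ltW.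
have := mean_leD IH (mean_leZ beta (mean_leD (mean_leD
  (mean_leZ 2 (mean_le_mean (grad_noise_mean t.+1))) (mean_leZ 2 (mean_le_mean hB)))
  (mean_le_cst_ge0 P c0))).
rewrite !(mean_cst K_gt0) (gtr0_norm beta_gt0) !(ger0_norm (ler0n R 2)).
apply: mean_le_dominated; first exact: measurable_consensus_error.
move=> w; rewrite ger0_norm ?consensus_error_ge0//.
have := consensus_errorS K_gt0 beta_gt0 beta_lt1 (run w) t; rewrite (negbTE dv).
have h := sample_grad_dispersion K_gt0 m_gt0 n_gt0 d_gt0 g_diff f_diff C_f_gt0
  jac_le grad_le dg_lip df_lip delta_ge0 heterogeneity eta_gt0 tau_gt0 (run w) t.+1.
move=> h'; apply: (le_trans h'); apply: lerD.
  by rewrite -[leRHS]mul1r ler_wpM2r ?consensus_error_ge0// lerBlDr lerDl ltW.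
by rewrite ler_wpM2l// ltW.
Qed.

Lemma measurable_objective_gradient t :
  measurable_fun setT (fun w => frob (grad (obj g f) (avg (fun k => W t k w)))).
Proof.
apply: measurable_frob; apply: (measurable_mx_comp_grad (obj_diff g_diff f_diff)).
apply: measurable_mx_avg => k; apply: (measurable_of_past (t := t.+1)).
by have [] := adapted_state t.
Qed.

Lemma objective_gradient_mean T Fstar : (forall V, Fstar <= obj g f V) ->
  mean_le P (fun w => \sum_(t < T) frob (grad (obj g f) (avg (fun k => W t k w))))
    ((obj g f W0 - Fstar) / eta +
     2 * rn * \sum_(t < T) (Num.sqrt (beta * (S2 / K%:R)) + drift_bound t +
       consensus_bound t) +
     T%:R * (L_F / 2 * (eta * n%:R))).
Proof.
move=> lb; have c0 : 0 <= (obj g f W0 - Fstar) / eta.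
  by apply: divr_ge0; [rewrite subr_ge0|exact: ltW].
have c1 : 0 <= T%:R * (L_F / 2 * (eta * n%:R)).
  apply: mulr_ge0 => //; apply: mulr_ge0; first exact: divr_ge0.
  by apply: mulr_ge0; [exact: ltW|exact: ler0n].
have rn0 : 0 <= 2 * rn by rewrite mulr_ge0 ?sqrtr_ge0.
have := mean_leD (mean_leD (mean_le_cst_ge0 P c0)
  (mean_leZ (2 * rn) (mean_le_sum (index_enum 'I_T) (fun t : 'I_T =>
     mean_leD (mean_leD (grad_noise_avg_mean t) (drift_mean t)) (consensus_mean t)))))
  (mean_le_cst_ge0 P c1).
rewrite (ger0_norm rn0); apply: mean_le_dominated.
  by apply: measurable_fun_sumR => t; exact: measurable_objective_gradient.
move=> w; rewrite ger0_norm; last by apply: sumr_ge0 => t _; exact: frob_ge0.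
rewrite -(ler_pM2l eta_gt0).
have := descent_sum K_gt0 m_gt0 n_gt0 d_gt0 g_diff f_diff C_f_gt0 jac_le grad_le
  dg_lip df_lip eta_gt0 (run w) T lb.
move=> h; apply: (le_trans h).
have hs : \sum_(t < T) (frob (tracking_error g f (trajW w) (trajM w) t) +
    consensus_error (trajM w) t) <=
  \sum_(t < T) (frob (grad_noise_avg_at t w) + drift_at t w + consensus_error (trajM w) t).
  apply: ler_sum => t _; rewrite lerD2r.
  exact: (frob_tracking_error K_gt0 m_gt0 n_gt0 d_gt0 g_diff f_diff C_f_gt0
    jac_le grad_le dg_lip df_lip eta_gt0 beta_gt0 beta_lt1 tau_gt0 (run w) t).
have E : eta * ((obj g f W0 - Fstar) / eta) = obj g f W0 - Fstar.
  by rewrite mulrC divfK// gt_eqF.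
have hs' := ler_wpM2l (mulr_ge0 rn0 (ltW eta_gt0)) hs.
rewrite !mulrDr E; apply: lerD; last first.
  by rewrite le_eqVlt; apply/orP; left; apply/eqP; ring.
by rewrite lerD2l (le_trans hs')// mulrA (mulrC eta).
Qed.

End fedcomuon.

(** * The final bound *)

Section recursions.
Context {R : realType}.
Implicit Types (r a h D q : nat -> R).

Lemma sum_contraction (beta : R) r a T :
  (forall t, r t.+1 = (1 - beta) * r t + a t) ->
  beta * \sum_(t < T) r t + r T = r 0%N + \sum_(t < T) a t.
Proof.
move=> rS; elim: T => [|T IH]; first by rewrite !big_ord0 mulr0 add0r addr0.
rewrite !big_ord_recr /= addrA -IH rS; ring.
Qed.

(* A quantity reset to 0 every [tau] steps keeps each increment for fewer than
   [tau] steps; [(tau - T %% tau) * D T] is what is still to be paid. *)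
Lemma sum_reset (tau : nat) D h T : (0 < tau)%N ->
  D 0%N = 0 -> (forall t, 0 <= h t) ->
  (forall t, D t.+1 = if (tau %| t.+1)%N then 0 else D t + h t) ->
  \sum_(t < T) D t <= tau%:R * \sum_(t < T) h t.
Proof.
move=> tau0 D0 h0 DS.
have D_ge0 t : 0 <= D t.
  by elim: t => [|t IH]; rewrite ?D0// DS; case: ifP => // _; rewrite addr_ge0.
suff H : \sum_(t < T) D t + (tau%:R - (T %% tau)%:R) * D T <=
    tau%:R * \sum_(t < T) h t.
  apply: le_trans H; rewrite lerDl mulr_ge0// subr_ge0 ler_nat.
  exact/ltnW/ltn_pmod.
elim: T => [|T IH]; first by rewrite !big_ord0 D0 !mulr0 addr0.
rewrite !big_ord_recr /=.
have p1 : (T %% tau)%:R + 1 <= tau%:R :> R by rewrite natr1 ler_nat ltn_pmod.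
have hT : 0 <= tau%:R * h T by rewrite mulr_ge0.
have pD : 0 <= (tau%:R - ((T %% tau)%:R + 1)) * D T by rewrite mulr_ge0// subr_ge0.
rewrite DS; case: ifPn => dv; first by rewrite mulr0; lra.
have -> : (T.+1 %% tau = (T %% tau).+1)%N by rewrite modnS (negbTE dv).
rewrite -[(T %% tau).+1%:R]natr1.
have ph : 0 <= ((T %% tau)%:R + 1) * h T by rewrite mulr_ge0// addr_ge0.
lra.
Qed.

Lemma sum_sqrt_le q T : (0 < T)%N -> (forall t, 0 <= q t) ->
  \sum_(t < T) Num.sqrt (q t) <= T%:R * Num.sqrt (T%:R^-1 * \sum_(t < T) q t).
Proof.
move=> T0 q0; have Tp : 0 < T%:R :> R by rewrite ltr0n.
rewrite -ler_pdivrMl//.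
have := sqr_mean_le T0 (fun t : 'I_T => Num.sqrt (q t)).
rewrite [leRHS](_ : _ = T%:R^-1 * \sum_(t < T) q t); last first.
  by congr (_ * _); apply: eq_bigr => t _; rewrite sqr_sqrtr.
rewrite -/(mean (fun t : 'I_T => Num.sqrt (q t))); set x := mean _ => h.
have x0 : 0 <= x by apply: mean_ge0 => // t; exact: sqrtr_ge0.
rewrite -[x](ger0_norm x0) -sqrtr_sqr ler_sqrt// mulr_ge0 ?invr_ge0 ?ler0n//.
by apply: sumr_ge0.
Qed.

(** The case a = 0 of [sum_contraction]. *)
Lemma sum_geometric_le (alpha : R) T : 0 < alpha -> alpha < 1 ->
  \sum_(t < T) (1 - alpha) ^+ t <= alpha^-1.
Proof.
move=> a0 a1; rewrite -[leRHS]mul1r ler_pdivlMr// mulrC.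
have := @sum_contraction alpha (fun t => (1 - alpha) ^+ t) (fun=> 0) T.
rewrite big1_eq /= expr0 addr0 => H.
rewrite -[leRHS]H => [|t]; last by rewrite exprS addr0.
by rewrite lerDl exprn_ge0// subr_ge0 ltW.
Qed.

End recursions.

(** Here SR, SD and Q stand for the sums over t < T of the drift, consensus and inner bounds, and zb
    for the bound on the averaged gradient noise. *)
Lemma final_bound_arith (R : realType) (G eta Tr rn nr S1 C s beta tau A LF delta zb
    SR SD Q : R) :
  0 < eta -> 0 < Tr -> 0 <= rn -> rn ^+ 2 = nr -> 0 < beta -> 0 <= tau -> 0 <= C ->
  0 <= LF -> Q <= Tr * A ->
  beta * SR <= S1 + C * s + (beta * (C * Q + Tr * (LF * (2 * eta * rn * tau))) +
     Tr * (LF * (eta * rn))) ->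
  SD <= tau * (beta * (Tr * (2 * S1) + 2 * (C * Q) +
     Tr * (2 * (LF * (2 * eta * rn * tau)) + delta))) ->
  Tr^-1 * (G / eta + 2 * rn * (Tr * zb + SR + SD) + Tr * (LF / 2 * (eta * nr))) <=
  G / (eta * Tr) + 2 * rn * C * s / (beta * Tr) +
  2 * rn * (1 / (beta * Tr) + 2 * beta * tau) * S1 +
  2 * rn * C * (1 + 2 * beta * tau) * A +
  eta * nr * LF * (1 / 2 + 4 * tau + 6 / beta + 8 * beta * tau ^+ 2) +
  2 * rn * beta * tau * delta + 2 * rn * zb.
Proof.
move=> eta0 T0 rn0 <- beta0 tau0 C0 LF0 QA hR hD.
have bt0 : 0 <= beta * tau by rewrite mulr_ge0// ltW.
have hR' : SR <= (S1 + C * s) / beta + C * (Tr * A) +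
    Tr * (LF * (2 * eta * rn * tau)) + Tr * (LF * (eta * rn)) / beta.
  rewrite -(ler_pM2l beta0) (le_trans hR)//.
  have -> : beta * ((S1 + C * s) / beta + C * (Tr * A) +
    Tr * (LF * (2 * eta * rn * tau)) + Tr * (LF * (eta * rn)) / beta) =
    S1 + C * s + (beta * (C * (Tr * A) + Tr * (LF * (2 * eta * rn * tau))) +
     Tr * (LF * (eta * rn))) by field; rewrite gt_eqF.
  by rewrite lerD2l lerD2r ler_wpM2l ?lerD2r ?ler_wpM2l// ltW.
have hD' : SD <= tau * (beta * (Tr * (2 * S1) + 2 * (C * (Tr * A)) +
     Tr * (2 * (LF * (2 * eta * rn * tau)) + delta))).
  rewrite (le_trans hD)// ler_wpM2l// ler_wpM2l ?(ltW beta0)//.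
  by rewrite lerD2r lerD2l !ler_wpM2l.
have h := ler_wpM2l (mulr_ge0 (ler0n R 2) rn0) (lerD (lerD (lexx (Tr * zb)) hR') hD').
rewrite ler_pdivrMl//.
(* This is the whole slack: 2 / beta comes out and 6 / beta is claimed. *)
have e0 : 0 <= 4 * (Tr * (eta * rn ^+ 2 * LF)) / beta.
  rewrite divr_ge0 ?(ltW beta0)// mulr_ge0// mulr_ge0 ?(ltW T0)// mulr_ge0//.
  by rewrite mulr_ge0 ?sqr_ge0// ltW.
apply: (le_trans (lerD (lerD (lexx _) h) (lexx _))); rewrite -subr_ge0.
move: e0; congr (0 <= _); field; rewrite !gt_eqF//.
Qed.

Theorem theorem1 (R : realType) (K m n d : nat)
  (K_gt0 : (0 < K)%N) (m_gt0 : (0 < m)%N) (n_gt0 : (0 < n)%N)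
  (d_gt0 : (0 < d)%N)
  (* sample spaces and sampling distributions of the clients *)
  (dX dZ : measure_display)
  (X : 'I_K -> measurableType dX) (Z : 'I_K -> measurableType dZ)
  (Dg : forall k, probability (X k) R) (Df : forall k, probability (Z k) R)
  (* stochastic inner and outer functions, and their expectations *)
  (gs : forall k, 'M[R]_(m, n) -> X k -> 'cV[R]_d)
  (fs : forall k, 'cV[R]_d -> Z k -> R)
  (g : 'I_K -> 'M[R]_(m, n) -> 'cV[R]_d)
  (f : 'I_K -> 'cV[R]_d -> R)
  (gs_diff : forall k x (W : 'M[R]_(m, n)),
    differentiable (fun V : 'M[R]_(m, n) => gs k V x) W)
  (fs_diff : forall k z (y : 'cV[R]_d),
    differentiable (fun y' : 'cV[R]_d => fs k y' z) y)
  (g_diff : forall k (W : 'M[R]_(m, n)), differentiable (g k) W)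
  (f_diff : forall k (y : 'cV[R]_d), differentiable (f k) y)
  (g_mean : forall k W, has_mean (Dg k) (gs k W) (g k W))
  (f_integrable : forall k y, (Df k).-integrable setT (EFin \o fs k y))
  (f_mean : forall k y, ('E_(Df k)[fs k y] = (f k y)%:E)%E)
  (* (1) *)
  (F_lower : has_lbound (range (obj g f)))
  (* (2) *)
  (sigma_g sigma_dg sigma_f : R)
  (sigma_g_gt0 : 0 < sigma_g) (sigma_dg_gt0 : 0 < sigma_dg)
  (sigma_f_gt0 : 0 < sigma_f)
  (dg_mean : forall k W,
    has_mean (Dg k) (fun x => jac (fun V => gs k V x) W) (jac (g k) W))
  (df_mean : forall k y,
    has_mean (Df k) (fun z => grad (fun y' => fs k y' z) y) (grad (f k) y))
  (g_var : forall k W,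
    ('E_(Dg k)[fun x => (frob (gs k W x - g k W) ^+ 2)%R]
     <= (sigma_g ^+ 2)%:E)%E)
  (dg_var : forall k W,
    ('E_(Dg k)[fun x =>
        (frob (jac (fun V => gs k V x) W - jac (g k) W) ^+ 2)%R]
     <= (sigma_dg ^+ 2)%:E)%E)
  (df_var : forall k y,
    ('E_(Df k)[fun z =>
        (frob (grad (fun y' => fs k y' z) y - grad (f k) y) ^+ 2)%R]
     <= (sigma_f ^+ 2)%:E)%E)
  (* (3) *)
  (C_g C_f : R) (C_g_gt0 : 0 < C_g) (C_f_gt0 : 0 < C_f)
  (dg_moment : forall k W,
    ('E_(Dg k)[fun x => (frob (jac (fun V => gs k V x) W) ^+ 2)%R]
     <= (C_g ^+ 2)%:E)%E)
  (df_moment : forall k y,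
    ('E_(Df k)[fun z => (frob (grad (fun y' => fs k y' z) y) ^+ 2)%R]
     <= (C_f ^+ 2)%:E)%E)
  (* (4) *)
  (L_g L_f : R)
  (dg_lip : forall k W1 W2,
    frob (jac (g k) W1 - jac (g k) W2) <= L_g * frob (W1 - W2))
  (df_lip : forall k y1 y2,
    frob (grad (f k) y1 - grad (f k) y2) <= L_f * frob (y1 - y2))
  (* (5) *)
  (delta : R) (delta_ge0 : 0 <= delta)
  (heterogeneity : forall W,
    K%:R^-1 *
      \sum_k frob (grad (client_obj g f k) W - grad (obj g f) W) ^+ 2
    <= delta ^+ 2)
  (* the samples drawn by the algorithm *)
  (dO : measure_display) (O : measurableType dO) (P : probability O R)
  (xi : forall (t : nat) (k : 'I_K), {RV P >-> X k})
  (zeta : forall (t : nat) (k : 'I_K), {RV P >-> Z k})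
  (xi_distr : forall t k A, measurable A -> distribution P (xi t k) A = Dg k A)
  (zeta_distr : forall t k A, measurable A ->
    distribution P (zeta t k) A = Df k A)
  (samples_indep : mutually_independent P (sample_events xi zeta))
  (* the algorithm *)
  (eta alpha beta : R) (tau : nat) (W0 : 'M[R]_(m, n))
  (eta_gt0 : 0 < eta)
  (alpha_gt0 : 0 < alpha) (alpha_lt1 : alpha < 1)
  (beta_gt0 : 0 < beta) (beta_lt1 : beta < 1)
  (tau_gt0 : (0 < tau)%N) (alpha_tau : alpha * tau%:R <= 1)
  (W Wt : nat -> 'I_K -> O -> 'M[R]_(m, n))
  (u : nat -> 'I_K -> O -> 'cV[R]_d)
  (M Mt : nat -> 'I_K -> O -> 'M[R]_(m, n))
  (run : forall w, FedCoMuon gs fs eta alpha beta tau W0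
    (fun t k => xi t k w) (fun t k => zeta t k w)
    (fun t k => W t k w) (fun t k => Wt t k w) (fun t k => u t k w)
    (fun t k => M t k w) (fun t k => Mt t k w))
  (T : nat) (T_gt0 : (0 < T)%N) :
  let F := obj g f in
  let Fstar := inf (range F) in
  let L_F := C_f * L_g + C_g ^+ 2 * L_f in
  let taur : R := tau%:R in
  let nr : R := n%:R in
  let Tr : R := T%:R in
  ((Tr^-1)%:E *
     \sum_(0 <= t < T) 'E_P[fun w => frob (grad F (avg (fun k => W t k w)))]
   <= ((F W0 - Fstar) / (eta * Tr)
       + 2 * Num.sqrt nr * C_g * L_f * sigma_g / (beta * Tr)
       + 2 * Num.sqrt nr * (1 / (beta * Tr) + 2 * beta * taur)
           * (C_g * sigma_f + C_f * sigma_dg)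
       + 2 * Num.sqrt nr * C_g * L_f * (1 + 2 * beta * taur)
           * Num.sqrt (4 * sigma_g ^+ 2 / (alpha * Tr)
                       + 86 * C_g ^+ 2 * nr / alpha ^+ 2 * eta ^+ 2
                       + 86 * alpha * sigma_g ^+ 2)
       + eta * nr * L_F
           * (1 / 2 + 4 * taur + 6 / beta + 8 * beta * taur ^+ 2)
       + 2 * Num.sqrt nr * beta * taur * delta
       + 2 * Num.sqrt (nr * beta) / Num.sqrt K%:R
           * Num.sqrt (C_g ^+ 2 * sigma_f ^+ 2
                       + C_f ^+ 2 * sigma_dg ^+ 2))%:E)%E.
Proof.
cbv zeta; set F := obj g f; set Fstar := inf (range F).
set L_F := C_f * L_g + C_g ^+ 2 * L_f.
set taur : R := tau%:R; set nr : R := n%:R; set Tr : R := T%:R.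
have lb V : Fstar <= obj g f V by apply: ge_inf; last by exists V.
have Tp : 0 < Tr by rewrite ltr0n.
have H := objective_gradient_mean K_gt0 m_gt0 n_gt0 d_gt0 gs_diff fs_diff g_diff
  f_diff g_mean f_integrable sigma_g_gt0 sigma_dg_gt0 sigma_f_gt0 dg_mean df_mean
  g_var dg_var df_var C_g_gt0 C_f_gt0 dg_moment df_moment dg_lip df_lip delta_ge0
  heterogeneity xi_distr zeta_distr samples_indep eta_gt0 alpha_gt0 alpha_lt1
  beta_gt0 beta_lt1 tau_gt0 alpha_tau run T lb.
set ib := inner_bound n sigma_g C_g eta alpha.
set r := drift_bound n sigma_g sigma_dg sigma_f C_g C_f L_g L_f eta alpha beta tau in H.
set D := consensus_bound n sigma_g sigma_dg sigma_f C_g C_f L_g L_f delta eta alpha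
  beta tau in H.
set rn := Num.sqrt n%:R in H *.
set zb := Num.sqrt (beta * _) in H.
set A := Num.sqrt (4 * sigma_g ^+ 2 / (alpha * Tr) + _ + _).
have rn0 : 0 <= rn by exact: sqrtr_ge0.
have Lf0 : 0 <= L_f by exact: (L_f_ge0 K_gt0 d_gt0 df_lip).
have LF0 : 0 <= L_F by exact: (L_F_ge0 K_gt0 m_gt0 n_gt0 d_gt0 C_g C_f_gt0 dg_lip df_lip).
have C0 : 0 <= C_g * L_f by rewrite mulr_ge0// ltW.
have ib0 t : 0 <= ib t by exact: sqrtr_ge0.
have rn2 : rn ^+ 2 = nr by rewrite sqr_sqrtr.
have rho0 : 0 <= L_F * (2 * eta * rn * taur).
  by rewrite mulr_ge0// mulr_ge0// mulr_ge0// mulr_ge0// ltW.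
have S10 : 0 <= C_g * sigma_f + C_f * sigma_dg.
  by rewrite addr_ge0// mulr_ge0// ltW.
have hQ : \sum_(t < T) ib t <= Tr * A.
  have q0 t : 0 <= 2 * (((1 - alpha) ^+ t + alpha) * sigma_g ^+ 2) +
      50 * (C_g * eta * rn / alpha) ^+ 2.
    apply: addr_ge0; last by rewrite mulr_ge0 ?sqr_ge0.
    apply: mulr_ge0 => //; apply: mulr_ge0; last exact: sqr_ge0.
    by apply: addr_ge0; [rewrite exprn_ge0// subr_ge0 ltW|exact: ltW].
  apply: (le_trans (sum_sqrt_le T_gt0 q0)); rewrite ler_wpM2l ?(ltW Tp)//.
  have hg := sum_geometric_le T alpha_gt0 alpha_lt1.
  have E : \sum_(t < T) (2 * (((1 - alpha) ^+ t + alpha) * sigma_g ^+ 2) +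
      50 * (C_g * eta * rn / alpha) ^+ 2) =
    2 * sigma_g ^+ 2 * \sum_(t < T) (1 - alpha) ^+ t +
    Tr * (2 * (alpha * sigma_g ^+ 2) + 50 * (C_g * eta * rn / alpha) ^+ 2).
    rewrite (eq_bigr (fun t : 'I_T => 2 * sigma_g ^+ 2 * (1 - alpha) ^+ t +
      (2 * (alpha * sigma_g ^+ 2) + 50 * (C_g * eta * rn / alpha) ^+ 2))); last first.
      by move=> t _; ring.
    by rewrite big_split /= sumr_const card_ord -[_ *+ T]mulr_natl -mulr_sumr.
  apply: ler_wsqrtr; rewrite E -subr_ge0.
  have g1 : 0 <= 2 * sigma_g ^+ 2 / Tr * (alpha^-1 - \sum_(t < T) (1 - alpha) ^+ t).
    by rewrite mulr_ge0 ?subr_ge0// divr_ge0 ?(ltW Tp)// mulr_ge0 ?sqr_ge0.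
  (* The gap between the claimed 4, 86, 86 and the 2, 50, 2 obtained from [inner_bound]; [g1]
     accounts for the geometric sum. *)
  have g2 : 0 <= 2 * sigma_g ^+ 2 / (alpha * Tr) + 84 * alpha * sigma_g ^+ 2 +
      36 * (C_g ^+ 2 * nr * eta ^+ 2 / alpha ^+ 2).
    rewrite !addr_ge0//.
    - by rewrite divr_ge0 ?mulr_ge0 ?sqr_ge0// ltW.
    - by rewrite mulr_ge0 ?sqr_ge0// mulr_ge0// ltW.
    - apply: mulr_ge0 => //; apply: divr_ge0; last exact: sqr_ge0.
      apply: mulr_ge0; last exact: sqr_ge0.
      by apply: mulr_ge0; [exact: sqr_ge0|exact: ler0n].
  move: (addr_ge0 g1 g2); congr (0 <= _); rewrite -rn2; field.
  by rewrite !gt_eqF.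
have hR : beta * \sum_(t < T) r t <= C_g * sigma_f + C_f * sigma_dg + C_g * L_f * sigma_g +
   (beta * (C_g * L_f * (\sum_(t < T) ib t) + Tr * (L_F * (2 * eta * rn * taur))) +
     Tr * (L_F * (eta * rn))).
  pose a t := beta * (C_g * L_f * ib t + L_F * (2 * eta * rn * taur)) + L_F * (eta * rn).
  have ern0 : 0 <= L_F * (eta * rn) by rewrite mulr_ge0// mulr_ge0// ltW.
  have r0 t : 0 <= r t.
    elim: t => [|t IH]; first by rewrite addr_ge0// mulr_ge0// ltW.
    rewrite /r /= addr_ge0//; first by rewrite mulr_ge0// subr_ge0 ltW.
    rewrite addr_ge0// mulr_ge0 ?(ltW beta_gt0)// addr_ge0// mulr_ge0//.
  have := @sum_contraction _ beta r a T (fun t => erefl).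
  have -> : \sum_(t < T) a t = beta * (C_g * L_f * \sum_(t < T) ib t +
      Tr * (L_F * (2 * eta * rn * taur))) + Tr * (L_F * (eta * rn)).
    rewrite big_split /= sumr_const card_ord -[_ *+ T]mulr_natl -mulr_sumr.
    by rewrite big_split /= sumr_const card_ord -[_ *+ T]mulr_natl -mulr_sumr.
  by move=> <-; rewrite lerDl.
have hD : \sum_(t < T) D t <= taur * (beta * (Tr * (2 * (C_g * sigma_f + C_f * sigma_dg))
     + 2 * (C_g * L_f * (\sum_(t < T) ib t)) +
     Tr * (2 * (L_F * (2 * eta * rn * taur)) + delta))).
  pose h t := beta * dispersion_bound n sigma_g sigma_dg sigma_f C_g C_f L_g L_f
    delta eta alpha tau t.
  have h0 t : 0 <= h t.
    rewrite mulr_ge0 ?(ltW beta_gt0)// addr_ge0//; last first.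
      by rewrite addr_ge0// mulr_ge0.
    by rewrite addr_ge0// mulr_ge0// mulr_ge0.
  have := @sum_reset _ tau D h T tau_gt0 erefl h0 (fun t => erefl).
  congr (_ <= _ * _); rewrite -mulr_sumr; congr (_ * _).
  rewrite big_split /= sumr_const card_ord -[_ *+ T]mulr_natl; congr (_ + _).
  rewrite big_split /= sumr_const card_ord -[_ *+ T]mulr_natl; congr (_ + _).
  by rewrite -!mulr_sumr.
have := final_bound_arith (obj g f W0 - Fstar) zb eta_gt0 Tp rn0 (sqr_sqrtr (ler0n R n))
  beta_gt0 (ler0n R tau) C0 LF0 hQ hR hD.
set U := (X in X <= _) => hU.
have E : U = Tr^-1 * ((obj g f W0 - Fstar) / eta +
   2 * rn * \sum_(t < T) (zb + r t + D t) + Tr * (L_F / 2 * (eta * nr))).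
  rewrite /U !big_split /= sumr_const card_ord -[zb *+ T]mulr_natl; ring.
apply: (@le_trans _ _ U%:E).
  rewrite big_mkord E EFinM lee_wpmul2l ?lee_fin ?invr_ge0 ?ler0n//.
  have eE (h : O -> R) : ('E_P[h] = \int[P]_w (h w)%:E)%E by rewrite unlock.
  have := mean_le_expectation H (fun w => sumr_ge0 _ (fun t _ => frob_ge0 _)).
  apply: le_trans; rewrite eE; under eq_bigr do rewrite eE.
  rewrite -ge0_integral_sum//; last first.
    by move=> t w _; rewrite lee_fin frob_ge0.
  - move=> t; apply/measurable_EFinP.
    exact: (measurable_objective_gradient gs_diff fs_diff g_diff f_diff g_mean
      f_integrable eta_gt0 run).
  by under eq_integral do rewrite sumEFin.
rewrite lee_fin (le_trans hU)// le_eqVlt; apply/orP; left; apply/eqP.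
(* Multiplied by 2 sqrt n, this is the last term of the claim. *)
have -> : zb = Num.sqrt beta / Num.sqrt K%:R *
    Num.sqrt (C_g ^+ 2 * sigma_f ^+ 2 + C_f ^+ 2 * sigma_dg ^+ 2).
  rewrite /zb [X in beta * X]mulrC mulrA sqrtrM; last by rewrite divr_ge0// ltW.
  by rewrite sqrtrM ?(ltW beta_gt0)// sqrtrV.
rewrite sqrtrM // -/rn /F /taur /nr /Tr /rn /A; ring.
Qed.
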